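(* Let $\varphi$ be an Orlicz $N$-function, let $w$ be a weight function on $I=[0,\gamma)$, $0<\gamma\le\infty$, and let $F$ be a bounded linear functional on $\Lambda^0_{\varphi,w}$ (with the Orlicz norm). Then $F=H+S$, where $H(f)=\int_Ifh$ for all $f\in\Lambda^0_{\varphi,w}$, for some $h\in\mathcal M_{\varphi_*,w}$, with $\|H\|=\|h\|_{\mathcal M_{\varphi_*,w}}$; $S$ is a bounded linear functional on $\Lambda^0_{\varphi,w}$ with $S(f)=0$ for all $f\in(\Lambda_{\varphi,w})_a$; and $$\|F\|=\inf\Big\{\lambda>0:\ P_{\varphi_*,w}\Big(\frac h\lambda\Big)+\frac1\lambda\|S\|\le1\Big\},$$ where $\|F\|$, $\|H\|$, $\|S\|$ are norms in $(\Lambda^0_{\varphi,w})^*$.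
   Context: An Orlicz function is a convex function $\varphi:[0,\infty)\to[0,\infty)$ with $\varphi(0)=0$ and $\varphi(t)>0$ for $t>0$. It is an $N$-function if $\lim_{t\to0}\varphi(t)/t=0$ and $\lim_{t\to\infty}\varphi(t)/t=\infty$. The complementary function is $\varphi_*(v)=\sup\{uv-\varphi(u):u\ge0\}$, $v\ge0$; it is an $N$-function when $\varphi$ is. $I=[0,\gamma)$, $0<\gamma\le\infty$, with Lebesgue measure $m$; $L^0$ is the set of (classes of) Lebesgue measurable functions $f:I\to\mathbb R$. For $f\in L^0$, $d_f(\lambda)=m\{t\in I:|f(t)|>\lambda\}$ for $\lambda>0$, and $f^*(t)=\inf\{\lambda>0:d_f(\lambda)\le t\}$, $t\in[0,\gamma)$. A weight function $w:I\to(0,\infty)$ is decreasing (non-increasing) and locally integrable, with $W(t)=\int_0^tw<\infty$ for $t\in I$, and $W(\infty)=\infty$ if $\gamma=\infty$. Put $\rho_{\varphi,w}(f)=\int_0^\gamma\varphi(f^*(t))w(t)\,dt$. The Orlicz-Lorentz space is the set of all $f\in L^0$ with $\rho_{\varphi,w}(\lambda f)<\infty$ for some $\lambda>0$; it is denoted $\Lambda_{\varphi,w}$ with the Luxemburg norm $\|f\|=\inf\{\epsilon>0:\rho_{\varphi,w}(f/\epsilon)\le1\}$ and $\Lambda^0_{\varphi,w}$ with the (equivalent) Orlicz norm $\|f\|^0=\sup\{\int_If^*g^*w:g\in L^0,\ \rho_{\varphi_*,w}(g)\le1\}$. The order-continuous subspace $(\Lambda_{\varphi,w})_a=(\Lambda^0_{\varphi,w})_a$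 consists of all $f$ such that $\|f_n\|\downarrow0$ whenever $0\le f_n\le|f|$, $f_n\downarrow0$ a.e.; it equals $\{f:\rho_{\varphi,w}(\lambda f)<\infty\ \text{for all}\ \lambda>0\}$. For an Orlicz function $\psi$ and $h\in L^0$ put $P_{\psi,w}(h)=\inf\{\int_I\psi(|h|/v)\,v:\ v\prec w\}$, where $v\ge0$ ranges over measurable functions and $v\prec w$ means $\int_0^tv^*\le\int_0^tw$ for all $t\in(0,\gamma)$; where $v=0$ the integrand $\psi(|h|/v)v$ is $0$ if $h=0$ and $\infty$ if $h\ne0$. $\mathcal M_{\psi,w}$ is the set of $h\in L^0$ with $P_{\psi,w}(\lambda h)<\infty$ for some $\lambda>0$, equipped with the norm $\|h\|_{\mathcal M_{\psi,w}}=\inf\{\epsilon>0:P_{\psi,w}(h/\epsilon)\le1\}$. *)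

(* Defs.v *)
From HB Require Import structures.
From mathcomp Require Import all_boot all_order all_algebra.
From mathcomp Require Import all_classical all_reals all_analysis.
Set Implicit Arguments.
Unset Strict Implicit.
Unset Printing Implicit Defensive.
Import Order.TTheory GRing.Theory Num.Theory.
Import numFieldNormedType.Exports.
Local Open Scope classical_set_scope.
Local Open Scope ring_scope.

(* An element of L^0 is represented by a function R -> R that is measurable on
   I = [0, gamma); its values outside I play no role.  Measurability is with
   respect to the Borel sets: every class of Lebesgue measurable functions
   modulo a.e. equality has a Borel representative. *)

Section orlicz_functions.
Context {R : realType}.
Implicit Types phi : R -> R.

(* Only the values of phi on [0, +oo) matter. *)
Definition orlicz_function phi : Prop :=
  [/\ convex_function (`[0, +oo[ : set R) phi,
      phi 0 = 0
    & forall t : R, 0 < t -> 0 < phi t].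

Definition N_function phi : Prop :=
  [/\ orlicz_function phi,
      phi t / t @[t --> 0^'+] --> 0
    & phi t / t @[t --> +oo] --> +oo].

(* The supremum is that of a bounded set when phi is an N-function. *)
Definition complementary phi (v : R) : R :=
  sup [set u * v - phi u | u in `[0, +oo[].

(* phi extended by phi(+oo) = +oo; needed since f^* may be infinite. *)
Definition ext_fun phi (x : \bar R) : \bar R := er_map phi x.

End orlicz_functions.

Section orlicz_lorentz.
Context {R : realType}.
Variable gamma : \bar R.
Local Notation mu := (@lebesgue_measure R).
Implicit Types (phi psi w f g h v : R -> R) (F : (R -> R) -> R).

Definition dom : set R := [set t | 0 <= t /\ (t%:E < gamma)%E].

Definition L0 : set (R -> R) := [set f | measurable_fun dom f].

Definition distr_fun f (lambda : R) : \bar R :=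
  mu [set t | dom t /\ lambda < `|f t|].

Definition rearr f (t : R) : \bar R :=
  ereal_inf [set lambda%:E | lambda in
    [set lambda | 0 < lambda /\ (distr_fun f lambda <= t%:E)%E]].

(* Monotonicity is required on (0, gamma) only: w is defined up to null sets,
   and a monotonicity constraint at 0 would exclude weights such as
   t^(-1/2), which are unbounded near 0. *)
Definition weight w : Prop :=
  [/\ forall t, dom t -> 0 < w t,
      forall s t : R, 0 < s -> s <= t -> (t%:E < gamma)%E -> w t <= w s,
      forall t, dom t -> (\int[mu]_(x in `[0%R, t]) (w x)%:E < +oo)%E
    & gamma = +oo%E -> (\int[mu]_(x in dom) (w x)%:E = +oo)%E].

Definition rho phi w f : \bar R :=
  (\int[mu]_(t in dom) (ext_fun phi (rearr f t) * (w t)%:E))%E.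

Definition Lambda phi w : set (R -> R) :=
  [set f | L0 f /\
    exists2 lambda : R, 0 < lambda & (rho phi w (lambda \*o f) < +oo)%E].

Definition luxemburg_norm phi w f : \bar R :=
  ereal_inf [set eps%:E | eps in
    [set eps | 0 < eps /\ (rho phi w (eps^-1 \*o f) <= 1)%E]].

Definition orlicz_norm phi w f : \bar R :=
  ereal_sup [set (\int[mu]_(t in dom) (rearr f t * rearr g t * (w t)%:E))%E
    | g in [set g | L0 g /\ (rho (complementary phi) w g <= 1)%E]].

Definition Lambda_a phi w : set (R -> R) :=
  [set f | Lambda phi w f /\
    forall fn : nat -> R -> R,
      (forall n, L0 (fn n)) ->
      (\forall t \ae mu, dom t ->
        [/\ forall n, 0 <= fn n t <= `|f t|,
            nonincreasing_seq (fn ^~ t)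
          & fn n t @[n --> \oo] --> 0]) ->
      nonincreasing_seq (fun n => luxemburg_norm phi w (fn n)) /\
      (luxemburg_norm phi w (fn n) @[n --> \oo] --> 0%E)].

Definition submaj v w : Prop :=
  forall t : R, 0 < t -> (t%:E < gamma)%E ->
    (\int[mu]_(s in `[0%R, t]) rearr v s <= \int[mu]_(s in `[0%R, t]) (w s)%:E)%E.

(* psi(|h| / v) v at a point, for h = a and v = b. *)
Definition P_integrand psi (a b : R) : \bar R :=
  if b == 0 then (if a == 0 then 0%E else +oo%E)
  else (psi (`|a| / b) * b)%:E.

Definition P psi w h : \bar R :=
  ereal_inf [set (\int[mu]_(t in dom) P_integrand psi (h t) (v t))%E
    | v in [set v | [/\ L0 v, forall t, dom t -> 0 <= v t & submaj v w]]].

Definition M_space psi w : set (R -> R) :=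
  [set h | L0 h /\
    exists2 lambda : R, 0 < lambda & (P psi w (lambda \*o h) < +oo)%E].

Definition M_norm psi w h : \bar R :=
  ereal_inf [set eps%:E | eps in
    [set eps | 0 < eps /\ (P psi w (eps^-1 \*o h) <= 1)%E]].

(* Elements of the dual of Lambda^0: functionals on representatives which are
   compatible with a.e. equality; values off Lambda are irrelevant. *)
Definition dual_Lambda0 phi w F : Prop :=
  [/\ forall f g, Lambda phi w f -> Lambda phi w g ->
        f = g %[ae mu in dom] -> F f = F g,
      forall (a : R) f g, Lambda phi w f -> Lambda phi w g ->
        F (a \*o f \+ g) = a * F f + F g
    & exists C : R, forall f, Lambda phi w f ->
        (`|F f|%:E <= C%:E * orlicz_norm phi w f)%E].

Definition dual_norm phi w F : \bar R :=
  ereal_sup [set `|F f|%:E | f in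
    [set f | Lambda phi w f /\ (orlicz_norm phi w f <= 1)%E]].

End orlicz_lorentz.

(* Main.v *)
(* On bounded functions with bounded support F is absolutely continuous, so by
   Radon-Nikodym it is integration against some h there.  Writing
   H f = \int f h and S = F - H, the functional S vanishes on these functions,
   hence S f = S (f 1_C) for the sets C = {|f| > n} \cup [n, gamma), on which the
   modular of f becomes arbitrarily small.  Everything is controlled through the
   Amemiya formula ||f||^0 = inf_m m (1 + rho (f / m)).

   If P (h / l) + ||S|| / l <= 1, Young's inequality bounds \int f h / l by
   rho f + P (h / l) while |S f| <= ||S||, so ||F|| <= l by Amemiya.  Conversely,
   for f bounded with bounded support and g in the unit ball, gluing f off C to
   g on C gives F f + S g <= ||F|| (1 + rho f), that is
     \int f |h| / l - rho f <= 1 - ||S|| / l =: K   for all l >= ||F||.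
   Since rho f is the supremum of \int phi(|f|) v over v \prec w, it remains to
   exchange a supremum and an infimum: find one v \prec w such that
   \int f |h| / l - \int phi(|f|) v <= K for all f.  This is Hahn-Banach for the
   sublinear functional u |-> inf (\sum_j c_j W(|E_j|) - s (\int f |h| / l - K))
   over u + s phi(f) <= \sum_j c_j 1_{E_j}; the functional it yields has a density
   v, and v \prec w because \int_E v <= W(|E|) for all E.  Taking for f the
   maximizers of u |h| / l - phi(u) v gives P (h / l) <= K.  The norm of H is the
   case S = 0. *)

Require Import Defs.
From HB Require Import structures.
From mathcomp Require Import all_boot all_order all_algebra.
From mathcomp Require Import all_classical all_reals all_analysis.
From mathcomp Require Import measurable_realfun ring lra.
Set Implicit Arguments.
Unset Strict Implicit.
Unset Printing Implicit Defensive.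
Import Order.TTheory GRing.Theory Num.Theory.
Import numFieldNormedType.Exports.
Local Open Scope classical_set_scope.
Local Open Scope ring_scope.

(** * Orlicz functions *)

(** The bound [|S f| <= ||S||] holds for every [f] of finite modular, however large: cutting [f]
    down to [C] does not change [S f] but makes the modular small, so the scale 1 in the Amemiya
    formula already gives a norm close to at most 1. This is why the estimates are carried by
    modulars rather than norms. The exchange of supremum and infimum uses no compactness of the set
    of all [v]. The functional given by Hahn-Banach is dominated on indicators by W(|E|), and since
    W(0+) = 0 this alone makes it absolutely continuous, so that it has a density. Facts about the
    modular are reduced by the layer-cake formula to the set function W(|E|), which is submodular
    because W is concave. Bounding by finite sums of indicators keeps this elementary: subadditivity
    of the Lorentz functional is needed only against one indicator at a time. The Amemiya formula is
    itself a duality: its scale m comes from the Lagrange multiplier of the constraint that the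
    complementary modular be at most 1. *)

Section orlicz_function_theory.
Context {R : realType}.
Variable phi : R -> R.
Hypothesis Nphi : N_function phi.

Lemma N_function0 : phi 0 = 0.
Proof. by case: Nphi => -[]. Qed.

Lemma N_function_convex x y t : 0 <= x -> 0 <= y -> 0 <= t -> t <= 1 ->
  phi (t * x + (1 - t) * y) <= t * phi x + (1 - t) * phi y.
Proof.
case: Nphi => -[cphi _ _] _ _ x0 y0 t0 t1.
have := cphi (Itv01 t0 t1) x y.
by rewrite !inE/= !in_itv/= !andbT !convRE; exact.
Qed.

Lemma N_function_ge0 x : 0 <= x -> 0 <= phi x.
Proof.
rewrite le_eqVlt => /predU1P[<-|x0]; first by rewrite N_function0.
by case: Nphi => -[_ _ p] _ _; exact/ltW/p.
Qed.

(** The three-chord inequality of convex functions, with denominators cleared. *)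
Lemma N_function_slopes x y z : 0 <= x -> x < y -> y < z ->
  (phi y - phi x) * (z - y) <= (phi z - phi y) * (y - x).
Proof.
move=> x0 xy yz; have xz : 0 < z - x by lra.
have t0 : 0 <= (z - y) / (z - x) by apply: divr_ge0; lra.
have t1 : (z - y) / (z - x) <= 1 by rewrite ler_pdivrMr// mul1r; lra.
have z0 : 0 <= z by lra.
have := N_function_convex x0 z0 t0 t1.
have -> : (z - y) / (z - x) * x + (1 - (z - y) / (z - x)) * z = y.
  by field; rewrite gt_eqF.
rewrite -(ler_pM2r xz).
have -> : ((z - y) / (z - x) * phi x + (1 - (z - y) / (z - x)) * phi z) * (z - x)
  = (z - y) * phi x + (y - x) * phi z by field; rewrite gt_eqF.
by move=> ?; nra.
Qed.

Lemma N_function_nd x y : 0 <= x -> x <= y -> phi x <= phi y.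
Proof.
move=> x0; rewrite le_eqVlt => /predU1P[->//|xy].
have y0 : 0 < y by lra.
have t0 : 0 <= x / y by apply: divr_ge0; lra.
have t1 : x / y <= 1 by rewrite ler_pdivrMr// mul1r; lra.
have := N_function_convex (ltW y0) (lexx 0) t0 t1.
rewrite N_function0 !mulr0 !addr0 divfK ?gt_eqF// => /le_trans; apply.
by rewrite ler_piMl// N_function_ge0// ltW.
Qed.

Lemma N_function_superlinear (A : R) :
  exists2 M, 0 <= M & forall u, M <= u -> A * u <= phi u.
Proof.
case: Nphi => _ _ /cvgryPge/(_ A)[M [Mr HM]].
exists (Num.max M 0 + 1); first by rewrite addr_ge0// le_max lexx orbT.
move=> u Mu; have u0 : 0 < u.
  by rewrite (lt_le_trans _ Mu)// ltr_pwDr// le_max lexx orbT.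
rewrite -ler_pdivlMr//; apply: HM; rewrite (lt_le_trans _ Mu)//.
by rewrite ltr_pwDr// le_max lexx.
Qed.

Lemma complementary_has_ubound v :
  has_ubound [set u * v - phi u | u in `[0, +oo[].
Proof.
have [M M0 HM] := N_function_superlinear v; exists (`|v| * M) => _ [u /= + <-].
rewrite in_itv/= andbT => u0; case: (leP M u) => [/HM Mu|uM].
  by have : 0 <= `|v| * M by [exact: mulr_ge0]; lra.
have := N_function_ge0 u0; have : u * v <= `|v| * M; last by lra.
rewrite mulrC (le_trans (ler_wpM2r u0 (ler_norm v)))//.
by rewrite ler_wpM2l// ltW.
Qed.

Lemma young u v : 0 <= u -> u * v <= phi u + complementary phi v.
Proof.
move=> u0; rewrite addrC -lerBlDr; apply: ub_le_sup.
  exact: complementary_has_ubound.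
by exists u => //=; rewrite in_itv/= u0.
Qed.

Lemma complementary_le v c : (forall u, 0 <= u -> u * v - phi u <= c) ->
  complementary phi v <= c.
Proof.
move=> H; apply: ge_sup; last first.
  by move=> _ [u /= + <-]; rewrite in_itv/= andbT; exact: H.
by exists (0 * v - phi 0), 0 => //=; rewrite in_itv/= lexx.
Qed.

Lemma complementary_ge0 v : 0 <= complementary phi v.
Proof. by have := young v (lexx 0); rewrite mul0r N_function0 add0r. Qed.

Lemma complementary0 : complementary phi 0 = 0.
Proof.
apply/eqP; rewrite eq_le complementary_ge0 andbT; apply: complementary_le => u.
by move=> /N_function_ge0; rewrite mulr0; lra.
Qed.

Lemma complementary_nd v v' : v <= v' ->
  complementary phi v <= complementary phi v'.
Proof.
move=> vv'; apply: complementary_le => u u0.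
have := young v' u0; have := ler_wpM2l u0 vv'; lra.
Qed.

Lemma complementary_convex v v' t : 0 <= t -> t <= 1 ->
  complementary phi (t * v + (1 - t) * v') <=
  t * complementary phi v + (1 - t) * complementary phi v'.
Proof.
move=> t0 t1; apply: complementary_le => u u0.
have t1' : 0 <= 1 - t by lra.
have := ler_wpM2l t0 (young v u0); have := ler_wpM2l t1' (young v' u0); lra.
Qed.

(* Right derivatives are subgradients, hence cases of equality in Young's
   inequality. *)
Lemma young_eq_selection : exists p : R -> R,
  [/\ forall u, 0 <= u -> 0 <= p u,
      forall u, 0 <= u -> u * p u = phi u + complementary phi (p u)
    & forall u u', 0 <= u -> u <= u' -> p u <= p u'].
Proof.
pose E u := [set (phi x - phi u) / (x - u) | x in `]u, +oo[].
have E0 u : E u !=set0.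
  by exists ((phi (u + 1) - phi u) / (u + 1 - u)), (u + 1) => //=;
    rewrite in_itv/= ltrDl ltr01.
have Elb u : 0 <= u -> lbound (E u) 0.
  move=> u0 _ [x /= + <-]; rewrite in_itv/= andbT => ux.
  by rewrite divr_ge0 ?subr_ge0// ?(ltW ux)//; apply/N_function_nd/ltW.
pose p u := inf (E u).
have psub u x : 0 <= u -> 0 <= x -> phi u + p u * (x - u) <= phi x.
  move=> u0 x0; case: (ltgtP x u) => [xu|ux|->]; last by rewrite subrr; lra.
  - have : (phi u - phi x) / (u - x) <= p u.
      apply: lb_le_inf => // _ [z /= + <-]; rewrite in_itv/= andbT => uz.
      rewrite ler_pdivrMr ?subr_gt0// mulrAC ler_pdivlMr ?subr_gt0//.
      exact: N_function_slopes.
    by rewrite ler_pdivrMr ?subr_gt0//; lra.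
  - have : p u <= (phi x - phi u) / (x - u).
      apply: ge_inf; first by exists 0; exact: Elb.
      by exists x => //=; rewrite in_itv/= ux.
    by rewrite ler_pdivlMr ?subr_gt0//; lra.
exists p; split=> [u u0|u u0|u u' u0].
- by apply: lb_le_inf => //; exact: Elb.
- apply/eqP; rewrite eq_le young//= addrC -lerBrDr.
  by apply: complementary_le => x x0; have := psub _ _ u0 x0; lra.
- rewrite le_eqVlt => /predU1P[->//|uu'].
  have u'0 : 0 <= u' by lra.
  have := psub _ _ u0 u'0; have := psub _ _ u'0 u0 => h1 h2.
  have : 0 <= (p u' - p u) * (u' - u) by lra.
  by rewrite pmulr_lge0 ?subr_gt0//; lra.
Qed.

(** The graph lies below its chord over [[u, u + 1]]. This is right continuity in quantitative form,
    valid at 0 too, and it permits approximation by rationals from the right. *)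
Lemma N_function_right_lipschitz u r : 0 <= u -> u <= r -> r <= u + 1 ->
  phi r <= phi u + (r - u) * (phi (u + 1) - phi u).
Proof.
move=> u0 ur ru; have t0 : 0 <= r - u by lra.
have t1 : r - u <= 1 by lra.
have u1 : 0 <= u + 1 by lra.
have := N_function_convex u1 u0 t0 t1.
have -> : (r - u) * (u + 1) + (1 - (r - u)) * u = r by ring.
by lra.
Qed.

(** Level sets of [phi] are half-lines by monotonicity, and open ones by left continuity. Layers of
    [phi (|f|)] thereby become layers of [|f|]. *)
Lemma N_function_level s : 0 <= s ->
  exists2 r, 0 <= r & forall x, 0 <= x -> (s < phi x) = (r < x).
Proof.
move=> s0; pose E := [set x | 0 <= x /\ phi x <= s].
have E0 : E 0 by rewrite /E/= N_function0.
have [M M0 HM] := N_function_superlinear 1.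
have ubE : has_ubound E.
  exists (M + s) => x [x0 xs]; case: (leP M x) => [/HM|]; lra.
have supE : has_sup E by split; [exists 0|].
have r0 : 0 <= sup E by apply: ub_le_sup.
exists (sup E) => // x x0; apply/idP/idP => [sx|rx]; last first.
  rewrite ltNge; apply/negP => xs.
  by have : x <= sup E by [exact: ub_le_sup]; rewrite leNgt rx.
suff phir : phi (sup E) <= s.
  rewrite ltNge; apply/negP => xr.
  by have := N_function_nd x0 xr; lra.
rewrite leNgt; apply/negP => sr.
set r := sup E in r0 sr *; set d := phi (r + 1) - phi r.
have d0 : 0 <= d by rewrite subr_ge0; apply: N_function_nd; lra.
(* Slopes to the left of [r] are at most the slope [d] over [[r, r + 1]], so [phi] would stay above
   [s] at this distance from [r], where the supremum still has points of [E]. *)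
have e0 : 0 < (phi r - s) / (d + 1) by apply: divr_gt0; lra.
have [z [z0 zs] rz] := sup_adherent e0 supE.
have zr : z <= r by exact: ub_le_sup.
move: zr; rewrite le_eqVlt => /predU1P[zr|zr]; first by move: sr; rewrite -zr; lra.
have r1 : r < r + 1 by lra.
have := N_function_slopes z0 zr r1; rewrite -/d => sl.
have : (r - z) * (d + 1) < phi r - s.
  by rewrite -ltr_pdivlMr; [rewrite -/r in rz; lra|lra].
move: sl; have -> : r + 1 - r = 1 by ring.
by rewrite mulr1 mulrC; nra.
Qed.

(** Moving [u] to the right can only increase [u * v] and costs at most [d * b] per unit in the
    other term. The 1 in [d * b + 1] guards against a zero denominator, the bound 1 keeps [q] below
    [u + 1]. *)
Lemma complementary_rat_approx v b u e : 0 <= v -> 0 <= b -> 0 <= u -> 0 < e ->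
  exists2 q : rat, 0 <= q & u * v - phi u * b - e <= ratr q * v - phi (ratr q) * b.
Proof.
move=> v0 b0 u0 e0; set d := phi (u + 1) - phi u.
have d0 : 0 <= d by rewrite subr_ge0; apply: N_function_nd; lra.
have db0 : 0 <= d * b by exact: mulr_ge0.
have de : 0 < Num.min 1 (e / (d * b + 1)).
  by rewrite lt_min ltr01/=; apply: divr_gt0 => //; lra.
have ulti : u < u + Num.min 1 (e / (d * b + 1)) by rewrite ltrDl.
have [q] := rat_in_itvoo ulti; rewrite in_itv/= => /andP[uq].
rewrite -ltrBlDl lt_min => /andP[q1 qe].
exists q; first by rewrite -(@ler0q R); lra.
have qu1 : ratr q <= u + 1 by lra.
have := N_function_right_lipschitz u0 (ltW uq) qu1; rewrite -/d => h.
have h' := ler_wpM2r b0 h.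
move: qe; rewrite ltr_pdivlMr; last by lra.
have := ler_wpM2r v0 (ltW uq).
by nra.
Qed.

Lemma P_integrand_ge0 a b : 0 <= b -> (0 <= P_integrand (complementary phi) a b)%E.
Proof.
move=> b0; rewrite /P_integrand; case: ifPn => _; first by case: ifPn.
by rewrite lee_fin mulr_ge0// complementary_ge0.
Qed.

Lemma P_integrand_young u a b : 0 <= u -> 0 <= b ->
  ((u * `|a|)%:E <= (phi u * b)%:E + P_integrand (complementary phi) a b)%E.
Proof.
move=> u0 b0; rewrite /P_integrand; case: ifPn => [/eqP ->|bN0].
  case: ifPn => [/eqP ->|aN0]; last by rewrite addey// leey.
  by rewrite normr0 !mulr0 adde0.
rewrite -EFinD lee_fin -mulrDl; have b1 : 0 < b by rewrite lt_def bN0.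
by rewrite -ler_pdivrMr// -mulrA young.
Qed.

(** The conventions at [b = 0] agree with the supremum of [u |a| - phi u * b] over [u], which is
    then 0 or infinite; hence the rational values control the integrand in all cases. *)
Lemma P_integrand_le a b (c : \bar R) : 0 <= b ->
  (forall q : rat, 0 <= q -> ((ratr q * `|a| - phi (ratr q) * b)%:E <= c)%E) ->
  (P_integrand (complementary phi) a b <= c)%E.
Proof.
move=> b0 H; case: c H => [c| |] H; [|exact: leey|]; last first.
  by have := H 0 (lexx 0); rewrite leeNy_eq.
have H' u : 0 <= u -> u * `|a| - phi u * b <= c.
  move=> u0; apply/ler_addgt0Pr => e e0.
  have [q q0] := complementary_rat_approx (normr_ge0 a) b0 u0 e0.
  by have := H q q0; rewrite lee_fin; lra.
rewrite /P_integrand; case: ifPn => [/eqP b00|bN0]; last first.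
  have b1 : 0 < b by rewrite lt_def bN0.
  rewrite lee_fin -ler_pdivlMr//; apply: complementary_le => u u0.
  by rewrite ler_pdivlMr// mulrBl -mulrA divfK//; exact: H'.
case: ifPn => [/eqP a0|aN0].
  by have := H' 0 (lexx 0); rewrite mul0r b00 mulr0 subrr lee_fin.
have a1 : 0 < `|a| by rewrite normr_gt0.
have c0 : 0 <= c by have := H' 0 (lexx 0); rewrite mul0r b00 mulr0 subrr.
(* At this point the supremum for [b = 0] would already exceed [c]. *)
have u0 : 0 <= (c + 1) / `|a| by apply: divr_ge0; lra.
by exfalso; have := H' _ u0; rewrite b00 mulr0 subr0 divfK ?gt_eqF//; lra.
Qed.

Definition rat_enum (n : nat) : R :=
  if unpickle n is Some q then Num.max 0 (ratr (q : rat)) else 0.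

Lemma rat_enum_ge0 n : 0 <= rat_enum n.
Proof. by rewrite /rat_enum; case: unpickle => // q; rewrite le_max lexx. Qed.

(* Discretizes over the rationals the supremum [sup_u (u |a| - phi u b)], which
   is [phi_*(|a| / b) b] for [b > 0]. *)
Fixpoint young_argmax (a b : R) (n : nat) : R :=
  if n is m.+1 then
    if young_argmax a b m * `|a| - phi (young_argmax a b m) * b <
       rat_enum m * `|a| - phi (rat_enum m) * b
    then rat_enum m else young_argmax a b m
  else 0.

Definition young_max a b n :=
  young_argmax a b n * `|a| - phi (young_argmax a b n) * b.

(** Only finitely many candidates are met in [n] steps, so the bound does not depend on [a] and [b];
    the maximizers taken pointwise along functions are therefore bounded. *)
Lemma young_argmax_bounded n : exists2 M, 0 <= M & forall a b,
  0 <= young_argmax a b n <= M.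
Proof.
elim: n => [|n [M M0 IH]]; first by exists 0 => //= a b; rewrite lexx.
exists (M + rat_enum n); first by rewrite addr_ge0// rat_enum_ge0.
move=> a b /=; have /andP[h1 h2] := IH a b; have := rat_enum_ge0 n.
by case: ifPn => _; lra.
Qed.

Lemma young_argmax_ge0 a b n : 0 <= young_argmax a b n.
Proof. by have [M _ /(_ a b)/andP[]] := young_argmax_bounded n. Qed.

Lemma young_max_nd a b : nondecreasing_seq (young_max a b).
Proof.
apply/nondecreasing_seqP => n; rewrite /young_max/=.
by case: ifPn => // /ltW.
Qed.

Lemma young_max_ge0 a b n : 0 <= young_max a b n.
Proof.
rewrite (le_trans _ (young_max_nd a b (leq0n n)))//.
by rewrite /young_max/= mul0r N_function0 mul0r subrr.
Qed.

Lemma cvg_young_max a b : 0 <= b ->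
  (young_max a b n)%:E @[n --> \oo] --> P_integrand (complementary phi) a b.
Proof.
move=> b0.
have nd : nondecreasing_seq (fun n => (young_max a b n)%:E).
  by move=> m n mn; rewrite lee_fin young_max_nd.
have -> : P_integrand (complementary phi) a b =
    ereal_sup (range (fun n => (young_max a b n)%:E)).
  apply/eqP; rewrite eq_le; apply/andP; split.
    apply: P_integrand_le => // q q0.
    (* The candidate [rat_enum m] enters the maximum at step [m.+1]. *)
    apply: (@le_trans _ _ (young_max a b (pickle q).+1)%:E); last first.
      by apply: ereal_sup_ubound; exists (pickle q).+1.
    rewrite lee_fin /young_max/=.
    have -> : rat_enum (pickle q) = ratr q.
      by rewrite /rat_enum pickleK max_r// ler0q.
    by case: ifPn => //; rewrite -leNgt.
  apply: ge_ereal_sup => _ [n _ <-].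
  have := P_integrand_young a (young_argmax_ge0 a b n) b0.
  by rewrite /young_max EFinB leeBlDl.
exact: ereal_nondecreasing_cvgn.
Qed.

(** Nothing is known of [phi] on the negative axis, so it is replaced by the monotone function
    [phi (max 0 x)]. *)
Lemma measurable_N_function_comp d (T : measurableType d) (D : set T)
    (f : T -> R) : measurable D -> measurable_fun D f ->
  (forall x, D x -> 0 <= f x) -> measurable_fun D (phi \o f).
Proof.
move=> mD mf f0.
apply: (eq_measurable_fun ((fun x => phi (Num.max 0 x)) \o f)).
  by move=> x /[!inE] Dx /=; rewrite max_r// f0.
apply: measurableT_comp => //; apply: nondecreasing_measurable => // x y xy.
apply: N_function_nd; first by rewrite le_max lexx.
by rewrite ge_max !le_max lexx xy orbT.
Qed.

Lemma measurable_complementary_comp d (T : measurableType d) (D : set T)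
    (f : T -> R) : measurable_fun D f ->
  measurable_fun D (complementary phi \o f).
Proof.
move=> mf; apply: measurableT_comp => //.
by apply: nondecreasing_measurable => // x y xy; exact: complementary_nd.
Qed.

Lemma measurable_young_argmax d (T : measurableType d) (D : set T)
    (a b : T -> R) n : measurable D -> measurable_fun D a ->
  measurable_fun D b -> measurable_fun D (fun t => young_argmax (a t) (b t) n).
Proof.
move=> mD ma mb; elim: n => [|n IH]/=; first exact: measurable_cst.
have m1 (u : T -> R) : measurable_fun D u -> (forall t, D t -> 0 <= u t) ->
    measurable_fun D (fun t => u t * `|a t| - phi (u t) * b t).
  move=> mu u0; apply: measurable_funB; apply: measurable_funM => //.
    exact: measurableT_comp.
  exact: measurable_N_function_comp.
apply: measurable_fun_if => //.
- apply: measurable_fun_ltr; apply: m1 => // t _; first exact: young_argmax_ge0.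
  exact: rat_enum_ge0.
- by apply: measurable_funS IH => // t [].
Qed.

End orlicz_function_theory.

(** * Hahn-Banach *)

Section hahn_banach.
Context {R : realType} {V : lmodType R}.
Variable X : set V.
Hypotheses (X0 : X 0) (XZD : forall (a : R) x y, X x -> X y -> X (a *: x + y)).

Let XD x y : X x -> X y -> X (x + y).
Proof. by move=> Xx Xy; rewrite -[x]scale1r; exact: XZD. Qed.

Let XZ a x : X x -> X (a *: x).
Proof. by move=> Xx; rewrite -[_ *: _]addr0; exact: XZD. Qed.

Let XN x : X x -> X (- x).
Proof. by move=> Xx; rewrite -scaleN1r; exact: XZ. Qed.

Definition sublinear_on (q : V -> R) :=
  (forall x y, X x -> X y -> q (x + y) <= q x + q y) /\
  (forall a x, 0 < a -> X x -> q (a *: x) <= a * q x).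

(** The reverse inequality is homogeneity for [a^-1], applied to [a *: x]. *)
Lemma sublinear_onZ q a x : sublinear_on q -> 0 < a -> X x ->
  q (a *: x) = a * q x.
Proof.
move=> [_ qZ] a0 Xx; apply/eqP; rewrite eq_le qZ//=.
have ai0 : 0 < a^-1 by rewrite invr_gt0.
have := qZ a^-1 (a *: x) ai0 (XZ _ Xx).
by rewrite scalerA mulVf ?gt_eqF// scale1r mulrC ler_pdivlMr// mulrC.
Qed.

Lemma sublinear_on0 q : sublinear_on q -> q 0 = 0.
Proof.
move=> sq; have := sublinear_onZ sq (ltr0n R 2) X0; rewrite scaler0.
by lra.
Qed.

Lemma sublinear_onN q x : sublinear_on q -> X x -> - q (- x) <= q x.
Proof.
move=> sq Xx; have := sq.1 x (- x) Xx (XN Xx).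
by rewrite subrr (sublinear_on0 sq); lra.
Qed.

Lemma sublinear_on_linear q : sublinear_on q ->
  (forall x y, X x -> X y -> q x + q y <= q (x + y)) ->
  forall a x y, X x -> X y -> q (a *: x + y) = a * q x + q y.
Proof.
move=> sq qa.
have qD x y : X x -> X y -> q (x + y) = q x + q y.
  by move=> Xx Xy; apply/eqP; rewrite eq_le sq.1// qa.
have qN x : X x -> q (- x) = - q x.
  move=> Xx; have := qD x (- x) Xx (XN Xx).
  by rewrite subrr (sublinear_on0 sq); lra.
move=> a x y Xx Xy; rewrite qD//; last exact: XZ.
congr (_ + _); case: (ltgtP a 0) => [a0|a0|->].
- have na0 : 0 < - a by rewrite oppr_gt0.
  have := sublinear_onZ sq na0 Xx; rewrite scaleNr qN; last exact: XZ.
  by lra.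
- exact: sublinear_onZ.
- by rewrite scale0r mul0r; exact: sublinear_on0.
Qed.

(* A minimal sublinear functional below [p] is linear. *)
Lemma hahn_banach_dominated (p : V -> R) : sublinear_on p ->
  exists2 nu : V -> R,
    (forall a x y, X x -> X y -> nu (a *: x + y) = a * nu x + nu y)
    & forall x, X x -> nu x <= p x.
Proof.
move=> sp.
pose T := {q : V -> R | sublinear_on q /\ forall x, X x -> q x <= p x}.
pose t0 : T := exist _ p (conj sp (fun x _ => lexx (p x))).
(* The order is reversed, so that Zorn's lemma yields a minimal functional. *)
pose le (q r : T) := `[< forall x, X x -> sval r x <= sval q x >].
have [] := @ZL_preorder T t0 le.
- by move=> q; apply/asboolP => x _.
- move=> q r s /asboolP rq /asboolP qs; apply/asboolP => x Xx.
  exact: le_trans (qs x Xx) (rq x Xx).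
- move=> A totA; have [[q0 Aq0]|A0] := pselect (A !=set0); last first.
    by exists t0 => s As; exfalso; apply: A0; exists s.
  pose E x := [set sval q x | q in A].
  have E0 x : E x !=set0 by exists (sval q0 x), q0.
  (* This bound, common to the whole chain, keeps the pointwise infimum finite. *)
  have Elb x : X x -> lbound (E x) (- p (- x)).
    move=> Xx _ [[q [sq qp]] Aq <-] /=; rewrite (le_trans _ (sublinear_onN sq Xx))//.
    by rewrite lerN2; apply: (qp) (XN Xx).
  have infE x q : X x -> A q -> inf (E x) <= sval q x.
    by move=> Xx Aq; apply: ge_inf; [exists (- p (- x)); exact: Elb|exists q].
  have sr : sublinear_on (fun x => inf (E x)).
    split=> [x y Xx Xy|a x a0 Xx] /=.
      rewrite -lerBlDr; apply: lb_le_inf => // _ [q1 Aq1 <-].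
      rewrite lerBlDr -lerBlDl; apply: lb_le_inf => // _ [q2 Aq2 <-].
      rewrite lerBlDl.
      have [/asboolP q12|/asboolP q21] := totA _ _ Aq1 Aq2.
        rewrite (le_trans (infE _ _ (XD Xx Xy) Aq2))//.
        case: q2 Aq2 q12 => q2 [sq2 q2p] /= Aq2 q12.
        by rewrite (le_trans (sq2.1 x y Xx Xy))// lerD2r q12.
      rewrite (le_trans (infE _ _ (XD Xx Xy) Aq1))//.
      case: q1 Aq1 q21 => q1 [sq1 q1p] /= Aq1 q21.
      by rewrite (le_trans (sq1.1 x y Xx Xy))// lerD2l q21.
    rewrite mulrC -ler_pdivrMr//; apply: lb_le_inf => // _ [q Aq <-].
    rewrite ler_pdivrMr// (le_trans (infE _ _ (XZ a Xx) Aq))//.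
    by case: q Aq => q [sq qp] /= Aq; rewrite mulrC; exact: sq.2.
  have rp x : X x -> inf (E x) <= p x.
    move=> Xx; rewrite (le_trans (infE _ _ Xx Aq0))//.
    by case: q0 Aq0 => q [sq qp] /= _; exact: qp.
  exists (exist _ (fun x => inf (E x)) (conj sr rp)) => s As.
  by apply/asboolP => x Xx /=; exact: infE.
move=> [q [sq qp]] qmax; exists q => //.
apply: sublinear_on_linear => // x y Xx Xy.
(* The infimum over [t] is again sublinear and below [q], so minimality forces equality with [q];
   the term [t = 1] then gives superadditivity in the direction [y]. *)
pose E z := [set q (z + t *: y) - t * q y | t in `[0, +oo[].
have E0 z : E z !=set0.
  by exists (q (z + 0 *: y) - 0 * q y), 0 => //=; rewrite in_itv/= lexx.
have Elb z : X z -> lbound (E z) (- q (- z)).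
  move=> Xz _ [t /= + <-]; rewrite in_itv/= andbT le_eqVlt => /predU1P[<-|t0'].
    by rewrite scale0r addr0 mul0r subr0; exact: sublinear_onN.
  rewrite lerBrDr addrC lerBlDr -sublinear_onZ//.
  rewrite [in leLHS](_ : t *: y = (z + t *: y) + - z); last first.
    by rewrite addrAC subrr add0r.
  by apply: sq.1; [apply: XD => //; exact: XZ|exact: XN].
have infE z t : X z -> 0 <= t -> inf (E z) <= q (z + t *: y) - t * q y.
  move=> Xz t1; apply: ge_inf; first by exists (- q (- z)); exact: Elb.
  by exists t => //=; rewrite in_itv/= t1.
have sr : sublinear_on (fun z => inf (E z)).
  split=> [z1 z2 Xz1 Xz2|a z a0 Xz] /=.
    rewrite -lerBlDr; apply: lb_le_inf => // _ [t1 /= + <-].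
    rewrite in_itv/= andbT => t10.
    rewrite lerBlDr -lerBlDl; apply: lb_le_inf => // _ [t2 /= + <-].
    rewrite in_itv/= andbT => t20.
    rewrite lerBlDl.
    have t12 : 0 <= t1 + t2 by exact: addr_ge0.
    rewrite (le_trans (infE _ _ (XD Xz1 Xz2) t12))//.
    rewrite scalerDl addrACA mulrDl.
    have := sq.1 (z1 + t1 *: y) (z2 + t2 *: y)
      (XD Xz1 (XZ _ Xy)) (XD Xz2 (XZ _ Xy)).
    by lra.
  rewrite mulrC -ler_pdivrMr//; apply: lb_le_inf => // _ [t /= + <-].
  rewrite in_itv/= andbT => t1.
  have at0 : 0 <= a * t by apply: mulr_ge0 => //; exact: ltW.
  rewrite ler_pdivrMr// (le_trans (infE _ _ (XZ a Xz) at0))//.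
  rewrite -scalerA -scalerDr sublinear_onZ//; last by apply: XD => //; exact: XZ.
  by lra.
have rq z : X z -> inf (E z) <= q z.
  by move=> Xz; have := infE z 0 Xz (lexx 0); rewrite scale0r addr0 mul0r subr0.
have rp z : X z -> inf (E z) <= p z.
  by move=> Xz; rewrite (le_trans (rq z Xz))// qp.
have /(_ _)/asboolP := qmax (exist _ (fun z => inf (E z)) (conj sr rp)).
rewrite /le /= => /(_ _ x Xx) qE.
have {}qE : q x <= inf (E x) by apply: qE; apply/asboolP.
rewrite (le_trans _ (_ : q (x + 1 *: y) - 1 * q y + q y <= _))//.
  by rewrite lerD2r (le_trans qE)// infE.
by rewrite scale1r mul1r subrK.
Qed.

End hahn_banach.

(** * Lebesgue integrals *)

Section preliminaries.
Context {R : realType}.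
Local Notation mu := (@lebesgue_measure R).

Lemma exists_nat_ge (s : R) : exists n : nat, s <= n%:R.
Proof. by exists (Num.truncn s).+1; exact/ltW/truncnS_gt. Qed.

Lemma le_mu (A B : set R) : measurable A -> measurable B -> A `<=` B ->
  (mu A <= mu B)%E.
Proof. by move=> mA mB AB; apply: le_measure => //; rewrite inE. Qed.

Lemma integral_cst_mu (D : set R) (c : \bar R) : measurable D ->
  (\int[mu]_(x in D) cst c x = c * mu D)%E.
Proof. by move=> mD; rewrite integral_cst. Qed.

Lemma ge0_le_integralD2 (D : set R) (f1 f2 g1 g2 : R -> \bar R) :
  measurable D ->
  measurable_fun D f1 -> measurable_fun D f2 ->
  measurable_fun D g1 -> measurable_fun D g2 ->
  (forall s, 0 <= f1 s)%E -> (forall s, 0 <= f2 s)%E ->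
  (forall s, 0 <= g1 s)%E -> (forall s, 0 <= g2 s)%E ->
  (forall s, D s -> f1 s + f2 s <= g1 s + g2 s)%E ->
  (\int[mu]_(s in D) f1 s + \int[mu]_(s in D) f2 s <=
   \int[mu]_(s in D) g1 s + \int[mu]_(s in D) g2 s)%E.
Proof.
move=> mD mf1 mf2 mg1 mg2 f10 f20 g10 g20 H; rewrite -!ge0_integralD//.
apply: ge0_le_integral => //; [|exact: emeasurable_funD..].
by move=> s _; rewrite adde_ge0.
Qed.

Lemma lee_cancel_fin (x y t a b : \bar R) : (x + a <= y + b)%E ->
  (b = t + a)%E -> (0 <= a)%E -> (a < +oo)%E -> (x <= y + t)%E.
Proof.
move=> + bE; rewrite bE => xy a0 aoo; have afin : a \is a fin_num by rewrite ge0_fin_numE.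
by rewrite -(leeD2rE x (y + t)%E afin) -addeA.
Qed.

Lemma cvge0_of_le (u : nat -> \bar R) : (forall n, 0 <= u n)%E ->
  (forall e : R, 0 < e -> \forall n \near \oo, (u n <= e%:E)%E) ->
  u n @[n --> \oo] --> 0%E.
Proof.
move=> u0 H; apply/fine_cvgP; split.
  near=> n; rewrite ge0_fin_numE// (@le_lt_trans _ _ 1%:E) ?ltry//.
  by near: n; exact: H.
apply/cvgrPdist_le => e e0; near=> n.
have ue : (u n <= e%:E)%E by near: n; exact: H.
rewrite sub0r normrN ger0_norm ?fine_ge0//.
by rewrite -lee_fin fineK// ge0_fin_numE// (le_lt_trans ue)// ltry.
Unshelve. all: by end_near. Qed.

Lemma cvge0_le (u : nat -> \bar R) (e : R) : u n @[n --> \oo] --> 0%E ->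
  0 < e -> \forall n \near \oo, (u n <= e%:E)%E.
Proof.
move=> /fine_cvgP[uf /cvgrPdist_le H] e0; near=> n.
have ufin : u n \is a fin_num by near: n.
rewrite -(fineK ufin) lee_fin (le_trans (ler_norm _))//.
have : `|0 - fine (u n)| <= e by near: n; exact: H.
by rewrite sub0r normrN.
Unshelve. all: by end_near. Qed.

Lemma ge0_integrable (D : set R) (f : R -> \bar R) : measurable_fun D f ->
  (forall x, D x -> (0 <= f x)%E) -> (\int[mu]_(x in D) f x < +oo)%E ->
  mu.-integrable D f.
Proof.
move=> mf f0 fin; apply/integrableP; split => //.
have -> : (\int[mu]_(x in D) `|f x| = \int[mu]_(x in D) f x)%E; last exact: fin.
by apply: eq_integral => x /[!inE] Dx; rewrite gee0_abs// f0.
Qed.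

Lemma ae_imply (P Q : R -> Prop) : (forall x, P x -> Q x) ->
  {ae mu, forall x, P x} -> {ae mu, forall x, Q x}.
Proof.
move=> PQ [N [mN N0 sub]]; exists N; split=> //.
by apply: subset_trans sub => x nQ /PQ.
Qed.

(** Superlevel sets of a monotone function on an interval are intervals. *)
Lemma nonincreasing_measurable_in (D : set R) (y : R -> \bar R) :
  is_interval D ->
  (forall s t, D s -> D t -> s <= t -> (y t <= y s)%E) -> measurable_fun D y.
Proof.
move=> iD yni.
apply: (measurability (@ErealGenCInfty.G R)) => [|/= _ [_] [r] -> <-].
  exact: ErealGenCInfty.measurableE.
apply: is_interval_measurable => s t [/= Ds] + [Dt] + u /andP[su ut].
rewrite !in_itv/= !andbT => ys yt; have Du : D u by apply: iD Ds Dt _ _; rewrite su.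
by split => //; rewrite (le_trans yt)// yni.
Qed.

Lemma lebesgue_measure_lt (z : \bar R) : (0 <= z)%E ->
  mu [set s | 0 <= s /\ (s%:E < z)%E] = z.
Proof.
case: z => [r| |] z0.
- rewrite (_ : [set s | _] = `[0, r[%classic :> set R); last first.
    apply/seteqP; split=> s /=; rewrite in_itv/= lte_fin.
      by case=> -> ->.
    by case/andP.
  rewrite lebesgue_measure_itv/= lte_fin; case: ifPn => [_|].
    by rewrite oppr0 adde0.
  by move: z0; rewrite lee_fin le_eqVlt => /predU1P[<-|->].
- rewrite (_ : [set s | _] = `[0, +oo[%classic :> set R); last first.
    by apply/seteqP; split=> s /=; rewrite in_itv/= andbT ltry//; case.
  by rewrite lebesgue_measure_itv/= ltry.
- by [].
Qed.

Lemma measurable_lt_ereal (z : \bar R) :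
  measurable ([set s | 0 <= s /\ (s%:E < z)%E] : set R).
Proof.
apply: is_interval_measurable => a b /= [a0 _] [_ bz] c /andP[ac cb]; split.
  exact: le_trans ac.
by rewrite (le_lt_trans _ bz)// lee_fin.
Qed.

Lemma integral_setI_indic (D A : set R) (f : R -> \bar R) :
  (\int[mu]_(x in D `&` A) f x = \int[mu]_(x in D) (f x * (\1_A x)%:E))%E.
Proof.
rewrite integral_mkcondr; apply: eq_integral => x _; rewrite patchE indicE.
by case: ifPn => _; rewrite ?mule1 ?mule0.
Qed.

Lemma monotone_convergence_le (D : set R) (g_ : nat -> R -> \bar R)
    (g : R -> \bar R) (c : \bar R) : measurable D ->
  (forall n, measurable_fun D (g_ n)) ->
  (forall n x, D x -> (0 <= g_ n x)%E) ->
  (forall x, D x -> {homo g_ ^~ x : m n / (m <= n)%N >-> (m <= n)%E}) ->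
  (forall x, D x -> g_ n x @[n --> \oo] --> g x) ->
  (forall n, (\int[mu]_(x in D) g_ n x <= c)%E) ->
  (\int[mu]_(x in D) g x <= c)%E.
Proof.
move=> mD mg g0 gnd gcvg gc.
have -> : (\int[mu]_(x in D) g x = \int[mu]_(x in D) limn (g_ ^~ x))%E.
  by apply: eq_integral => x /[!inE] Dx; rewrite (cvg_lim _ (gcvg _ Dx)).
have cvgI := @cvg_monotone_convergence _ _ _ mu D mD g_ mg g0 gnd.
rewrite -(cvg_lim _ cvgI)//; apply: lime_le; last by near=> n; exact: gc.
by apply/cvg_ex; eexists; exact: cvgI.
Unshelve. all: by end_near. Qed.

Lemma integral_exhaustion_le (D : set R) (A : nat -> set R) (f : R -> \bar R)
    (c : \bar R) : measurable D -> (forall n, measurable (A n)) ->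
  {homo A : m n / (m <= n)%N >-> m `<=` n} ->
  (forall x, D x -> exists n, A n x) ->
  measurable_fun D f -> (forall x, D x -> (0 <= f x)%E) ->
  (forall n, (\int[mu]_(x in D `&` A n) f x <= c)%E) ->
  (\int[mu]_(x in D) f x <= c)%E.
Proof.
move=> mD mA And DA mf f0 Ic.
apply: (@monotone_convergence_le D (fun n x => f x * (\1_(A n) x)%:E)%E) => //.
- move=> n; apply: emeasurable_funM => //.
  by apply/measurable_EFinP/measurable_indic.
- by move=> n x Dx; rewrite mule_ge0 ?f0// lee_fin.
- move=> x Dx m n mn; rewrite lee_wpmul2l ?f0// lee_fin !indicE.
  have [Amx|Amx] := pselect (A m x); last by rewrite (memNset Amx).
  by rewrite !mem_set//; exact: And Amx.
- move=> x Dx; apply: cvg_near_cst; have [N AN] := DA _ Dx.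
  near=> n; rewrite indicE mem_set ?mule1//; apply: (And N) => //.
  by near: n; exact: nbhs_infty_ge.
- by move=> n; rewrite -integral_setI_indic.
Unshelve. all: by end_near. Qed.

Lemma measure_exhaustion (D : set R) (A : nat -> set R) (c : \bar R) :
  measurable D -> (forall n, measurable (A n)) ->
  {homo A : m n / (m <= n)%N >-> m `<=` n} ->
  (forall x, D x -> exists n, A n x) ->
  (forall n, (mu (D `&` A n) <= c)%E) -> (mu D <= c)%E.
Proof.
move=> mD mA And DA Ic.
have h (E : set R) : measurable E -> mu E = (\int[mu]_(x in E) cst 1%E x)%E.
  by move=> mE; rewrite integral_cst// mul1e.
rewrite h//; apply: (integral_exhaustion_le mD mA And DA) => // n.
by rewrite -h//; exact: measurableI.
Qed.

(** Tonelli on the region below the graph of [y], weighted by [k]. Extension by 0 off [D] allows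
    integration over the whole plane, and [y] may be infinite. *)
Lemma layer_cake (D : set R) (k : R -> R) (y : R -> \bar R) :
  measurable D -> measurable_fun D k -> (forall x, D x -> 0 <= k x) ->
  measurable_fun D y -> (forall x, D x -> (0 <= y x)%E) ->
  (\int[mu]_(x in D) (y x * (k x)%:E) =
   \int[mu]_(s in `[0%R, +oo[)
     \int[mu]_(x in D `&` [set x | s%:E < y x]) (k x)%:E)%E.
Proof.
move=> mD mk k0 my y0.
pose k' := (EFin \o k) \_ D; pose y' := y \_ D.
have mk' : measurable_fun setT k'.
  by apply/(measurable_restrictT _ mD); exact/measurable_EFinP.
have my' : measurable_fun setT y' by exact/(measurable_restrictT _ mD).
have k'0 x : (0 <= k' x)%E.
  by apply: erestrict_ge0 => z Dz /=; rewrite lee_fin k0.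
have y'0 x : (0 <= y' x)%E by apply: erestrict_ge0 => z Dz; exact: y0.
pose A : set (R * R) := [set p | 0 <= p.2 /\ (p.2%:E < y' p.1)%E].
have mA : measurable A.
  have -> : A = (setT `&` [set p | (fun p => 0%:E : \bar R) p <= (EFin \o snd) p]%E) `&`
     (setT `&` [set p | (EFin \o snd) p < (y' \o fst) p]%E).
    apply/seteqP; split=> p; rewrite /A /= lee_fin; first by case.
    by case=> -[_ ?] [_ ?].
  apply: measurableI.
    by apply: measurable_lee => //; apply/measurable_EFinP.
  apply: measurable_lte => //; first exact/measurable_EFinP.
  by apply: measurableT_comp => //.
pose F (p : R * R) : \bar R := (k' p.1 * (\1_A p)%:E)%E.
have mF : measurable_fun setT F.
  apply: emeasurable_funM; first exact: measurableT_comp mk' measurable_fst.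
  exact/measurable_EFinP/measurable_indic.
have F0 p : (0 <= F p)%E by rewrite mule_ge0// lee_fin.
transitivity (\int[mu]_x \int[mu]_s F (x, s))%E.
  rewrite integral_mkcond; apply: eq_integral => x _.
  transitivity (k' x * y' x)%E.
    by rewrite /k' /y' !patchE/=; case: ifPn => _; rewrite ?mule0// muleC.
  rewrite /F/= ge0_integralZl//; last first.
  - by apply/measurable_EFinP; exact: (measurableT_comp (measurable_indic mA)).
  - congr (_ * _)%E.
    rewrite [X in _ = (\int[mu]_s X s)%E](_ : _ =
      (fun s => (\1_[set s | (0 <= s)%R /\ (s%:E < y' x)%E] s)%:E)); last first.
      by apply/funext => s; rewrite !indicE /A/=; congr (_%:R%:E);
         apply/idP/idP; rewrite !inE.
    rewrite integral_indic//; last exact: measurable_lt_ereal.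
    by rewrite setIT; exact/esym/lebesgue_measure_lt.
transitivity (\int[mu]_s \int[mu]_x F (x, s))%E.
  exact: (@fubini_tonelli _ _ _ _ R mu mu F mF F0).
rewrite [RHS]integral_mkcond; apply: eq_integral => s _.
rewrite patchE; case: ifPn => [|sN]; last first.
  apply: integral0_eq => x _; rewrite /F indicE memNset ?mule0//= => -[s0 _].
  by move/negP: sN; apply; rewrite inE/= in_itv/= s0.
rewrite inE/= in_itv/= andbT => s0.
rewrite [RHS]integral_mkcond; apply: eq_integral => x _.
rewrite /F /k' patchE [RHS]patchE indicE /A /y' /=.
have [Dx|nDx] := pselect (D x); last first.
  by rewrite (memNset nDx) mul0e memNset// => -[].
rewrite (mem_set Dx); have [xs|nxs] := pselect (s%:E < y x)%E.
  rewrite !mem_set//= ?mule1//; split=> //.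
  by rewrite patchE mem_set.
by rewrite !memNset ?mule0// => -[]//; rewrite patchE mem_set.
Qed.

Lemma layer_cake_measure (D : set R) (y : R -> \bar R) :
  measurable D -> measurable_fun D y -> (forall x, D x -> (0 <= y x)%E) ->
  (\int[mu]_(x in D) y x =
   \int[mu]_(s in `[0%R, +oo[) mu (D `&` [set x | s%:E < y x]))%E.
Proof.
move=> mD my y0.
transitivity (\int[mu]_(x in D) (y x * (cst 1%R x)%:E))%E.
  by apply: eq_integral => x _; rewrite mule1.
rewrite layer_cake//; apply: eq_integral => s _.
have mL : measurable (D `&` [set x | (s%:E < y x)%E]).
  by apply: measurable_lte => //; exact: measurable_cst.
have : (\int[mu]_(x in D `&` [set x | s%:E < y x]) cst 1%E x)%E =
    mu (D `&` [set x | s%:E < y x]%E) by rewrite integral_cst// mul1e.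
by [].
Qed.

Lemma measurable_level_measure (D : set R) (y : R -> \bar R) (I : set R) :
  measurable D -> measurable_fun D y -> is_interval I ->
  measurable_fun I (fun s => mu (D `&` [set x | (s%:E < y x)%E])).
Proof.
move=> mD my iI; apply: nonincreasing_measurable_in => // s t _ _ st.
have mL r : measurable (D `&` [set x | (r%:E < y x)%E]).
  by apply: measurable_lte => //; exact: measurable_cst.
apply: le_mu; [exact: mL..|].
by move=> u [Au /= tu]; split=> //=; apply: le_lt_trans tu; rewrite lee_fin.
Qed.

End preliminaries.

(** * The primitive of the weight *)

Section weight_theory.
Context {R : realType}.
Local Notation mu := (@lebesgue_measure R).
Variables (gamma : \bar R) (w : R -> R).

Lemma is_interval_dom : is_interval (dom gamma).
Proof.
move=> a b [a0 _] [_ bg] c /andP[ac cb]; split; first exact: le_trans ac.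
by rewrite (le_lt_trans _ bg)// lee_fin.
Qed.

Lemma measurable_dom : measurable (dom gamma).
Proof. by apply: is_interval_measurable; exact: is_interval_dom. Qed.

Lemma measure_dom : (0 <= gamma)%E -> mu (dom gamma) = gamma.
Proof. exact: lebesgue_measure_lt. Qed.

Hypotheses (gamma_gt0 : (0 < gamma)%E) (Hw : weight gamma w).

Lemma measurable_weight : measurable_fun (dom gamma) w.
Proof.
(* Monotonicity says nothing at 0, so this point is split off. *)
have -> : dom gamma = [set 0] `|` (dom gamma `&` [set t | 0 < t]).
  apply/seteqP; split=> t /=.
    move=> dt; have [+ _] := dt; rewrite le_eqVlt.
    by move=> /predU1P[<-|t0]; [left|right].
  by move=> [->|[]//]; split.
have mI : measurable (dom gamma `&` [set t | 0 < t]).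
  apply: measurableI; first exact: measurable_dom.
  rewrite (_ : [set t | _] = `]0, +oo[%classic); first exact: measurable_itv.
  by apply/seteqP; split=> t /=; rewrite in_itv/= andbT.
apply/measurable_funU => //; split; first exact: measurable_fun_set1.
apply/measurable_EFinP; apply: nonincreasing_measurable_in.
  move=> a b [[a0 ag] /= a1] [[b0 bg] /= b1] c /andP[ac cb]; split => /=.
    by apply: (is_interval_dom (conj a0 ag) (conj b0 bg)); rewrite ac.
  exact: lt_le_trans ac.
move=> s t [[_ sg] /= s0] [[_ tg] _] st; rewrite /= lee_fin.
by case: Hw => _ H _ _; exact: H.
Qed.

(** The primitive W on the extended reals, constant beyond [gamma], so that [wint (mu E)] makes
    sense for sets of any measure. *)
Definition wint (x : \bar R) : \bar R :=
  (\int[mu]_(t in dom gamma `&` [set t | t%:E < x]) (w t)%:E)%E.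

Lemma dom_ltE (x : \bar R) : dom gamma `&` [set t | (t%:E < x)%E] =
  [set t | 0 <= t /\ (t%:E < mine gamma x)%E].
Proof.
apply/seteqP; split=> t /=; first by case=> -[t0 tg] tx; rewrite lt_min tg.
by case=> t0; rewrite lt_min => /andP[].
Qed.

Lemma measurable_dom_lt (x : \bar R) :
  measurable (dom gamma `&` [set t | (t%:E < x)%E]).
Proof. by rewrite dom_ltE; exact: measurable_lt_ereal. Qed.

Lemma weight_ge0 t : dom gamma t -> 0 <= w t.
Proof. by case: Hw => H _ _ _ /H/ltW. Qed.

Lemma measurable_weightS (A : set R) : A `<=` dom gamma ->
  measurable_fun A (EFin \o w).
Proof.
move=> Ad; apply/measurable_EFinP; apply: measurable_funS Ad measurable_weight.
exact: measurable_dom.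
Qed.

Lemma weight_integral_le (A B : set R) : measurable A -> measurable B ->
  A `<=` B -> B `<=` dom gamma ->
  (\int[mu]_(t in A) (w t)%:E <= \int[mu]_(t in B) (w t)%:E)%E.
Proof.
move=> mA mB AB Bd; apply: ge0_subset_integral => //.
  exact: measurable_weightS.
by move=> t /Bd/weight_ge0; rewrite lee_fin.
Qed.

Lemma wint_ge0 x : (0 <= wint x)%E.
Proof. by apply: integral_ge0 => t [dt _]; rewrite lee_fin weight_ge0. Qed.

Lemma wint_nd x y : (x <= y)%E -> (wint x <= wint y)%E.
Proof.
move=> xy; apply: weight_integral_le; [exact: measurable_dom_lt..| |].
  by move=> t /= [dt tx]; split=> //; exact: lt_le_trans xy.
by move=> t [].
Qed.

Lemma wint_le0 x : (x <= 0)%E -> wint x = 0%E.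
Proof.
move=> x0; rewrite /wint (_ : _ `&` _ = set0) ?integral_set0//.
apply/seteqP; split=> // t /= [[t0 _] tx].
by have := lt_le_trans tx x0; rewrite lte_fin ltNge t0.
Qed.

Lemma wint_pinfty : gamma = +oo%E -> wint +oo%E = +oo%E.
Proof.
move=> gy; case: Hw => _ _ _ /(_ gy) intw; rewrite -[RHS]intw /wint; congr (integral _ _ _).
by apply/seteqP; split=> t /=; [case|move=> dt; split=> //; rewrite ltry].
Qed.

(** Local integrability only covers [r < gamma]. Beyond a finite [gamma], the part over the right
    half of the interval is bounded because [w] is at most its value at the midpoint there. *)
Lemma wint_lty r : (wint r%:E < +oo)%E.
Proof.
case: Hw => _ wni wloc _.
have [r0|r0] := leP r 0; first by rewrite wint_le0// ?lee_fin// ltry.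
have [rg|gr] := ltP r%:E gamma.
  apply: le_lt_trans (wloc r _); last by split=> //; exact: ltW.
  apply: weight_integral_le; first exact: measurable_dom_lt.
  - exact: measurable_itv.
  - by move=> t [[t0 _]] /=; rewrite lte_fin in_itv/= t0 => /ltW.
  - by move=> t /=; rewrite in_itv/= => /andP[t0 tr]; split=> //;
      rewrite (le_lt_trans _ rg)// lee_fin.
move: gamma_gt0 gr; case E : gamma => [g| |]//; rewrite lte_fin lee_fin => g0 gr.
pose h := g / 2; have h0 : 0 < h by rewrite /h; lra.
have hg : (h%:E < gamma)%E by rewrite E lte_fin /h; lra.
have hd : dom gamma h by split=> //; exact: ltW.
pose A : set R := `[0, h]%classic; pose B : set R := `]h, g[%classic.
have Ad : A `<=` dom gamma.
  move=> t; rewrite /A/= in_itv/= => /andP[t0 th]; split=> //.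
  by rewrite (le_lt_trans _ hg)// lee_fin.
have Bd : B `<=` dom gamma.
  move=> t; rewrite /B/= in_itv/= => /andP[ht tg]; split; first by lra.
  by rewrite E lte_fin.
apply: (@le_lt_trans _ _ (\int[mu]_(t in A `|` B) (w t)%:E)%E).
  apply: weight_integral_le; first exact: measurable_dom_lt.
  - by apply: measurableU; exact: measurable_itv.
  - move=> t [[t0]]; rewrite E lte_fin => tg _; rewrite /A /B /=.
    by rewrite !in_itv/= t0 tg/= andbT; case: (leP t h); [left|right].
  - by move=> t [/Ad|/Bd].
rewrite ge0_integral_setU//; last 5 first.
- exact: measurable_itv.
- exact: measurable_itv.
- by apply: measurable_weightS => t [/Ad|/Bd].
- by move=> t [/Ad|/Bd] /weight_ge0; rewrite lee_fin.
- by apply/disj_setPS => t []; rewrite /A/B/= !in_itv/= => /andP[_ th] /andP[]; lra.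
apply: lte_add_pinfty; first exact: wloc.
apply: (@le_lt_trans _ _ (\int[mu]_(t in B) (cst (w h)%:E t))%E).
  apply: ge0_le_integral => //.
  - exact: measurable_itv.
  - by move=> t /Bd/weight_ge0; rewrite lee_fin.
  - exact: measurable_weightS.
  - move=> t Bt; have [_ tg] := Bd _ Bt; move: Bt; rewrite /B/= in_itv/= lee_fin.
    by move=> /andP[ht _]; apply: wni => //; exact: ltW.
rewrite integral_cst; last exact: measurable_itv.
apply: lte_mul_pinfty => //; first by rewrite lee_fin weight_ge0.
by have := lebesgue_measure_itv `]h, g[; rewrite /= lte_fin => ->; case: ifPn; rewrite ?ltry.
Qed.

Definition wintr r : R := fine (wint r%:E).

Lemma wintrE r : wint r%:E = (wintr r)%:E.
Proof. by rewrite fineK// ge0_fin_numE ?wint_ge0// wint_lty. Qed.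

Lemma wintr_ge0 r : 0 <= wintr r.
Proof. by rewrite -lee_fin -wintrE wint_ge0. Qed.

Lemma wintr_nd r s : r <= s -> wintr r <= wintr s.
Proof. by move=> rs; rewrite -lee_fin -!wintrE wint_nd// lee_fin. Qed.

Lemma wintr_le0 r : r <= 0 -> wintr r = 0.
Proof. by move=> r0; rewrite /wintr wint_le0. Qed.

Lemma wint_split a b : a <= b -> wint b%:E = (wint a%:E +
  \int[mu]_(t in dom gamma `&` `[a, b[) (w t)%:E)%E.
Proof.
move=> ab.
have mab : measurable (dom gamma `&` `[a, b[).
  by apply: measurableI; [exact: measurable_dom|exact: measurable_itv].
rewrite /wint -ge0_integral_setU//.
- congr (integral _ _ _); rewrite -setIUr; congr (_ `&` _).
  apply/seteqP; split=> t /=; rewrite in_itv/= !lte_fin.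
    by move=> ->; rewrite andbT; case: (ltP t a); [left|right].
  by move=> [|/andP[]//]; move=> /lt_le_trans; exact.
- exact: measurable_dom_lt.
- by apply: measurable_weightS => t [] [].
- by move=> t [] [dt _]; rewrite lee_fin weight_ge0.
- apply/disj_setPS => t [] [_ /= ta] [_ /=]; rewrite in_itv/= => /andP[at_ _].
  by move: ta; rewrite lte_fin ltNge at_.
Qed.

(** The value 0 beyond [gamma], where the primitive is constant, gives a supergradient at every
    positive [b]. *)
Definition weight_ext b : R := if (b%:E < gamma)%E then w b else 0.

Lemma weight_ext_ge0 b : 0 <= b -> 0 <= weight_ext b.
Proof. by move=> b0; rewrite /weight_ext; case: ifPn => // bg; exact: weight_ge0. Qed.

(** Since [w] is nonincreasing, it is at most [w b] to the right of [b] and at least [w b] to the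
    left. *)
Lemma wintr_supergradient b x : 0 < b -> 0 <= x ->
  wintr x <= wintr b + weight_ext b * (x - b).
Proof.
move=> b0 x0; case: Hw => _ wni _ _.
have [bx|xb] := leP b x.
  have mD : measurable (dom gamma `&` `[b, x[).
    by apply: measurableI; [exact: measurable_dom|exact: measurable_itv].
  rewrite -lee_fin EFinD -!wintrE (wint_split bx); apply: leeD => //.
  apply: (@le_trans _ _ (\int[mu]_(t in `[b, x[) (cst (weight_ext b)%:E t))%E).
    apply: (@le_trans _ _ (\int[mu]_(t in dom gamma `&` `[b, x[)
        (cst (weight_ext b)%:E t))%E).
      apply: ge0_le_integral => //.
      - by move=> t [dt _]; rewrite lee_fin weight_ge0.
      - by apply: measurable_weightS => t [].
      - move=> t [[_ tg]] /=; rewrite in_itv/= => /andP[bt _]; rewrite lee_fin.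
        rewrite /weight_ext ifT; first exact: wni.
        by rewrite (le_lt_trans _ tg)// lee_fin.
    apply: ge0_subset_integral => //.
      by move=> t _; rewrite /= lee_fin weight_ext_ge0// ltW.
  rewrite integral_cst//= lebesgue_measure_itv/= lte_fin.
  case: ifPn => [_|]; first by rewrite -EFinD -EFinM.
  by rewrite -leNgt mule0 lee_fin => ?; rewrite mulr_ge0 ?weight_ext_ge0 ?subr_ge0// ltW.
have [gb|bg] := leP gamma b%:E.
  by rewrite /weight_ext ltNge gb/= mul0r addr0 wintr_nd// ltW.
have wb : weight_ext b = w b by rewrite /weight_ext bg.
have dI t : 0 <= t -> t < b -> dom gamma t.
  by move=> t0 tb; split=> //; rewrite (lt_trans _ bg)// lte_fin.
suff : ((w b * (b - x))%:E <= \int[mu]_(t in dom gamma `&` `[x, b[) (w t)%:E)%E.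
  move=> h; have : (wint x%:E + (w b * (b - x))%:E <= wint b%:E)%E.
    by rewrite (wint_split (ltW xb)) leeD2l.
  by rewrite !wintrE -EFinD lee_fin wb; lra.
apply: (@le_trans _ _ (\int[mu]_(t in `]x, b[) (cst (w b)%:E t))%E).
  rewrite integral_cst//= lebesgue_measure_itv/= lte_fin xb.
  by rewrite -EFinD -EFinM.
apply: (@le_trans _ _ (\int[mu]_(t in `]x, b[) (w t)%:E)%E).
  apply: ge0_le_integral => //.
  - by move=> t _; rewrite lee_fin weight_ge0//; split=> //; exact: ltW.
  - apply: measurable_weightS => t /=; rewrite in_itv/= => /andP[xt tb].
    by apply: dI => //; exact: le_trans x0 (ltW xt).
  - move=> t /=; rewrite in_itv/= => /andP[xt tb]; rewrite lee_fin.
    by apply: wni => //; [exact: le_lt_trans xt|exact: ltW].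
apply: weight_integral_le => //.
- by apply: measurableI; [exact: measurable_dom|exact: measurable_itv].
- move=> t /=; rewrite !in_itv/= => /andP[xt tb]; rewrite tb (ltW xt); split=> //.
  by apply: dI => //; exact: le_trans x0 (ltW xt).
Qed.

Lemma wintr_concave x y t : 0 <= x -> 0 <= y -> 0 <= t -> t <= 1 ->
  t * wintr x + (1 - t) * wintr y <= wintr (t * x + (1 - t) * y).
Proof.
move=> x0 y0 t0 t1; set b := t * x + (1 - t) * y.
have t1' : 0 <= 1 - t by lra.
have : 0 <= b by rewrite addr_ge0// mulr_ge0.
rewrite le_eqVlt => /predU1P[b0|b0]; last first.
  have := ler_wpM2l t0 (wintr_supergradient b0 x0).
  have := ler_wpM2l t1' (wintr_supergradient b0 y0).
  set c := weight_ext b; set W := wintr b.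
  have : t * (c * (x - b)) + (1 - t) * (c * (y - b)) = 0 by rewrite /b; ring.
  by lra.
(* At 0 there may be no supporting line, as [w] can be unbounded there; but a barycentre 0 makes
   both products, hence both terms on the left, vanish. *)
have tx0 : 0 <= t * x by exact: mulr_ge0.
have ty0 : 0 <= (1 - t) * y by exact: mulr_ge0.
have zero s z : s * z = 0 -> s * wintr z = 0.
  by move=> /eqP; rewrite mulf_eq0 => /orP[]/eqP->;
     rewrite ?mul0r// wintr_le0// mulr0.
rewrite zero; last by move: b0; rewrite /b; lra.
rewrite zero; last by move: b0; rewrite /b; lra.
by rewrite addr0 wintr_ge0.
Qed.

(** The inner points [a] and [b] are convex combinations of [x] and [y] with complementary weights;
    concavity is applied to each and the results are added. *)
Lemma wintr_submod y a b x : 0 <= y -> y <= a -> y <= b -> x + y = a + b ->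
  wintr x + wintr y <= wintr a + wintr b.
Proof.
move=> y0 ya yb xyab; have := ya; rewrite le_eqVlt => /predU1P[yaE|ya'].
  by have -> : x = b; [lra|rewrite yaE addrC].
have xy : 0 < x - y by lra.
pose t := (x - a) / (x - y).
have t0 : 0 <= t by apply: divr_ge0; lra.
have t1 : t <= 1 by rewrite ler_pdivrMr//; lra.
have x0 : 0 <= x by lra.
have := wintr_concave y0 x0 t0 t1; have := wintr_concave x0 y0 t0 t1.
have -> : t * y + (1 - t) * x = a by rewrite /t; field; rewrite gt_eqF.
have -> : t * x + (1 - t) * y = b.
  by rewrite [RHS](_ : b = x + y - a); [rewrite /t; field; rewrite gt_eqF|lra].
by lra.
Qed.

Lemma measure_subdom_fin (A : set R) : measurable A -> A `<=` dom gamma ->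
  gamma != +oo%E -> mu A \is a fin_num.
Proof.
move=> mA Ad gy; rewrite ge0_fin_numE//.
apply: (@le_lt_trans _ _ (mu (dom gamma))).
  by apply: le_measure; rewrite ?inE//; exact: measurable_dom.
by rewrite measure_dom ?ltW// ltey.
Qed.

(** The measures of union and intersection have the same sum as those of [A] and [B] and lie further
    apart, so concavity of the primitive applies. Infinite measure forces [gamma = +oo], where W is
    infinite and the right side too. *)
Lemma wint_submod (A B : set R) : measurable A -> measurable B ->
  A `<=` dom gamma -> B `<=` dom gamma ->
  (wint (mu (A `|` B)) + wint (mu (A `&` B)) <= wint (mu A) + wint (mu B))%E.
Proof.
move=> mA mB Ad Bd.
have infty (C : set R) : measurable C -> C `<=` dom gamma -> ~ mu C \is a fin_num ->
    wint (mu C) = +oo%E.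
  move=> mC Cd nC; have gy : gamma = +oo%E.
    by apply/eqP/negPn/negP => gy; apply: nC; exact: measure_subdom_fin.
  rewrite (_ : mu C = +oo%E) ?wint_pinfty//.
  by apply/eqP; rewrite -leye_eq leNgt; apply/negP => ?; apply: nC; rewrite ge0_fin_numE.
have [fA|nA] := pselect (mu A \is a fin_num); last first.
  by rewrite (infty A)// addye ?leey// gt_eqF// (lt_le_trans _ (wint_ge0 _)).
have [fB|nB] := pselect (mu B \is a fin_num); last first.
  by rewrite (infty B)// addey ?leey// gt_eqF// (lt_le_trans _ (wint_ge0 _)).
have mAB := measurableU _ _ mA mB; have mIAB := measurableI _ _ mA mB.
have fI : mu (A `&` B) \is a fin_num.
  rewrite ge0_fin_numE// (le_lt_trans (le_measure mu _ _ (@subIsetl _ A B)))// ?inE//.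
  by rewrite -ge0_fin_numE.
have AU : mu (A `|` B) = (mu A + mu B - mu (A `&` B))%E.
  rewrite -measureUfinl -?ge0_fin_numE//.
have fU : mu (A `|` B) \is a fin_num by rewrite AU fin_numB fin_numD fA fB.
rewrite -(fineK fU) -(fineK fI) -(fineK fA) -(fineK fB) !wintrE -!EFinD lee_fin.
apply: wintr_submod; first exact: fine_ge0.
- by rewrite fine_le// le_measure ?inE//; exact: subIsetl.
- by rewrite fine_le// le_measure ?inE//; exact: subIsetr.
- apply/EFin_inj; rewrite !EFinD !fineK// AU subeK//.
Qed.

Lemma wint_subadditive (A B : set R) : measurable A -> measurable B ->
  A `<=` dom gamma -> B `<=` dom gamma ->
  (wint (mu (A `|` B)) <= wint (mu A) + wint (mu B))%E.
Proof.
move=> mA mB Ad Bd; apply: le_trans (wint_submod mA mB Ad Bd).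
by rewrite leeDl// wint_ge0.
Qed.

(** Dominated convergence over shrinking intervals. The point 0 is left out of [D], so that the
    indicators tend to 0 everywhere on it. *)
Lemma wint_cvg0 (e : R) : 0 < e -> exists2 d : R, 0 < d & (wint d%:E <= e%:E)%E.
Proof.
move=> e0; pose D : set R := dom gamma `&` `]0, 1[.
have mD : measurable D.
  by apply: measurableI; [exact: measurable_dom|exact: measurable_itv].
have Dd : D `<=` dom gamma by move=> t [].
pose I (n : nat) : set R := `]-oo, n.+1%:R^-1[%classic.
pose f_ (n : nat) (t : R) : \bar R := ((w t)%:E * (\1_(I n) t)%:E)%E.
have n10 (n : nat) : 0 < n.+1%:R^-1 :> R by rewrite invr_gt0.
have n11 (n : nat) : n.+1%:R^-1 <= 1 :> R by rewrite invf_le1// ler1n.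
have wE n : wint n.+1%:R^-1%:E = (\int[mu]_(t in D) f_ n t)%E.
  transitivity (\int[mu]_(t in D `&` I n) (w t)%:E)%E; last first.
    exact: integral_setI_indic.
  rewrite /wint (@ge0_negligible_integral _ _ _ mu _ [set 0])//.
  - congr (integral _ _ _); apply/seteqP; split=> t; rewrite /D /I /= !in_itv/=.
      move=> [[[t0 tg] tn] tN0]; rewrite lte_fin in tn.
      have {}t0 : 0 < t by rewrite lt_neqAle t0 eq_sym andbT; apply/eqP.
      by rewrite tn t0 (lt_le_trans tn (n11 n)); split=> //; split=> //; split=> //; exact: ltW.
    move=> [[dt /andP[t0 t1]] tn]; split; first by rewrite lte_fin.
    by move=> t00; rewrite t00 ltxx in t0.
  - exact: measurable_dom_lt.
  - by apply: measurable_weightS => t [].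
  - by move=> t [dt _]; rewrite lee_fin weight_ge0.
  - exact: lebesgue_measure_set1.
have : (\int[mu]_(t in D) f_ n t)%E @[n --> \oo] --> (\int[mu]_(t in D) cst 0%E t)%E.
  apply: (@dominated_cvg _ _ _ mu D mD f_ (cst 0%E) (EFin \o w)).
  - move=> n; apply: emeasurable_funM; first exact: measurable_weightS.
    by apply/measurable_EFinP/measurable_indic; exact: measurable_itv.
  - move=> t [_ /=]; rewrite in_itv/= => /andP[t0 _].
    apply: cvg_near_cst; near=> n.
    have tn : t^-1 < n%:R by near: n; exact: nbhs_infty_gtr.
    rewrite /f_ indicE memNset ?mule0// /I/= in_itv/= => nt.
    have : t^-1 < n.+1%:R by rewrite (lt_trans tn)// ltr_nat.
    by rewrite -[ltRHS]invrK ltf_pV2 ?posrE ?invr_gt0// ltNge (ltW nt).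
  - by [].
  - apply/integrableP; split; first exact: measurable_weightS.
    rewrite (_ : (\int[mu]_(t in D) _)%E = (\int[mu]_(t in D) (w t)%:E)%E); last first.
      apply: eq_integral => t /[!inE] Dt.
      by rewrite /= ger0_norm// weight_ge0//; exact: Dd.
    apply: le_lt_trans (wint_lty 1); apply: weight_integral_le => //.
    - exact: measurable_dom_lt.
    - by move=> t [dt /=]; rewrite in_itv/= => /andP[_ t1]; split=> //; rewrite lte_fin.
  - move=> n t Dt; rewrite /f_ indicE.
    have w0 := weight_ge0 (Dd _ Dt).
    by case: (_ \in _); rewrite ?mule1 ?mule0/= ?normr0 lee_fin// ger0_norm.
rewrite integral0 => /fine_cvgP[_] /cvgrPdist_le /(_ e e0) [N _ /(_ N (leqnn N))] /=.
rewrite sub0r normrN -wE -/(wintr _) ger0_norm ?wintr_ge0// => we.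
by exists N.+1%:R^-1 => //; rewrite wintrE lee_fin.
Unshelve. all: by end_near. Qed.

End weight_theory.

(** * Decreasing rearrangements *)

Section rearrangement.
Context {R : realType}.
Local Notation mu := (@lebesgue_measure R).
Variable gamma : \bar R.
Hypothesis gamma_gt0 : (0 < gamma)%E.
Implicit Types f g v : R -> R.

Lemma measurable_super_level f s : L0 gamma f ->
  measurable [set t | dom gamma t /\ s < f t].
Proof.
move=> mf.
have := measurable_lte (measurable_dom gamma) (measurable_cst s%:E)
  (proj2 (measurable_EFinP _ _) mf).
by congr (measurable _).
Qed.

Lemma L0_indic f (C : set R) : L0 gamma f -> measurable (dom gamma `&` C) ->
  L0 gamma (fun t => f t * \1_C t).
Proof.
move=> mf mC.
apply: (eq_measurable_fun (fun t => f t * \1_(dom gamma `&` C) t)).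
  by move=> t dt; rewrite !indicE in_setI dt.
by apply: measurable_funM => //; apply: measurable_indic.
Qed.

Lemma L0_norm f : L0 gamma f -> L0 gamma (fun t => `|f t|).
Proof. by move=> mf; apply: measurableT_comp mf. Qed.

Lemma measurable_distr_set f s : L0 gamma f ->
  measurable [set t | dom gamma t /\ s < `|f t|].
Proof. by move=> /L0_norm mf; exact: (measurable_super_level _ mf). Qed.

Lemma distr_fun_le f g s s' : L0 gamma f -> L0 gamma g ->
  (forall t, dom gamma t -> s' < `|g t| -> s < `|f t|) ->
  (distr_fun gamma g s' <= distr_fun gamma f s)%E.
Proof.
move=> mf mg fg; apply: le_measure; rewrite ?inE; [exact: measurable_distr_set..|].
by move=> t [dt gs]; split=> //; exact: fg.
Qed.

Lemma distr_fun_ni f s s' : L0 gamma f -> s <= s' ->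
  (distr_fun gamma f s' <= distr_fun gamma f s)%E.
Proof.
by move=> mf ss'; apply: distr_fun_le => // t _; exact: le_lt_trans.
Qed.

(** The set where [|f| > s] is the increasing union of those where [|f| > s + 1/(n+1)]. *)
Lemma distr_fun_right_continuous f s x : L0 gamma f ->
  (forall s', s < s' -> (distr_fun gamma f s' <= x)%E) ->
  (distr_fun gamma f s <= x)%E.
Proof.
move=> mf H.
apply: (@measure_exhaustion _ _ (fun n => [set t | dom gamma t /\ s + n.+1%:R^-1 < `|f t|])).
- exact: measurable_distr_set.
- by move=> n; exact: measurable_distr_set.
- move=> m n mn t [dt sm]; split=> //; apply: le_lt_trans sm.
  by rewrite lerD2l lef_pV2 ?posrE// ler_nat.
- move=> t [dt sf]; have d0 : 0 < `|f t| - s by rewrite subr_gt0.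
  have [N _ HN] := near_infty_natSinv_lt (PosNum d0).
  have h : N.+1%:R^-1 < `|f t| - s := HN N (leqnn N).
  by exists N; split=> //; rewrite -ltrBrDl.
- move=> n; apply: le_trans (H (s + n.+1%:R^-1) _); last by rewrite ltrDl invr_gt0.
  apply: le_measure; rewrite ?inE; [|exact: measurable_distr_set|by move=> t []].
  by apply: measurableI; exact: measurable_distr_set.
Qed.

Lemma rearr_ge0 f t : (0 <= rearr gamma f t)%E.
Proof. by apply: le_ereal_inf_tmp => _ [l [l0 _] <-]; rewrite lee_fin ltW. Qed.

(** The Galois connection between rearrangement and distribution function. It rests on right
    continuity of the latter, through which the infimum is attained. *)
Lemma rearr_le f t s : L0 gamma f -> 0 <= s ->
  (rearr gamma f t <= s%:E)%E = (distr_fun gamma f s <= t%:E)%E.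
Proof.
move=> mf s0; apply/idP/idP => [fs|ds].
  apply: distr_fun_right_continuous => // s' ss'.
  have : (rearr gamma f t < s'%:E)%E by rewrite (le_lt_trans fs).
  move=> /ereal_inf_lt[_ [l [l0 dl] <-]]; rewrite lte_fin => ls'.
  by rewrite (le_trans _ dl)// distr_fun_ni// ltW.
apply/lee_addgt0Pr => e e0; rewrite -EFinD; apply: ereal_inf_lbound.
exists (s + e) => //; split; first by rewrite ltr_wpDl.
by rewrite (le_trans _ ds)// distr_fun_ni// lerDl ltW.
Qed.

Lemma lt_rearr f t s : L0 gamma f -> 0 <= s ->
  (s%:E < rearr gamma f t)%E = (t%:E < distr_fun gamma f s)%E.
Proof. by move=> mf s0; rewrite ltNge rearr_le// -ltNge. Qed.

Lemma rearr_ni f t t' : t <= t' -> (rearr gamma f t' <= rearr gamma f t)%E.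
Proof.
move=> tt'; apply: le_ereal_inf => _ [l [l0 dl] <-]; exists l => //; split=> //.
by rewrite (le_trans dl)// lee_fin.
Qed.

Lemma rearr_eq f g t : (forall t, dom gamma t -> `|f t| = `|g t|) ->
  rearr gamma f t = rearr gamma g t.
Proof.
move=> fg; rewrite /rearr; congr ereal_inf; congr image.
apply/funext => l; rewrite /= /distr_fun; congr (_ /\ (mu _ <= _)%E).
by apply/seteqP; split=> u [du]; [rewrite fg|rewrite -fg].
Qed.

Lemma measurable_rearr f (D : set R) : is_interval D ->
  measurable_fun D (rearr gamma f).
Proof.
by move=> iD; apply: nonincreasing_measurable_in => // s t _ _; exact: rearr_ni.
Qed.

Lemma eq_ereal_ge0 (x y : \bar R) : (0 <= x)%E -> (0 <= y)%E ->
  (forall s : R, 0 <= s -> (x <= s%:E)%E = (y <= s%:E)%E) -> x = y.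
Proof.
have h (a b : \bar R) : (0 <= a)%E -> (0 <= b)%E ->
    (forall s : R, 0 <= s -> (a <= s%:E)%E = (b <= s%:E)%E) -> (a <= b)%E.
  case: b => [b| |] a0 b0 H; [by rewrite H ?lexx// -lee_fin|exact: leey|by []].
move=> x0 y0 H; apply/eqP; rewrite eq_le; apply/andP; split; apply: h => //.
by move=> s s0; rewrite H.
Qed.

Lemma rearr_scale f k t : L0 gamma f -> 0 < k ->
  rearr gamma (k \*o f) t = (k%:E * rearr gamma f t)%E.
Proof.
move=> mf k0.
have mkf : L0 gamma (k \*o f) by apply: measurable_funM => //; exact: measurable_cst.
apply: eq_ereal_ge0; [exact: rearr_ge0|by rewrite mule_ge0 ?rearr_ge0// lee_fin ltW|].
move=> s s0; rewrite rearr_le// muleC -lee_pdivlMr// -EFinM.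
rewrite rearr_le//; last by rewrite divr_ge0// ltW.
rewrite /distr_fun; congr (mu _ <= _)%E; apply/seteqP.
by split=> u [du] /=; rewrite normrM gtr0_norm// ltr_pdivrMr// mulrC.
Qed.

(* The rearrangement of a nonincreasing function differs from it only where
   some rational separates them. *)
Lemma rearr_nonincreasing_ae g :
  (forall t, dom gamma t -> 0 <= g t) ->
  (forall s t, dom gamma s -> dom gamma t -> s <= t -> g t <= g s) ->
  {ae mu, forall t, dom gamma t -> rearr gamma g t = (g t)%:E}.
Proof.
move=> g0 gni.
have mg : L0 gamma g.
  apply/measurable_EFinP; apply: nonincreasing_measurable_in => //.
    exact: is_interval_dom.
have gle t : dom gamma t -> (rearr gamma g t <= (g t)%:E)%E.
  move=> dt; rewrite rearr_le ?g0//.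
  have [t0 _] := dt.
  rewrite -[leRHS](@lebesgue_measure_lt R t%:E)//.
  apply: le_measure; rewrite ?inE; [exact: measurable_distr_set| exact: measurable_lt_ereal|].
  move=> u [du]; rewrite ger0_norm ?g0// => gtu; split; first by case: du.
  by rewrite lte_fin ltNge; apply/negP => tu; have := gni _ _ dt du tu; rewrite leNgt gtu.
pose N (q : rat) := [set t | dom gamma t /\ ratr q < g t /\ (rearr gamma g t <= (ratr q)%:E)%E].
(* For [s < t] in [N q] the function exceeds [q] on all of [[0, t)], so its distribution function at
   [q] exceeds [s], against [rearr g s <= q]. Each [N q] is thus at most a point and the exceptional
   set is countable. *)
have N1 q s t : 0 <= q -> N q s -> N q t -> s = t.
  move=> q0; wlog st : s t / s <= t.
    by move=> H Ns Nt; case: (leP s t) => [|/ltW] /H; [exact|move=> /(_ Nt Ns)].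
  move=> [ds [gs rs]] [dt [gt rt]]; move: st; rewrite le_eqVlt => /predU1P[//|st].
  exfalso; move: rs; rewrite rearr_le ?ler0q//; apply/negP; rewrite -ltNge.
  have [t0 _] := dt.
  apply: (@lt_le_trans _ _ t%:E); first by rewrite lte_fin.
  rewrite -[leLHS](@lebesgue_measure_lt R t%:E)//.
  apply: le_measure; rewrite ?inE; [exact: measurable_lt_ereal|exact: measurable_distr_set|].
  move=> u [u0]; rewrite lte_fin => ut.
  have du : dom gamma u by split=> //; case: dt => _; apply: le_lt_trans; rewrite lee_fin ltW.
  by split=> //; rewrite ger0_norm ?g0// (lt_le_trans gt)// gni// ltW.
have cN : countable (\bigcup_(q in [set q : rat | 0 <= q]) N q).
  apply: bigcup_countable => // q q0.
  have [[t Nt]|N0] := pselect (N q !=set0).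
    apply: sub_countable (countable1 t); apply: subset_card_le => s Ns.
    exact: N1 Ns Nt.
  by rewrite (_ : N q = set0)//; apply/eqP/negPn/negP => /set0P.
exists (\bigcup_(q in [set q : rat | 0 <= q]) N q); split.
- exact: countable_measurable.
- exact: countable_lebesgue_measure0.
- move=> t /= /not_implyP[dt]; have := gle t dt; rewrite le_eqVlt => /predU1P[->//|rg _].
  have := rearr_ge0 g t; move: rg; case rE : (rearr gamma g t) => [r| |]//.
  rewrite lte_fin lee_fin => rg r0; have [q] := rat_in_itvoo rg.
  rewrite in_itv/= => /andP[rq qg]; exists q => /=; first by rewrite -(@ler0q R); lra.
  by split=> //; split=> //; rewrite rE lee_fin ltW.
Qed.

End rearrangement.

(** * Submajorization *)

Section submajorization.
Context {R : realType}.
Local Notation mu := (@lebesgue_measure R).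
Variables (gamma : \bar R) (phi w : R -> R).
Hypotheses (gamma_gt0 : (0 < gamma)%E) (Hw : weight gamma w).
Implicit Types f g h v : R -> R.

(** Hardy-Littlewood: the layer of [v] at height [s] meets [E] in measure at most the minimum of
    [mu E] and the distribution function, which is the measure of the corresponding layer of
    [rearr v] on [[0, mu E]]. *)
Lemma submaj_integral_le v (E : set R) : L0 gamma v ->
  (forall t, dom gamma t -> 0 <= v t) -> submaj gamma v w ->
  measurable E -> E `<=` dom gamma ->
  (\int[mu]_(t in E) (v t)%:E <= wint gamma w (mu E))%E.
Proof.
move=> mv v0 vw mE Ed.
have vS A : measurable A -> A `<=` dom gamma -> measurable_fun A (EFin \o v).
  move=> mA Ad; apply/measurable_EFinP; apply: measurable_funS Ad mv.
  exact: measurable_dom.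
(* Submajorization only speaks of lengths below [gamma]; sets of full or infinite measure are
   treated afterwards. *)
have small (A : set R) x : measurable A -> A `<=` dom gamma -> mu A = x%:E ->
    (x%:E < gamma)%E -> (\int[mu]_(t in A) (v t)%:E <= wint gamma w (mu A))%E.
  move=> mA Ad muA xg; have : (0 <= mu A)%E by exact: measure_ge0.
  rewrite muA lee_fin le_eqVlt => /predU1P[x0|x0].
    rewrite (_ : (\int[mu]_(t in A) _)%E = 0%E) ?(wint_ge0 Hw)//.
    apply: null_set_integral => //; first exact: vS.
    by rewrite -x0 in muA; exact: muA.
  have I0x : is_interval (`[0, x]%classic : set R) by exact: interval_is_interval.
  apply: (@le_trans _ _ (\int[mu]_(t in `[0%R, x]) rearr gamma v t)%E); last first.
    apply: le_trans (vw x x0 xg) _.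
    rewrite /wint (@ge0_negligible_integral _ _ _ mu _ [set x])//.
    - apply: (weight_integral_le gamma_gt0 Hw) => //.
      + by apply: measurableD => //; exact: measurable_itv.
      + exact: measurable_dom_lt.
      + move=> t [/=]; rewrite in_itv/= => /andP[t0 tx] /eqP tNx.
        have {}tx : t < x by rewrite lt_neqAle tNx.
        split; last by rewrite lte_fin.
        by split=> //; rewrite (lt_trans _ xg)// lte_fin.
    - apply: (measurable_weightS gamma_gt0 Hw) => t /=.
      rewrite in_itv/= => /andP[t0 tx]; split=> //.
      by rewrite (le_lt_trans _ xg)// lee_fin.
    - move=> t /=; rewrite in_itv/= lee_fin => /andP[t0 tx].
      apply: (weight_ge0 Hw); split=> //.
      by rewrite (le_lt_trans _ xg)// lee_fin.
    - exact: lebesgue_measure_set1.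
  rewrite layer_cake_measure//; last 2 first.
  - exact: vS.
  - by move=> t /Ad/v0; rewrite lee_fin.
  rewrite [leRHS]layer_cake_measure//; last 2 first.
  - exact: measurable_rearr.
  - by move=> t _; exact: rearr_ge0.
  have mA1 s : measurable (A `&` [set t | (s%:E < (EFin \o v) t)%E]).
    have := measurable_lte mA (measurable_cst s%:E) (vS _ mA Ad).
    by congr (measurable _).
  have mI1 s : measurable (`[0, x]%classic `&` [set t | (s%:E < rearr gamma v t)%E]).
    by apply: measurable_lte => //; exact: measurable_rearr.
  apply: ge0_le_integral => //.
  - by apply: measurable_level_measure => //; [exact: vS|exact: interval_is_interval].
  - apply: measurable_level_measure => //; last exact: interval_is_interval.
    exact: measurable_rearr.
  - move=> s /=; rewrite in_itv/= andbT => s0.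
    apply: (@le_trans _ _ (mine x%:E (distr_fun gamma v s))).
      rewrite le_min; apply/andP; split.
        by rewrite -muA; apply: le_mu => //; exact: mA1.
      apply: le_mu => //; first exact: measurable_distr_set.
      move=> t [At /= st]; split; first exact: Ad.
      by move: st; rewrite lte_fin ger0_norm// v0//; exact: Ad.
    rewrite -[leLHS]lebesgue_measure_lt; last by rewrite le_min lee_fin ltW//=.
    apply: le_mu => //; first exact: measurable_lt_ereal.
    move=> t [t0]; rewrite lt_min lte_fin => /andP[tx td]; split=> /=.
      by rewrite in_itv/= t0 ltW.
    by rewrite lt_rearr.
have [Einf|Efin] := eqVneq (mu E) +oo%E.
  have gy : gamma = +oo%E.
    apply/eqP/negPn/negP => /(measure_subdom_fin gamma_gt0 mE Ed).
    by rewrite Einf.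
  by rewrite Einf (wint_pinfty Hw gy) leey.
have mEfin : mu E \is a fin_num by rewrite ge0_fin_numE// ltey.
have [Eg|gE] := ltP (mu E) gamma.
  by apply: (small _ (fine (mu E))) => //; rewrite fineK.
have Eg : mu E = gamma.
  apply/eqP; rewrite eq_le gE andbT -(measure_dom (ltW gamma_gt0)).
  by apply: le_mu => //; exact: measurable_dom.
(* A set of full finite measure is exhausted by its parts to the left of [r n < gamma], whose
   measures are below [gamma]. *)
pose g := fine gamma.
have gE' : gamma = g%:E by rewrite /g -Eg fineK.
have g0 : 0 < g by rewrite -lte_fin -gE'.
pose r n := g - g / n.+1%:R.
have rg n : r n < g by rewrite ltrBlDr ltrDl divr_gt0.
apply: (@integral_exhaustion_le _ E (fun n => `]-oo, r n[%classic)) => //.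
- move=> m n mn t /=; rewrite !in_itv/= => /lt_le_trans; apply.
  by rewrite lerD2l lerN2 ler_pM2l// lef_pV2 ?posrE// ler_nat.
- move=> t Et; have [t0] := Ed _ Et; rewrite gE' lte_fin => tg.
  have d0 : 0 < (g - t) / g by rewrite divr_gt0// subr_gt0.
  have [N _ HN] := near_infty_natSinv_lt (PosNum d0).
  have h : N.+1%:R^-1 < (g - t) / g := HN N (leqnn N).
  exists N; rewrite /= in_itv/= /r ltrBrDl -ltrBrDr.
  by rewrite mulrC -ltr_pdivlMr.
- exact: vS.
- by move=> t /Ed/v0; rewrite lee_fin.
- move=> n; have mEn : measurable (E `&` `]-oo, r n[) by exact: measurableI.
  have End : E `&` `]-oo, r n[ `<=` dom gamma by move=> t [/Ed].
  have Enr : (mu (E `&` `]-oo, r n[) < gamma)%E.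
    rewrite gE'; apply: (@le_lt_trans _ _ (Num.max 0 (r n))%:E); last first.
      by rewrite lte_fin gt_max g0 rg.
    rewrite -[leRHS]lebesgue_measure_lt ?lee_fin ?le_max ?lexx//.
    apply: le_mu => //; first exact: measurable_lt_ereal.
    move=> t [/Ed[t0 _]] /=; rewrite in_itv/= => tr; split=> //.
    by rewrite lte_fin lt_max tr orbT.
  have fin : mu (E `&` `]-oo, r n[) \is a fin_num.
    by rewrite ge0_fin_numE// (lt_trans Enr)// gE' ltry.
  apply: (@le_trans _ _ (wint gamma w (mu (E `&` `]-oo, r n[)))).
    by apply: (small _ (fine (mu (E `&` `]-oo, r n[)))) => //; rewrite fineK.
  by apply: (wint_nd gamma_gt0 Hw); apply: le_mu => //; exact: subIsetl.
Qed.

(* For [l < rearr v t] the set [A = {v > l}] has measure greater than [t];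
   averaging the hypothesis over [E] and [A] and using the concavity of the
   primitive of [w] replaces a subset of measure exactly [t]. *)
Lemma submaj_of_integral_le v : L0 gamma v ->
  (forall t, dom gamma t -> 0 <= v t) ->
  (forall E, measurable E -> E `<=` dom gamma ->
    (\int[mu]_(t in E) (v t)%:E <= wint gamma w (mu E))%E) ->
  submaj gamma v w.
Proof.
move=> mv v0 vle t t0 tg.
have vS A : measurable A -> A `<=` dom gamma -> measurable_fun A (EFin \o v).
  move=> mA Ad; apply/measurable_EFinP; apply: measurable_funS Ad mv.
  exact: measurable_dom.
have vS0 A s : A `<=` dom gamma -> A s -> (0 <= (v s)%:E)%E.
  by move=> Ad As; rewrite lee_fin v0//; exact: Ad.
pose W := wintr gamma w.
have key l e (E : set R) : 0 <= l -> (t%:E < distr_fun gamma v l)%E ->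
    measurable E -> E `<=` [set s | dom gamma s /\ l < `|v s|] ->
    mu E = e%:E -> e <= t ->
    (\int[mu]_(s in E) (v s)%:E + (l * (t - e))%:E <= (W t)%:E)%E.
  move=> l0 tl mE El muE et.
  pose A := [set s | dom gamma s /\ l < `|v s|].
  have mA : measurable A by exact: measurable_distr_set.
  (* [A] may have infinite measure; [B n] keeps [E], has finite measure, and for large [n] still has
     measure above [t]. *)
  pose B n := E `|` (A `&` `[0, n%:R]).
  have mB n : measurable (B n).
    by apply: measurableU => //; apply: measurableI => //; exact: measurable_itv.
  have BA n : B n `<=` A by move=> s [/El//|[]].
  have Ad : A `<=` dom gamma by move=> s [].
  have Ed : E `<=` dom gamma by move=> s /El [].
  have Bfin n : mu (B n) \is a fin_num.
    rewrite ge0_fin_numE//; apply: (@le_lt_trans _ _ (mu E + mu (`[0%R, (n%:R)%R]%classic : set R))%E).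
      apply: (@le_trans _ _ (mu (E `|` `[0, n%:R]))); last exact: measureU2.
      apply: le_mu; [exact: mB|exact: measurableU|].
      by apply: setUS => s [].
    rewrite muE; apply: lte_add_pinfty; first exact: ltry.
    have := lebesgue_measure_itv `[0%R, (n%:R : R)]; rewrite /= lte_fin => ->.
    by case: ifP => _; rewrite ?ltry// -EFinD ltry.
  have [n tn] : exists n, (t%:E < mu (B n))%E.
    apply: contrapT => /forallNP H; move: tl; rewrite ltNge => /negP; apply.
    apply: (@measure_exhaustion _ A (fun n => `[0, n%:R]%classic)) => //.
    - by move=> m n mn s /=; rewrite !in_itv/= => /andP[-> /le_trans]; apply; rewrite ler_nat.
    - move=> s [[s0 _] _]; have [k sk] := exists_nat_ge s.
      by exists k; rewrite /= in_itv/= s0.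
    - move=> n; apply: (@le_trans _ _ (mu (B n))); last by rewrite leNgt; apply/negP/H.
      apply: le_mu; [exact: measurableI|exact: mB|exact: subsetUr].
  pose a := fine (mu (B n)).
  have muB : mu (B n) = a%:E by rewrite fineK.
  have ta : t < a by rewrite -lte_fin -muB.
  have ae : 0 < a - e by lra.
  (* The weight for which [t] is the average of [a = mu (B n)] and [e = mu E]. *)
  pose th := (t - e) / (a - e).
  have th0 : 0 <= th by apply: divr_ge0; lra.
  have th1 : th <= 1 by rewrite ler_pdivrMr//; lra.
  have BE : E `<=` B n by exact: subsetUl.
  have mBE : measurable (B n `\` E) by exact: measurableD.
  have Bd : B n `<=` dom gamma by move=> s /BA/Ad.
  have vE := vle E mE Ed; have vB := vle (B n) (mB n) Bd.
  rewrite muE (wintrE gamma_gt0 Hw) in vE; rewrite muB (wintrE gamma_gt0 Hw) in vB.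
  have splitB : (\int[mu]_(s in B n) (v s)%:E = \int[mu]_(s in E) (v s)%:E +
      \int[mu]_(s in B n `\` E) (v s)%:E)%E.
    rewrite -ge0_integral_setU//.
    - by rewrite setDUK.
    - by rewrite setDUK//; exact: vS.
    - by rewrite setDUK// => s; exact: vS0.
    - by apply/disj_setPS => s [Es [_ /(_ Es)]].
  have muBE : mu (B n `\` E) = (a - e)%:E.
    have : mu (B n) = (mu E + mu (B n `\` E))%E.
      by rewrite -measureU// ?setDUK// setIDA setIC -setIDA setDv setI0.
    rewrite muB muE; case : (mu (B n `\` E)) => [c| |]//= [->].
    by congr (_%:E); ring.
  have lBE : ((l * (a - e))%:E <= \int[mu]_(s in B n `\` E) (v s)%:E)%E.
    apply: (@le_trans _ _ (\int[mu]_(s in B n `\` E) cst l%:E s)%E).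
      by rewrite integral_cst_mu// muBE EFinM.
    apply: ge0_le_integral => //.
    - by apply: vS => // s [/Bd].
    - move=> s [/BA[ds +] _]; rewrite lee_fin ger0_norm ?v0//.
      by move/ltW.
  have W0 : 0 <= e by rewrite -lee_fin -muE measure_ge0.
  have a0 : 0 <= a by lra.
  have := wintr_concave gamma_gt0 Hw a0 W0 th0 th1.
  have -> : th * a + (1 - th) * e = t by rewrite /th; field; rewrite gt_eqF.
  move: vB vE lBE; rewrite splitB.
  have : (0 <= \int[mu]_(s in E) (v s)%:E)%E by apply: integral_ge0 => s; exact: vS0.
  have : (0 <= \int[mu]_(s in B n `\` E) (v s)%:E)%E.
    by apply: integral_ge0 => s [/Bd ds _]; rewrite lee_fin v0.
  case: (\int[mu]_(s in E) (v s)%:E)%E => [x| |]//.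
  case: (\int[mu]_(s in B n `\` E) (v s)%:E)%E => [y| |]//.
  rewrite -!EFinD !lee_fin => y0 x0 xy xe ly cc.
  have -> : l * (t - e) = th * (l * (a - e)) by rewrite /th; field; rewrite gt_eqF.
  have h1 := ler_wpM2l th0 ly; have h2 := ler_wpM2l th0 xy.
  have th1' : 0 <= 1 - th by lra.
  have h3 := ler_wpM2l th1' xe.
  rewrite /W; clear -h1 h2 h3 cc; clearbody th a.
  by move: (wintr gamma w) h1 h2 h3 cc => W h1 h2 h3 cc; lra.
have l_fin : (rearr gamma v t <= (W t / t)%:E)%E.
  have Wt0 : 0 <= W t by exact: wintr_ge0.
  rewrite leNgt lt_rearr//; last by rewrite divr_ge0// ltW.
  apply/negP => tl.
  have [s Ws] : exists2 s, W t / t < s & (t%:E < distr_fun gamma v s)%E.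
    apply: contrapT => H; move: tl; rewrite ltNge => /negP; apply.
    apply: distr_fun_right_continuous => // s' Ws'.
    by rewrite leNgt; apply/negP => s't; apply: H; exists s'.
  have s0 : 0 <= s by rewrite ltW// (le_lt_trans _ Ws)// divr_ge0// ltW.
  (* The empty set gives [s * t <= W t], contrary to the choice of [s]; so the rearrangement is
     finite at [t]. *)
  move=> /(key s 0 set0 s0) => /(_ measurable0 (@sub0set _ _) (measure0 _) (ltW t0)).
  rewrite integral_set0 add0e lee_fin subr0.
  by move: Ws; rewrite ltr_pdivrMr// ltNge => /negP.
have : (0 <= rearr gamma v t)%E by exact: rearr_ge0.
move: l_fin; case lE : (rearr gamma v t) => [l| |]//; rewrite !lee_fin => _ l0.
(* With [l] the value of the rearrangement at [t], its integral over [[0, t]] is at most the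
   integral of [v] over [E] plus [l] times the missing length [t - e]. *)
pose E := [set s | dom gamma s /\ l < `|v s|].
have mE : measurable E by exact: measurable_distr_set.
have Ed : E `<=` dom gamma by move=> s [].
have Et : (mu E <= t%:E)%E by rewrite -(rearr_le _ mv l0) lE.
have Efin : mu E \is a fin_num by rewrite ge0_fin_numE// (le_lt_trans Et)// ltry.
pose e := fine (mu E).
have muE : mu E = e%:E by rewrite fineK.
have et : e <= t by rewrite -lee_fin -muE.
have e0 : 0 <= e by rewrite -lee_fin -muE.
have bound : (\int[mu]_(s in E) (v s)%:E + (l * (t - e))%:E <= (W t)%:E)%E.
  move: l0; rewrite le_eqVlt => /predU1P[l00|l0].
    rewrite -l00 mul0r adde0 (le_trans (vle E mE Ed))// muE (wintrE gamma_gt0 Hw) lee_fin.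
    exact: wintr_nd.
  have step l' : 0 <= l' -> l' < l ->
      (\int[mu]_(s in E) (v s)%:E + (l' * (t - e))%:E <= (W t)%:E)%E.
    move=> l'0 l'l; apply: key => //; first by rewrite -lt_rearr// lE lte_fin.
    by move=> s [ds ls]; split=> //; exact: lt_trans ls.
  have := step 0 (lexx 0) l0.
  have : (0 <= \int[mu]_(s in E) (v s)%:E)%E by apply: integral_ge0 => s; exact: vS0.
  move: step; case: (\int[mu]_(s in E) (v s)%:E)%E => [x| |]// step x0 _.
  rewrite -EFinD lee_fin; apply/ler_addgt0Pr => d d0.
  have te1 : 0 < t - e + 1 by lra.
  (* The estimate is known for levels strictly below [l] only; this level loses at most [d]. *)
  pose l' := Num.max 0 (l - d / (t - e + 1)).
  have dt0 : 0 < d / (t - e + 1) by exact: divr_gt0.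
  have l'0 : 0 <= l' by rewrite le_max lexx.
  have l'l : l' < l by rewrite gt_max l0/=; lra.
  have := step l' l'0 l'l; rewrite -EFinD lee_fin.
  have : l - d / (t - e + 1) <= l' by rewrite le_max lexx orbT.
  have te0 : 0 <= t - e by lra.
  move=> /(ler_wpM2r te0).
  have : d / (t - e + 1) * (t - e) <= d.
    by rewrite mulrAC ler_pdivrMr//; nra.
  by lra.
have I0t : is_interval (`[0, t]%classic : set R) by exact: interval_is_interval.
have mI0t : measurable (`[0, t]%classic : set R) by exact: measurable_itv.
have mR : measurable_fun (`[0, t]%classic : set R) (rearr gamma v) by exact: measurable_rearr.
apply: (@le_trans _ _ (W t)%:E); last first.
  rewrite -(wintrE gamma_gt0 Hw); apply: (weight_integral_le gamma_gt0 Hw) => //.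
  - exact: measurable_dom_lt.
  - by move=> s [[s0 _]] /=; rewrite lte_fin in_itv/= s0 => /ltW.
  - move=> s /=; rewrite in_itv/= => /andP[s0 st]; split=> //.
    by rewrite (le_lt_trans _ tg)// lee_fin.
apply: le_trans bound; rewrite layer_cake_measure//; last by move=> s _; exact: rearr_ge0.
rewrite [X in (_ <= X + _)%E]layer_cake_measure//; last 2 first.
- exact: vS.
- by move=> s; exact: vS0.
(* The remainder is written as an integral over levels in [[0, l[], so that both sides can be
   compared level by level. *)
have intl : ((l * (t - e))%:E =
    \int[mu]_(s in `[0%R, +oo[) ((t - e) * \1_(`[0, l[ : set R) s)%:E)%E.
  rewrite (_ : (fun s => _) = (fun s => (t - e)%:E * (\1_(`[0, l[ : set R) s)%:E)%E); last first.
    by apply/funext => s; rewrite EFinM.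
  rewrite ge0_integralZl//; last 2 first.
  - by apply/measurable_EFinP/measurable_indic; exact: measurable_itv.
  - by rewrite lee_fin; lra.
  rewrite integral_indic//.
  rewrite (_ : _ `&` _ = `[0, l[%classic); last first.
    apply/seteqP; split=> s /=; first by case.
    by rewrite !in_itv/= andbT => /andP[s0 sl]; rewrite s0 sl.
  rewrite mulrC EFinM; congr (_ * _)%E.
  have := lebesgue_measure_itv `[0%R, l[; rewrite /= lte_fin oppr0 adde0 => ->.
  by move: l0; rewrite le_eqVlt => /predU1P[<-|->]//; rewrite ltxx.
rewrite intl -ge0_integralD//; last 3 first.
- by apply: measurable_level_measure => //; [exact: vS|exact: interval_is_interval].
- by move=> s _; rewrite lee_fin mulr_ge0//; lra.
- by apply/measurable_EFinP; apply: measurable_funM => //;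
    exact: measurable_indic.
apply: ge0_le_integral => //.
- by apply: measurable_level_measure => //; exact: interval_is_interval.
- apply: emeasurable_funD.
    by apply: measurable_level_measure => //; [exact: vS|exact: interval_is_interval].
  apply/measurable_EFinP; apply: measurable_funM => //;
    exact: measurable_indic.
move=> s /=; rewrite in_itv/= andbT => s0.
have mLE : measurable (E `&` [set u | (s%:E < (v u)%:E)%E]).
  by apply: measurable_lte => //; exact: vS.
have mLI : measurable (`[0, t] `&` [set u | (s%:E < rearr gamma v u)%E]).
  exact: measurable_lte.
rewrite indicE; have [sl|ls] := ltP s l.
  rewrite mem_set/= ?in_itv/= ?s0 ?sl// mulr1.
  rewrite (_ : E `&` _ = E); last first.
    apply/seteqP; split=> u; first by case.
    move=> Eu; split=> //=; case: Eu => du; rewrite ger0_norm ?v0// lte_fin.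
    exact: lt_trans.
  rewrite muE -EFinD addrC subrK.
  apply: (@le_trans _ _ (mu (`[0, t]%classic : set R))).
    by apply: le_mu => //; exact: subIsetl.
  by have := lebesgue_measure_itv `[0%R, t]; rewrite /= lte_fin t0 oppr0 adde0 => ->.
rewrite memNset/= ?in_itv/= ?s0 ?ltNge ?ls// mulr0 adde0.
apply: (@le_trans _ _ (distr_fun gamma v s)).
  rewrite -[leRHS]lebesgue_measure_lt//.
  apply: le_mu => //; first exact: measurable_lt_ereal.
  move=> u [/=]; rewrite in_itv/= => /andP[u0 _]; rewrite lt_rearr//.
apply: le_mu => //; first exact: measurable_distr_set.
move=> u [du su]; have vu0 : 0 <= v u by exact: v0.
rewrite ger0_norm// in su; split; last by rewrite /= lte_fin.
by split=> //; rewrite ger0_norm// (le_lt_trans ls).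
Qed.

End submajorization.

(** * The Lorentz functional and the modular *)

Section lorentz_functional.
Context {R : realType}.
Local Notation mu := (@lebesgue_measure R).

Lemma lebesgue_measure_shift (c : R) (A : set R) : measurable A ->
  pushforward mu ((fun s => s - c) : _ -> measurableTypeR R) A = mu A.
Proof.
move=> mA; have mf : measurable_fun setT ((fun s => s - c) : R -> measurableTypeR R).
  by apply: measurable_funB.
pose f : {mfun _ >-> _} := HB.pack ((fun s => s - c) : R -> measurableTypeR R)
  (isMeasurableFun.Build _ _ _ _ _ mf).
apply/esym; apply: (@lebesgue_measure_unique R (pushforward mu f)) => //= _ [[a b]] _ <-.
rewrite /pushforward (_ : f @^-1` _ = `]a + c, b + c]%classic); last first.
  by apply/seteqP; split=> s /=; rewrite !in_itv/= ltrBrDr lerBlDr.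
rewrite !lebesgue_measure_itv/= !lte_fin ltrD2r.
by case: ifP => // _; rewrite -!EFinD; congr (_%:E); ring.
Qed.

Lemma ge0_integral_shift (c : R) (f : R -> \bar R) :
  measurable_fun (`[0, +oo[ : set R) f ->
  (forall s, 0 <= s -> (0 <= f s)%E) ->
  (\int[mu]_(s in `[c, +oo[) f (s - c)%R = \int[mu]_(s in `[0%R, +oo[) f s)%E.
Proof.
move=> mf f0; rewrite (_ : `[c, +oo[%classic =
    ((fun s => s - c) : _ -> measurableTypeR R) @^-1` `[0%R, +oo[); last first.
  by apply/seteqP; split=> s /=; rewrite !in_itv/= !andbT subr_ge0.
rewrite -ge0_integral_pushforward//; last 2 first.
- by apply: measurable_funB.
- by move=> s; rewrite inE/= in_itv/= andbT => /f0.
apply: eq_measure_integral; first by apply: measurable_funB.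
by move=> mf' A mA AS; exact: lebesgue_measure_shift.
Qed.

Variables (gamma : \bar R) (phi w : R -> R).
Hypotheses (gamma_gt0 : (0 < gamma)%E) (Hw : weight gamma w).
Hypothesis Nphi : N_function phi.
Implicit Types f g h v u : R -> R.

(* The Lorentz functional [u |-> \int u^* w] in layer-cake form. *)
Definition lorentz u : \bar R :=
  (\int[mu]_(s in `[0%R, +oo[)
     wint gamma w (mu [set t | dom gamma t /\ (s < u t)%R]))%E.

Lemma lorentzE u : lorentz u =
  (\int[mu]_(s in `[0%R, +oo[)
     wint gamma w (mu [set t | dom gamma t /\ (s < u t)%R]))%E.
Proof. by []. Qed.

Lemma measurable_wint_level u (I : set R) : L0 gamma u -> is_interval I ->
  measurable_fun I
    (fun s => wint gamma w (mu [set t | dom gamma t /\ s < u t])).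
Proof.
move=> mu_ iI; apply: nonincreasing_measurable_in; first exact: iI.
move=> s t _ _ st.
apply: (wint_nd gamma_gt0 Hw); apply: le_mu; [exact: measurable_super_level..|].
by move=> x [dx tx]; split=> //; exact: le_lt_trans tx.
Qed.

Lemma le_lorentz u u' : L0 gamma u -> L0 gamma u' ->
  (forall t, dom gamma t -> u t <= u' t) -> (lorentz u <= lorentz u')%E.
Proof.
move=> mu1 mu2 uu'; apply: ge0_le_integral; first exact: measurable_itv.
- by move=> s _; exact: wint_ge0.
- by apply: measurable_wint_level => //; exact: interval_is_interval.
- by apply: measurable_wint_level => //; exact: interval_is_interval.
- move=> s _; apply: (wint_nd gamma_gt0 Hw); apply: le_mu; [exact: measurable_super_level..|].
  by move=> t [dt su]; split=> //; rewrite (lt_le_trans su)// uu'.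
Qed.

(** Layer cake in [u] with density [v]: the hypothesis is applied to each level set of [u]. *)
Lemma integral_le_lorentz u v : L0 gamma u -> L0 gamma v ->
  (forall t, dom gamma t -> 0 <= u t) -> (forall t, dom gamma t -> 0 <= v t) ->
  (forall E, measurable E -> E `<=` dom gamma ->
    (\int[mu]_(t in E) (v t)%:E <= wint gamma w (mu E))%E) ->
  (\int[mu]_(t in dom gamma) (u t * v t)%:E <= lorentz u)%E.
Proof.
move=> mu1 mv u0 v0 vle.
rewrite (_ : (\int[mu]_(t in _) _)%E =
  (\int[mu]_(t in dom gamma) ((u t)%:E * (v t)%:E))%E); last first.
  by apply: eq_integral => t _; rewrite EFinM.
have md := measurable_dom gamma.
rewrite layer_cake//; last exact/measurable_EFinP.
have mL s : measurable (dom gamma `&` [set t | (s%:E < (u t)%:E)%E]).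
  by apply: measurable_lte => //; exact/measurable_EFinP.
apply: ge0_le_integral => //.
- by move=> s _; apply: integral_ge0 => t [dt _]; rewrite lee_fin v0.
- apply: nonincreasing_measurable_in => //; first exact: interval_is_interval.
  move=> s t _ _ st; apply: ge0_subset_integral; [exact: mL|exact: mL|..].
  + apply/measurable_EFinP; apply: measurable_funS mv => //.
  + by move=> x [dx _]; rewrite lee_fin v0.
  + by move=> x [dx tx]; split=> //; apply: le_lt_trans tx; rewrite lee_fin.
- by apply: measurable_wint_level => //; exact: interval_is_interval.
- by move=> s _; apply: vle => // t [].
Qed.

(** The level sets of the sum are covered by those of the two summands, to which subadditivity of
    W(|E|) applies. *)
Lemma lorentz_disjoint u u' : L0 gamma u -> L0 gamma u' ->
  (forall t, dom gamma t -> 0 <= u t) -> (forall t, dom gamma t -> 0 <= u' t) ->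
  (forall t, dom gamma t -> u t = 0 \/ u' t = 0) ->
  (lorentz (u \+ u')%R <= lorentz u + lorentz u')%E.
Proof.
move=> mu1 mu2 u0 u'0 uu'.
have mL u1 : L0 gamma u1 -> measurable_fun (`[0, +oo[%classic : set R)
    (fun s => wint gamma w (mu [set t | dom gamma t /\ s < u1 t])).
  by move=> mu'; apply: measurable_wint_level => //; exact: interval_is_interval.
rewrite -ge0_integralD//; last 4 first.
- by move=> s _; exact: wint_ge0.
- exact: mL.
- by move=> s _; exact: wint_ge0.
- exact: mL.
apply: ge0_le_integral => //.
- by move=> s _; exact: wint_ge0.
- by apply: mL; apply: measurable_funD.
- by apply: emeasurable_funD; exact: mL.
move=> s /=; rewrite in_itv/= andbT => s0.
apply: le_trans (wint_subadditive gamma_gt0 Hw _ _ _ _).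
- apply: (wint_nd gamma_gt0 Hw); apply: le_mu.
  + by apply: measurable_super_level; exact: measurable_funD.
  + by apply: measurableU; exact: measurable_super_level.
  + move=> t [dt]; case: (uu' t dt) => ->; rewrite ?add0r ?addr0 => ?.
      by right; split.
    by left; split.
- exact: measurable_super_level.
- exact: measurable_super_level.
- by move=> t [].
- by move=> t [].
Qed.

(* Subadditivity against indicators: submodularity of [E |-> W (mu E)] on the
   level sets of [u + c 1_E], then translation in the level. *)
Lemma lorentz_add_indic u (c : R) (E : set R) : L0 gamma u ->
  (forall t, dom gamma t -> 0 <= u t) -> 0 <= c ->
  measurable E -> E `<=` dom gamma -> (mu E < +oo)%E ->
  (lorentz u < +oo)%E ->
  (lorentz (fun t => (u t + c * \1_E t)%R) <= lorentz u + c%:E * wint gamma w (mu E))%E.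
Proof.
move=> mu1 u0 c0 mE Ed Efin ufin.
pose A s := [set t | dom gamma t /\ s < u t].
pose B s := [set t | dom gamma t /\ s < u t + c * \1_E t].
pose a s := wint gamma w (mu (E `&` A s)).
have mA s : measurable (A s) by exact: measurable_super_level.
have m1E : L0 gamma (fun t => u t + c * \1_E t).
  by apply: measurable_funD => //; apply: measurable_funM.
have mB s : measurable (B s) by exact: (measurable_super_level _ m1E).
have a0 s : (0 <= a s)%E by exact: wint_ge0.
have mEA s : measurable (E `&` A s) by exact: measurableI.
have Ad s : A s `<=` dom gamma by move=> t [].
have EAd s : E `&` A s `<=` dom gamma by move=> t [_ /Ad].
have ma : measurable_fun (`[0, +oo[ : set R) a.
  apply: nonincreasing_measurable_in; first exact: interval_is_interval.
  move=> s t _ _ st; apply: (wint_nd gamma_gt0 Hw); apply: le_mu => //.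
  by move=> x [Ex [dx tx]]; split=> //; split=> //; exact: le_lt_trans tx.
have mL u1 (I : set R) : is_interval I -> L0 gamma u1 -> measurable_fun I
    (fun s => wint gamma w (mu [set t | dom gamma t /\ s < u1 t])).
  by move=> iI mu'; exact: measurable_wint_level.
have afin : (\int[mu]_(s in `[0%R, +oo[) a s < +oo)%E.
  apply: le_lt_trans ufin; apply: ge0_le_integral; first exact: measurable_itv.
  - by move=> s _; exact: a0.
  - exact: ma.
  - by apply: mL => //; exact: interval_is_interval.
  - by move=> s _; apply: (wint_nd gamma_gt0 Hw); apply: le_mu; [exact: mEA|exact: mA|move=> t []].
(* The function [a] shifted by [c]. For [s < c] the level condition is void and the set is [E]
   itself, which produces the term [c * W (mu E)]. *)
pose b s := wint gamma w (mu (E `&` A (s - c))).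
have b0 s : (0 <= b s)%E by exact: wint_ge0.
have EA1 r : r < 0 -> E `&` A r = E.
  move=> r0; apply/setIidPl => t Et; split; first exact: Ed.
  by rewrite (lt_le_trans r0)// u0//; exact: Ed.
have mbI (I : set R) : is_interval I -> measurable_fun I b.
  move=> iI; apply: nonincreasing_measurable_in; first exact: iI.
  move=> s t _ _ st; apply: (wint_nd gamma_gt0 Hw).
  apply: le_mu; [exact: mEA|exact: mEA|].
  move=> x [Ex [dx tx]]; split=> //; split=> //; apply: le_lt_trans tx.
  by rewrite lerD2r.
have mb : measurable_fun (`[0, +oo[ : set R) b.
  by apply: mbI; exact: interval_is_interval.
have dec : (`[0, +oo[%classic : set R) = `[0, c[ `|` `[c, +oo[.
  apply/seteqP; split=> s /=; rewrite !in_itv/= !andbT.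
    by move=> ->; case: (ltP s c); [left|right].
  by case=> [/andP[]//|]; exact: le_trans.
have intb : (\int[mu]_(s in `[0%R, +oo[) b s =
    c%:E * wint gamma w (mu E) + \int[mu]_(s in `[0%R, +oo[) a s)%E.
  have mc : measurable (`[0, c[ : set R) by exact: measurable_itv.
  have mc' : measurable (`[c, +oo[ : set R) by exact: measurable_itv.
  rewrite [in LHS]dec (ge0_integral_setU mu mc mc'); last 3 first.
  - by rewrite -dec; exact: mb.
  - by move=> s _; exact: b0.
  - by apply/disj_setPS => s [] /=; rewrite !in_itv/= andbT ltNge => /andP[_ /negP].
  have -> : (\int[mu]_(s in `[0%R, c[) b s = c%:E * wint gamma w (mu E))%E.
    rewrite (@eq_integral _ _ _ _ _ (cst (wint gamma w (mu E)))); last first.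
      move=> s; rewrite inE/= in_itv/= /b => /andP[_ sc].
      by rewrite EA1// subr_lt0.
    rewrite integral_cst_mu; last exact: mc.
    have -> : mu (`[0, c[%classic : set R) = c%:E; last by rewrite muleC.
    have := lebesgue_measure_itv `[0%R, c[; rewrite /= lte_fin oppr0 adde0 => ->.
    by move: c0; rewrite le_eqVlt => /predU1P[<-|->]//; rewrite ltxx.
  have -> : (\int[mu]_(s in `[c, +oo[) b s = \int[mu]_(s in `[0%R, +oo[) a s)%E.
    exact: (ge0_integral_shift c ma (fun s _ => a0 s)).
  by [].
(* Submodularity at each level [s]: the level set of the sum lies in the union of [A s] and [E] cut
   by [A (s - c)], and [E] cut by [A s] lies in their intersection. The integral of [a], finite by
   [afin], then cancels. *)
have main : (lorentz (fun t => (u t + c * \1_E t)%R) +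
    \int[mu]_(s in `[0%R, +oo[) a s <=
    lorentz u + \int[mu]_(s in `[0%R, +oo[) b s)%E.
  have I0 : is_interval (`[0, +oo[%classic : set R) by exact: interval_is_interval.
  apply: (ge0_le_integralD2 (measurable_itv _) (mL _ _ I0 m1E) ma (mL _ _ I0 mu1) mb).
  - by move=> s; exact: wint_ge0.
  - exact: a0.
  - by move=> s; exact: wint_ge0.
  - exact: b0.
  move=> s /=; rewrite in_itv/= andbT => s0.
  have := wint_submod gamma_gt0 Hw (mA s) (mEA (s - c)) (@Ad s) (@EAd (s - c)).
  apply: le_trans; apply: leeD.
    apply: (wint_nd gamma_gt0 Hw).
    apply: le_mu; [exact: (mB s)|by apply: measurableU; [exact: mA|exact: mEA]|].
    move=> t [dt]; rewrite indicE; have [Et|nEt] := pselect (E t).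
      by rewrite mem_set// mulr1 => h; right; split=> //; split=> //; rewrite ltrBlDr.
    by rewrite memNset// mulr0 addr0 => h; left; split.
  apply: (wint_nd gamma_gt0 Hw).
  apply: le_mu; [exact: mEA|by apply: measurableI; [exact: mA|exact: mEA]|].
  move=> t [Et [dt st]]; split; first by split.
  by split=> //; split=> //; rewrite (le_lt_trans _ st)// lerBlDr lerDl.
have Ia0 : (0 <= \int[mu]_(s in `[0%R, +oo[) a s)%E.
  by apply: integral_ge0 => s _; exact: a0.
exact: lee_cancel_fin main intb Ia0 afin.
Qed.

Definition simple_dominant (l : seq (R * set R)) t : R :=
  \sum_(p <- l) p.1 * \1_(p.2) t.

(** The cost of the simple function, an upper bound for its Lorentz functional. The sets may overlap
    arbitrarily, so the bound can be strict. *)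
Definition dominant_weight (l : seq (R * set R)) : R :=
  \sum_(p <- l) p.1 * fine (wint gamma w (mu p.2)).

Definition admissible (l : seq (R * set R)) : Prop :=
  forall p, List.In p l -> [/\ 0 <= p.1, measurable p.2, p.2 `<=` dom gamma &
    (mu p.2 < +oo)%E].

Lemma lorentz0 : lorentz (cst 0) = 0%E.
Proof.
apply: integral0_eq => s /=; rewrite in_itv/= andbT => s0.
rewrite (_ : [set t | _] = set0) ?measure0 ?wint_le0//.
by apply/seteqP; split=> // t [_] /=; rewrite ltNge s0.
Qed.

Lemma wint_fin (E : set R) : (mu E < +oo)%E ->
  wint gamma w (mu E) \is a fin_num.
Proof.
move=> Efin; have E0 : mu E \is a fin_num by rewrite ge0_fin_numE.
by rewrite -(fineK E0) ge0_fin_numE ?wint_ge0//; exact: wint_lty.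
Qed.

(** One indicator is added at a time; the bound from the induction also supplies the finiteness that
    this addition requires. *)
Lemma lorentz_simple l : admissible l ->
  [/\ L0 gamma (simple_dominant l), forall t, 0 <= simple_dominant l t
    & (lorentz (simple_dominant l) <= (dominant_weight l)%:E)%E].
Proof.
elim: l => [|[c E] l IH] al.
  rewrite /simple_dominant /dominant_weight (_ : (fun t => _) = cst 0); last first.
    by apply/funext => t; rewrite big_nil.
  by split=> [||]; rewrite ?big_nil ?lorentz0//; [exact: measurable_cst|move=> t; rewrite big_nil].
have [|ml l0 lw] := IH; first by move=> p pl; apply: al; right.
have [/= c0 mE Ed Efin] := al (c, E) (or_introl erefl).
have slE : simple_dominant ((c, E) :: l) =
    (fun t => simple_dominant l t + c * \1_E t).
  by apply/funext => t; rewrite /simple_dominant big_cons addrC.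
rewrite slE; split.
- by apply: measurable_funD => //; apply: measurable_funM.
- by move=> t; rewrite addr_ge0// mulr_ge0.
- apply: le_trans (lorentz_add_indic _ _ _ _ _ _ _) _ => //.
    by rewrite (le_lt_trans lw)// ltry.
  rewrite /dominant_weight big_cons/= EFinD EFinM fineK ?wint_fin// addeC.
  exact: leeD2r.
Qed.

End lorentz_functional.

(** * The modular as a Lorentz functional *)

Section rho_theory.
Context {R : realType}.
Local Notation mu := (@lebesgue_measure R).
Variables (gamma : \bar R) (phi w : R -> R).
Hypotheses (gamma_gt0 : (0 < gamma)%E) (Hw : weight gamma w).
Hypothesis Nphi : N_function phi.
Implicit Types f g h v u : R -> R.

Lemma ext_fun_ge0 (x : \bar R) : (0 <= x)%E -> (0 <= ext_fun phi x)%E.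
Proof.
by case: x => [x| |]//=; rewrite !lee_fin; exact: N_function_ge0.
Qed.

Lemma ext_fun_nd (x y : \bar R) : (0 <= x)%E -> (x <= y)%E ->
  (ext_fun phi x <= ext_fun phi y)%E.
Proof.
case: x => [x| |]//; case: y => [y| |]//=; rewrite ?lee_fin ?leey//.
exact: N_function_nd.
Qed.

Lemma measurable_ext_fun_rearr f (D : set R) : is_interval D ->
  measurable_fun D (fun t => ext_fun phi (rearr gamma f t)).
Proof.
move=> iD; apply: nonincreasing_measurable_in; first exact: iD.
move=> s t _ _ st; apply: ext_fun_nd; first exact: rearr_ge0.
exact: rearr_ni.
Qed.

Lemma measurable_phi_norm f : L0 gamma f -> L0 gamma (fun t => phi `|f t|).
Proof.
move=> mf; apply: (measurable_N_function_comp Nphi); first exact: measurable_dom.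
  exact: L0_norm.
by move=> t _; exact: normr_ge0.
Qed.

(** The set where [phi (rearr f)] exceeds [s] is an initial interval whose length is the measure of
    the set where [phi (|f|)] exceeds [s], because levels of [phi] are open half-lines. *)
Lemma rho_lorentz f : L0 gamma f ->
  rho gamma phi w f = lorentz gamma w (fun t => phi `|f t|).
Proof.
move=> mf; rewrite /rho layer_cake; last 5 first.
- exact: measurable_dom.
- exact: measurable_weight.
- exact: weight_ge0.
- by apply: measurable_ext_fun_rearr; exact: is_interval_dom.
- by move=> t _; apply: ext_fun_ge0; exact: rearr_ge0.
apply: eq_integral => s0; rewrite inE/= in_itv/= andbT.
move: s0 => s s0; rewrite -/(wint gamma w _).
have [r r0 rs] := N_function_level Nphi s0.
have mE : mu [set t | dom gamma t /\ s < phi `|f t|] = distr_fun gamma f r.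
  rewrite /distr_fun; congr (mu _); apply/seteqP.
  by split=> t [dt] h; split=> //; move: h; rewrite (rs _ (normr_ge0 _)).
have key t : (s%:E < ext_fun phi (rearr gamma f t))%E =
    (t%:E < mu [set t | dom gamma t /\ (s < phi `|f t|)%R])%E.
  rewrite mE -lt_rearr//; have := rearr_ge0 gamma f t.
  case: (rearr gamma f t) => [x| |]//; rewrite ?ltry//.
  by rewrite lee_fin /= !lte_fin => /rs.
rewrite /wint; congr (integral _ _ _); apply/seteqP.
by split=> t [dt] h; split=> //; move: h; rewrite /= key.
Qed.

Opaque wint lorentz.

Lemma rho_ge0 f : (0 <= rho gamma phi w f)%E.
Proof.
apply: integral_ge0 => t dt; apply: mule_ge0.
  by apply: ext_fun_ge0; exact: rearr_ge0.
by rewrite lee_fin; exact: weight_ge0 Hw _ dt.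
Qed.

Lemma le_rho f g : L0 gamma f -> L0 gamma g ->
  (forall t, dom gamma t -> `|f t| <= `|g t|) ->
  (rho gamma phi w f <= rho gamma phi w g)%E.
Proof.
move=> mf mg fg; rewrite (rho_lorentz mf) (rho_lorentz mg).
apply: (le_lorentz gamma_gt0 Hw (measurable_phi_norm mf) (measurable_phi_norm mg)).
by move=> t dt; apply: (N_function_nd Nphi) => //; exact: fg.
Qed.

Lemma rho_eq f g : (forall t, dom gamma t -> `|f t| = `|g t|) ->
  rho gamma phi w f = rho gamma phi w g.
Proof. by move=> fg; apply: eq_integral => t _; rewrite (rearr_eq _ fg). Qed.

Lemma rho_disjoint f g : L0 gamma f -> L0 gamma g ->
  (forall t, dom gamma t -> f t = 0 \/ g t = 0) ->
  (rho gamma phi w (f \+ g)%R <= rho gamma phi w f + rho gamma phi w g)%E.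
Proof.
move=> mf mg fg; have mfg : L0 gamma (f \+ g) by exact: measurable_funD.
rewrite (rho_lorentz mf) (rho_lorentz mg) (rho_lorentz mfg).
have phi0 : phi `|(0 : R)%R| = 0 by rewrite normr0; exact: N_function0.
apply: (@le_trans _ _ (lorentz gamma w ((fun t => phi `|f t|) \+ (fun t => phi `|g t|)))).
  apply: (le_lorentz gamma_gt0 Hw).
  - exact: measurable_phi_norm.
  - by apply: measurable_funD; exact: measurable_phi_norm.
  - by move=> t dt /=; case: (fg t dt) => ->; rewrite ?phi0 ?add0r ?addr0.
apply: (lorentz_disjoint gamma_gt0 Hw).
- exact: measurable_phi_norm.
- exact: measurable_phi_norm.
- by move=> t _; apply: (N_function_ge0 Nphi).
- by move=> t _; apply: (N_function_ge0 Nphi).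
- by move=> t dt; case: (fg t dt) => ->; [left|right].
Qed.

Lemma integral_le_rho f v : L0 gamma f -> L0 gamma v ->
  (forall t, dom gamma t -> 0 <= v t) -> submaj gamma v w ->
  (\int[mu]_(t in dom gamma) (phi `|f t| * v t)%:E <= rho gamma phi w f)%E.
Proof.
move=> mf mv v0 vw; rewrite (rho_lorentz mf); apply: (integral_le_lorentz gamma_gt0 Hw).
- exact: measurable_phi_norm.
- exact: mv.
- by move=> t _; apply: (N_function_ge0 Nphi).
- exact: v0.
- by move=> E mE Ed; exact: submaj_integral_le.
Qed.

Lemma rho_le_dominant f l : L0 gamma f -> admissible gamma l ->
  (forall t, dom gamma t -> phi `|f t| <= simple_dominant l t) ->
  (rho gamma phi w f <= (dominant_weight gamma w l)%:E)%E.
Proof.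
move=> mf al fl; have [ml l0 lw] := lorentz_simple gamma_gt0 Hw al.
rewrite (rho_lorentz mf); apply: le_trans lw.
exact: (le_lorentz gamma_gt0 Hw (measurable_phi_norm mf) ml fl).
Qed.

Lemma wint_small (e : R) : 0 < e -> exists2 d : R, 0 < d &
  forall x : \bar R, (x <= d%:E)%E -> (wint gamma w x <= e%:E)%E.
Proof.
move=> e0; have [d d0 de] := wint_cvg0 gamma_gt0 Hw e0; exists d => // x xd.
exact: le_trans (wint_nd gamma_gt0 Hw xd) de.
Qed.

(** Chebyshev: an infinite value at level [s] persists at all lower levels, hence on an interval of
    positive length. *)
Lemma lorentz_level_fin u s : L0 gamma u -> (lorentz gamma w u < +oo)%E ->
  0 < s -> (wint gamma w (mu [set t | dom gamma t /\ (s < u t)%R]) < +oo)%E.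
Proof.
move=> mu1 ufin s0; rewrite ltNge leye_eq; apply/negP => /eqP Eoo.
move: ufin; rewrite ltNge leye_eq => /negP; apply; rewrite -leye_eq.
pose g s := wint gamma w (mu [set t | dom gamma t /\ (s < u t)%R]).
have iI : is_interval (`[0, +oo[%classic : set R) by exact: interval_is_interval.
have iI' : is_interval (`[0, s]%classic : set R) by exact: interval_is_interval.
have g0 r : (0 <= g r)%E by exact: wint_ge0.
have mg := measurable_wint_level gamma_gt0 Hw mu1 iI.
have mg' := measurable_wint_level gamma_gt0 Hw mu1 iI'.
apply: (@le_trans _ _ (\int[mu]_(r in `[0%R, s]) g r)%E); last first.
  apply: ge0_subset_integral; [exact: measurable_itv|exact: measurable_itv|exact: mg|..].
    by move=> r _; exact: g0.
  by move=> r /=; rewrite !in_itv/= andbT => /andP[].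
apply: (@le_trans _ _ (\int[mu]_(r in `[0%R, s]) cst +oo%E r)%E).
  rewrite integral_cst_mu; last exact: measurable_itv.
  have -> : mu (`[0, s]%classic : set R) = s%:E.
    by have := lebesgue_measure_itv `[0%R, s]; rewrite /= lte_fin s0 oppr0 adde0.
  by rewrite mulyr gtr0_sg// mul1e.
apply: ge0_le_integral; [exact: measurable_itv|by move=> r _; exact: leey|exact: measurable_cst|exact: mg'|].
move=> r /=; rewrite in_itv/= => /andP[_ rs]; rewrite -Eoo.
apply: (wint_nd gamma_gt0 Hw); apply: le_mu; [exact: measurable_super_level..|].
by move=> t [dt st]; split=> //; exact: le_lt_trans st.
Qed.

Lemma lorentz_level_mu_fin u s : L0 gamma u -> (lorentz gamma w u < +oo)%E ->
  0 < s -> (mu [set t | dom gamma t /\ (s < u t)%R] < +oo)%E.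
Proof.
move=> mu1 ufin s0; have := lorentz_level_fin mu1 ufin s0.
have mA : measurable [set t | dom gamma t /\ s < u t] by exact: measurable_super_level.
have [gy|gN] := eqVneq gamma +oo%E; last first.
  move=> _; rewrite -ge0_fin_numE//; apply: (measure_subdom_fin gamma_gt0) => //.
  by move=> t [].
apply: contraTT; rewrite -!leNgt !leye_eq => /eqP ->.
by rewrite (wint_pinfty Hw gy).
Qed.

(** At each positive level the level set has finite measure and shrinks to the empty set, so its
    W-value tends to 0; dominated convergence over the levels concludes. *)
Lemma lorentz_shrink u (C : nat -> set R) : L0 gamma u ->
  (forall t, dom gamma t -> 0 <= u t) -> (lorentz gamma w u < +oo)%E ->
  (forall n, measurable (dom gamma `&` C n)) ->
  {homo C : m n / (m <= n)%N >-> n `<=` m} ->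
  (forall t, dom gamma t -> exists n, ~ C n t) ->
  lorentz gamma w (fun t => u t * \1_(C n) t) @[n --> \oo] --> 0%E.
Proof.
move=> mu1 u0 ufin mC Cni CN.
pose A s n := [set t | dom gamma t /\ s < u t * \1_(C n) t].
pose A' s := [set t | dom gamma t /\ s < u t].
have AE s n : 0 <= s -> A s n = A' s `&` (dom gamma `&` C n).
  move=> s0; apply/seteqP; split=> t.
    move=> [dt]; rewrite indicE; case: (boolP (t \in C n)) => tC.
      by rewrite mulr1 => st; split=> //; split=> //; rewrite -inE.
    by rewrite mulr0 ltNge s0.
  by move=> [[dt st] [_ Ct]]; split=> //; rewrite indicE mem_set// mulr1.
have mA' s : measurable (A' s) by exact: measurable_super_level.
have mA s n : 0 <= s -> measurable (A s n).
  by move=> s0; rewrite AE//; exact: measurableI.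
have mAlt s n : 0 < s -> measurable (A s n) by move=> s0; apply: mA; exact: ltW.
pose f_ n s := wint gamma w (mu (A s n)).
pose g s := wint gamma w (mu (A' s)).
have iI : is_interval (`]0, +oo[%classic : set R) by exact: interval_is_interval.
(* Level 0 is dropped, since the set where [u > 0] may have infinite measure. *)
have lE v : L0 gamma v -> lorentz gamma w v =
    (\int[mu]_(s in `]0%R, +oo[) wint gamma w (mu [set t | dom gamma t /\ (s < v t)%R]))%E.
  move=> mv; rewrite lorentzE integral_itv_obnd_cbnd//.
  exact: measurable_wint_level.
have fni n s t : 0 < s -> 0 < t -> s <= t -> (f_ n t <= f_ n s)%E.
  move=> s0 t0 st; apply: (wint_nd gamma_gt0 Hw).
  apply: le_mu; [exact: mAlt|exact: mAlt|].
  by move=> x [dx tx]; split=> //; exact: le_lt_trans tx.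
have mf_ n : measurable_fun (`]0, +oo[ : set R) (f_ n).
  apply: nonincreasing_measurable_in; first exact: iI.
  by move=> s t; rewrite /= !in_itv/= !andbT; exact: fni.
have mg : measurable_fun (`]0, +oo[ : set R) g by exact: measurable_wint_level.
have g0 s : (0 <= g s)%E by exact: wint_ge0.
have f0 n s : (0 <= f_ n s)%E by exact: wint_ge0.
have fg n s : 0 < s -> (f_ n s <= g s)%E.
  move=> s0; apply: (wint_nd gamma_gt0 Hw); apply: le_mu; [exact: mAlt|exact: mA'|].
  by rewrite AE ?ltW// => t [].
have gfin s : 0 < s -> g s \is a fin_num.
  by move=> s0; rewrite (ge0_fin_numE (g0 s)); exact: lorentz_level_fin.
have cvgf s : 0 < s -> f_ n s @[n --> \oo] --> 0%E.
  move=> s0; have muA0 : mu (A s n) @[n --> \oo] --> 0%E.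
    have cA : \bigcap_n A s n = set0.
      apply/seteqP; split=> // t At; have [dt _] := At 0%N I.
      have [n nC] := CN t dt; have := At n I; rewrite AE ?ltW// => -[_ [_]].
      by move=> /nC.
    rewrite -(@measure0 _ _ _ mu) -cA.
    apply: (@nonincreasing_cvg_mu _ _ _ mu (A s)).
    - apply: (@le_lt_trans _ _ (mu (A' s))); last exact: lorentz_level_mu_fin.
      by apply: le_mu; [exact: mAlt|exact: mA'|rewrite AE ?ltW// => t []].
    - by move=> n; exact: mAlt.
    - by rewrite cA.
    - move=> m n mn; apply/subsetPset; rewrite !AE ?ltW// => t [At [dt Ct]].
      by split=> //; split=> //; exact: Cni Ct.
  apply: cvge0_of_le => [n|e e0]; first exact: f0.
  have [d d0 de] := wint_small e0.
  near=> n; apply: de; near: n; exact: cvge0_le.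
have mD : measurable (`]0, +oo[%classic : set R) by exact: measurable_itv.
have mcut n : L0 gamma (fun t => u t * \1_(C n) t).
  exact: L0_indic.
under eq_fun do rewrite (lE _ (mcut _)).
have -> : 0%E = (\int[mu]_(s in `]0%R, +oo[) cst 0%E s)%E :> \bar R by rewrite integral0.
apply: (@dominated_cvg _ _ _ mu _ mD f_ (cst 0%E) g mf_).
- by move=> s; rewrite /= in_itv/= andbT; exact: cvgf.
- by move=> s; rewrite /= in_itv/= andbT; exact: gfin.
- by apply: ge0_integrable; [exact: mg|move=> s _; exact: g0|rewrite -lE].
- move=> n s; rewrite /= in_itv/= andbT => s0.
  by rewrite (gee0_abs (f0 n s)); exact: fg.
Unshelve. all: by end_near. Qed.

Lemma rho_shrink f (C : nat -> set R) : L0 gamma f ->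
  (rho gamma phi w f < +oo)%E ->
  (forall n, measurable (dom gamma `&` C n)) ->
  {homo C : m n / (m <= n)%N >-> n `<=` m} ->
  (forall t, dom gamma t -> exists n, ~ C n t) ->
  rho gamma phi w (fun t => f t * \1_(C n) t) @[n --> \oo] --> 0%E.
Proof.
move=> mf rf mC Cni CN.
have mcut n : L0 gamma (fun t => f t * \1_(C n) t).
  exact: L0_indic.
rewrite (rho_lorentz mf) in rf.
under eq_fun do rewrite (rho_lorentz (mcut _)).
rewrite (_ : (fun n => _) =
    (fun n => lorentz gamma w (fun t => phi `|f t| * \1_(C n) t))).
  apply: lorentz_shrink => //; first exact: measurable_phi_norm.
  by move=> t _; exact: (N_function_ge0 Nphi).
apply/funext => n; congr (lorentz _ _ _); apply/funext => t.
rewrite indicE; case: (_ \in _); rewrite ?mulr1// !mulr0 normr0.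
exact: N_function0.
Qed.

End rho_theory.

(** * The Amemiya formula *)

(** A Lagrange multiplier in one dimension: [S a b] pairs a constraint value with an objective
    value, [V] bounds the objective under the constraint [a <= 1], and [(0, 0)] is a Slater
    point. *)
Lemma scalar_lagrange (R : realType) (S : R -> R -> Prop) (V : R) :
  S 0 0 -> (forall a b, S a b -> a <= 1 -> b <= V) ->
  (forall a1 b1 a2 b2 t, S a1 b1 -> S a2 b2 -> 0 <= t -> t <= 1 ->
    exists2 a, S a (t * b1 + (1 - t) * b2) & a <= t * a1 + (1 - t) * a2) ->
  exists2 m, 0 <= m & forall a b, S a b -> b <= V + m * (a - 1).
Proof.
move=> S00 SV Smix.
(* Points with [a < 1] bound the multiplier from above by these quotients, points with [a > 1] bound
   it from below; the largest value allowed by the former is taken. *)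
pose E := [set x | exists a b, [/\ S a b, a < 1 & x = (V - b) / (1 - a)]].
have Elb : lbound E 0.
  move=> _ [a [b [Sab a1 ->]]]; apply: divr_ge0; last by lra.
  by have := SV a b Sab (ltW a1); lra.
have E0 : E !=set0 by exists ((V - 0) / (1 - 0)), 0, 0; split=> //; exact: ltr01.
exists (inf E); first exact: lb_le_inf.
move=> a b Sab; case: (ltgtP a 1) => [a1|a1|a1].
- have : inf E <= (V - b) / (1 - a).
    by apply: ge_inf; [exists 0|exists a, b].
  by rewrite ler_pdivlMr; [lra|lra].
- have : (b - V) / (a - 1) <= inf E.
    apply: lb_le_inf => // _ [a2 [b2 [Sab2 a21 ->]]].
    (* The mixing weight that brings the constraint back to 1. *)
    pose t := (1 - a2) / (a - a2).
    have aa : 0 < a - a2 by lra.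
    have t0 : 0 <= t by apply: divr_ge0; lra.
    have t1 : t <= 1 by rewrite ler_pdivrMr//; lra.
    have [a3 Sa3 a3le] := Smix _ _ _ _ t Sab Sab2 t0 t1.
    have ta : t * a + (1 - t) * a2 = 1 by rewrite /t; field; rewrite gt_eqF.
    have a31 : a3 <= 1 by move: a3le; rewrite ta.
    have := SV _ _ Sa3 a31.
    have -> : t * b + (1 - t) * b2 = ((1 - a2) * b + (a - 1) * b2) / (a - a2).
      by rewrite /t; field; rewrite gt_eqF.
    rewrite ler_pdivrMr// => h.
    rewrite ler_pdivrMr; last by lra.
    rewrite mulrAC ler_pdivlMr; last by lra.
    by lra.
  by rewrite ler_pdivrMr; [lra|lra].
- by rewrite a1 subrr mulr0 addr0; apply: (SV a); rewrite ?a1// -a1.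
Qed.

Section norms.
Context {R : realType}.
Local Notation mu := (@lebesgue_measure R).
Variables (gamma : \bar R) (phi w : R -> R).
Hypotheses (gamma_gt0 : (0 < gamma)%E) (Hw : weight gamma w).
Hypothesis Nphi : N_function phi.
Implicit Types f g h v u : R -> R.

Let phis := complementary phi.

Lemma ext_complementary_ge0 (x : \bar R) : (0 <= ext_fun phis x)%E \/ x = -oo%E.
Proof.
by case: x => [x| |]; [left|left|right] => //=; rewrite lee_fin complementary_ge0.
Qed.

Lemma ext_complementary_rearr_ge0 g t : (0 <= ext_fun phis (rearr gamma g t))%E.
Proof.
case: (ext_complementary_ge0 (rearr gamma g t)) => // E.
by have := rearr_ge0 gamma g t; rewrite E.
Qed.

Lemma measurable_ext_complementary_rearr g (D : set R) : is_interval D ->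
  measurable_fun D (fun t => ext_fun phis (rearr gamma g t)).
Proof.
move=> iD; apply: nonincreasing_measurable_in; first exact: iD.
move=> s t _ _ st; have := rearr_ni gamma g st.
have := rearr_ge0 gamma g s; have := rearr_ge0 gamma g t.
case: (rearr gamma g s) => [x| |]//; case: (rearr gamma g t) => [y| |]//=.
  by rewrite !lee_fin => _ _; exact: complementary_nd.
by move=> *; exact: leey.
Qed.

Lemma young_ext (x y : \bar R) : (0 <= x)%E -> (0 <= y)%E ->
  (x * y <= ext_fun phi x + ext_fun phis y)%E.
Proof.
case: x => [x| |]//; case: y => [y| |]//; rewrite ?lee_fin => x0 y0 /=.
- exact: young.
- by rewrite addey ?leey.
- by rewrite addye ?leey.
Qed.

(** The easy half of the Amemiya formula: Young's inequality for [k] times the rearrangement of [f]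
    and that of [g], under the integral. *)
Lemma orlicz_norm_le f (k : R) : L0 gamma f -> 0 < k ->
  (orlicz_norm gamma phi w f <=
   k^-1%:E * (1 + rho gamma phi w (k \*o f)))%E.
Proof.
move=> mf k0; apply: ge_ereal_sup => _ [g [mg rg] <-].
have md := measurable_dom gamma; have id := is_interval_dom (gamma := gamma).
have mw : measurable_fun (dom gamma) (EFin \o w).
  by apply/measurable_EFinP; exact: measurable_weight.
have w0 t : dom gamma t -> (0 <= (w t)%:E)%E.
  by move=> dt; rewrite lee_fin; exact: weight_ge0 Hw _ dt.
have k0' : (0 <= k^-1%:E)%E by rewrite lee_fin invr_ge0 ltW.
pose A t := (ext_fun phi (rearr gamma (k \*o f) t) * (w t)%:E)%E.
pose B t := (ext_fun phis (rearr gamma g t) * (w t)%:E)%E.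
have mA : measurable_fun (dom gamma) A.
  by apply: emeasurable_funM; [exact: measurable_ext_fun_rearr|exact: mw].
have mB : measurable_fun (dom gamma) B.
  by apply: emeasurable_funM; [exact: measurable_ext_complementary_rearr|exact: mw].
have A0 t : dom gamma t -> (0 <= A t)%E.
  by move=> dt; rewrite mule_ge0 ?w0//; apply: ext_fun_ge0 => //; exact: rearr_ge0.
have B0 t : dom gamma t -> (0 <= B t)%E.
  by move=> dt; rewrite mule_ge0 ?w0//; exact: ext_complementary_rearr_ge0.
apply: (@le_trans _ _ (\int[mu]_(t in dom gamma) (k^-1%:E * (A t + B t)))%E).
  apply: ge0_le_integral.
  - exact: md.
  - by move=> t dt; rewrite !mule_ge0 ?w0// rearr_ge0.
  - apply: emeasurable_funM; last exact: mw.
    by apply: emeasurable_funM; exact: measurable_rearr.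
  - by apply: measurable_funeM; exact: emeasurable_funD.
  - move=> t dt; rewrite /A /B -ge0_muleDl; last 2 first.
    + by apply: ext_fun_ge0 => //; exact: rearr_ge0.
    + exact: ext_complementary_rearr_ge0.
    rewrite muleA; apply: lee_wpmul2r; first exact: w0.
    have := young_ext (rearr_ge0 gamma (k \*o f) t) (rearr_ge0 gamma g t).
    rewrite [X in (X * _ <= _)%E]rearr_scale// => h.
    apply: le_trans (lee_wpmul2l k0' h).
    by rewrite !muleA -EFinM mulVf ?gt_eqF// mul1e.
rewrite ge0_integralZl//; last 2 first.
- exact: emeasurable_funD.
- by move=> t dt; rewrite adde_ge0 ?A0 ?B0.
apply: lee_wpmul2l; first exact: k0'.
rewrite (ge0_integralD mu md A0 mA B0 mB) addeC.
by apply: leeD; [exact: rg|exact: lexx].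
Qed.

(** Such functions agree almost everywhere with their rearrangements and, unlike rearrangements of
    sums, are stable under convex combination, which the multiplier argument requires. *)
Definition decreasing_density g :=
  (forall t, dom gamma t -> 0 <= g t) /\
  (forall s t, dom gamma s -> dom gamma t -> s <= t -> g t <= g s).

Lemma decreasing_density_L0 g : decreasing_density g -> L0 gamma g.
Proof.
move=> [_ gni]; apply/measurable_EFinP; apply: nonincreasing_measurable_in.
  exact: is_interval_dom.
by move=> s t ds dt st; rewrite lee_fin gni.
Qed.

Lemma decreasing_density_orlicz_norm f g : L0 gamma f -> decreasing_density g ->
  (\int[mu]_(t in dom gamma) (phis (g t) * w t)%:E <= 1)%E ->
  (\int[mu]_(t in dom gamma) (rearr gamma f t * (g t * w t)%:E) <=
   orlicz_norm gamma phi w f)%E.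
Proof.
move=> mf dg ag; have mg := decreasing_density_L0 dg.
have [g0 gni] := dg.
have md := measurable_dom gamma; have id := is_interval_dom (gamma := gamma).
have mw := measurable_weight gamma_gt0 Hw.
have w0 t : dom gamma t -> 0 <= w t by exact: weight_ge0 Hw _.
have mpg : measurable_fun (dom gamma) (fun t => phis (g t)).
  exact: measurable_complementary_comp.
have gg := rearr_nonincreasing_ae g0 gni.
apply: ereal_sup_ubound; exists g.
  split=> //; rewrite /rho.
  rewrite (@ge0_ae_eq_integral _ _ _ mu _ _
    (fun t => (phis (g t) * w t)%:E))//.
  - apply: emeasurable_funM; first exact: measurable_ext_complementary_rearr.
    exact/measurable_EFinP.
  - by apply/measurable_EFinP; exact: measurable_funM.
  - move=> t dt; rewrite mule_ge0 ?lee_fin ?w0//; exact: ext_complementary_rearr_ge0.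
  - by move=> t dt; rewrite lee_fin mulr_ge0 ?w0// complementary_ge0.
  - by apply: ae_imply gg => t H dt; rewrite /= H//= EFinM.
apply: ge0_ae_eq_integral => //.
- apply: emeasurable_funM; last exact/measurable_EFinP.
  by apply: emeasurable_funM; exact: measurable_rearr.
- apply: emeasurable_funM; first exact: measurable_rearr.
  by apply/measurable_EFinP; exact: measurable_funM.
- by move=> t dt; rewrite !mule_ge0 ?rearr_ge0// lee_fin w0.
- by move=> t dt; rewrite !mule_ge0 ?rearr_ge0// lee_fin mulr_ge0 ?w0 ?g0.
- by apply: ae_imply gg => t H dt; rewrite H// -muleA EFinM.
Qed.

Lemma complementary_div x a : 1 <= a -> phis (x / a) <= phis x / a.
Proof.
move=> a1; have t0 : 0 <= a^-1 by rewrite invr_ge0; lra.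
have t1 : a^-1 <= 1 by rewrite invf_le1//; lra.
have := complementary_convex Nphi x 0 t0 t1.
by rewrite (complementary0 Nphi) !mulr0 !addr0 mulrC [_ * phis x]mulrC.
Qed.

(** Dividing [g] by the maximum of [a] and 1 brings its complementary modular below 1 by convexity,
    and the norm bound then applies. *)
Lemma decreasing_density_integral_lty f g (a V : R) : L0 gamma f ->
  decreasing_density g -> (orlicz_norm gamma phi w f <= V%:E)%E ->
  (\int[mu]_(t in dom gamma) (phis (g t) * w t)%:E)%E = a%:E ->
  (\int[mu]_(t in dom gamma) (rearr gamma f t * (g t * w t)%:E) < +oo)%E.
Proof.
move=> mf dg fV ag; have mg := decreasing_density_L0 dg; have [g0 gni] := dg.
have md := measurable_dom gamma; have id := is_interval_dom (gamma := gamma).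
have mw := measurable_weight gamma_gt0 Hw.
have w0 t : dom gamma t -> 0 <= w t by exact: weight_ge0 Hw _.
pose b := Num.max a 1; have b1 : 1 <= b by rewrite le_max lexx orbT.
have b0 : 0 < b by lra.
have ab : a <= b by rewrite le_max lexx.
have mpg : measurable_fun (dom gamma) (fun t => phis (g t)).
  exact: measurable_complementary_comp.
have bi0 : 0 <= b^-1 by rewrite invr_ge0; lra.
pose g' t := g t / b.
have dg' : decreasing_density g'.
  split=> [t dt|s t ds dt st]; first by rewrite divr_ge0 ?g0//; lra.
  by rewrite ler_wpM2r// gni.
have mpg' : measurable_fun (dom gamma) (fun t => phis (g' t)).
  exact: (measurable_complementary_comp Nphi (decreasing_density_L0 dg')).
have ag' : (\int[mu]_(t in dom gamma) (phis (g' t) * w t)%:E <= 1)%E.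
  apply: (@le_trans _ _ (\int[mu]_(t in dom gamma) (b^-1%:E * (phis (g t) * w t)%:E))%E).
    apply: ge0_le_integral => //.
    - by move=> t dt; rewrite lee_fin mulr_ge0 ?w0// complementary_ge0.
    - by apply/measurable_EFinP; exact: measurable_funM.
    - by apply: measurable_funeM; apply/measurable_EFinP; exact: measurable_funM.
    - move=> t dt; rewrite -EFinM lee_fin mulrA ler_wpM2r ?w0//.
      by rewrite mulrC; exact: complementary_div.
  rewrite ge0_integralZl//; last 2 first.
  - by apply/measurable_EFinP; exact: measurable_funM.
  - by move=> t dt; rewrite lee_fin mulr_ge0 ?w0// complementary_ge0.
  by rewrite ag -EFinM lee_fin mulrC ler_pdivrMr// mul1r.
have bg' := le_trans (decreasing_density_orlicz_norm mf dg' ag') fV.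
rewrite (_ : (\int[mu]_(t in _) _)%E =
  (\int[mu]_(t in dom gamma) (b%:E * (rearr gamma f t * (g' t * w t)%:E)))%E); last first.
  apply: eq_integral => t _; rewrite muleCA -EFinM; congr (_ * _%:E)%E.
  by rewrite /g'; field; rewrite gt_eqF.
rewrite (ge0_integralZl mu md); last 3 first.
- apply: emeasurable_funM; first exact: measurable_rearr.
  apply/measurable_EFinP; apply: measurable_funM => //.
  exact: decreasing_density_L0.
- by move=> t dt; rewrite mule_ge0 ?rearr_ge0// lee_fin mulr_ge0 ?w0 ?(dg'.1).
- by rewrite lee_fin ltW.
apply: lte_mul_pinfty => //; first by rewrite lee_fin ltW.
exact: le_lt_trans bg' (ltry _).
Qed.

(** The hard half of the formula. The multiplier [m] of the constraint on the complementary modular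
    is tested against densities that give equality in Young's inequality, which turns it into a
    bound on the modular of [f / M]. *)
Lemma amemiya f (V e : R) : L0 gamma f ->
  (orlicz_norm gamma phi w f <= V%:E)%E -> 0 < e ->
  exists2 m : R, 0 < m &
    (m%:E * (1 + rho gamma phi w (m^-1 \*o f)) <= (V + e)%:E)%E.
Proof.
move=> mf fV e0.
have md := measurable_dom gamma; have id := is_interval_dom (gamma := gamma).
have mw := measurable_weight gamma_gt0 Hw.
have w0 t : dom gamma t -> 0 <= w t by exact: weight_ge0 Hw _.
have mr := measurable_rearr gamma f id.
have r0 t : (0 <= rearr gamma f t)%E by exact: rearr_ge0.
have mphis g : decreasing_density g ->
    measurable_fun (dom gamma) (fun t => (phis (g t) * w t)%:E).
  move=> dg; apply/measurable_EFinP; apply: measurable_funM => //.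
  exact: (measurable_complementary_comp Nphi (decreasing_density_L0 dg)).
have phis0 g t : dom gamma t -> (0 <= (phis (g t) * w t)%:E)%E.
  by move=> dt; rewrite lee_fin mulr_ge0 ?w0// complementary_ge0.
have mfg g : decreasing_density g ->
    measurable_fun (dom gamma) (fun t => rearr gamma f t * (g t * w t)%:E)%E.
  move=> dg; apply: emeasurable_funM => //; apply/measurable_EFinP.
  by apply: measurable_funM => //; exact: decreasing_density_L0.
have fg0 g t : decreasing_density g -> dom gamma t ->
    (0 <= rearr gamma f t * (g t * w t)%:E)%E.
  by move=> dg dt; rewrite mule_ge0 ?r0// lee_fin mulr_ge0 ?w0 ?(dg.1).
(* Pairs of constraint and objective. Under mixing the objective is linear, while convexity of
   [phis] gives only an inequality for the constraint. *)
pose S a b := exists g, [/\ decreasing_density g,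
  (\int[mu]_(t in dom gamma) (phis (g t) * w t)%:E)%E = a%:E
  & (\int[mu]_(t in dom gamma) (rearr gamma f t * (g t * w t)%:E))%E = b%:E].
have S00 : S 0 0.
  exists (cst 0); split.
  - by split.
  - by apply: integral0_eq => t _; rewrite /phis (complementary0 Nphi) mul0r.
  - by apply: integral0_eq => t _; rewrite mul0r mule0.
have SV a b : S a b -> a <= 1 -> b <= V.
  move=> [g [dg ag bg]] a1; rewrite -lee_fin -bg; apply: le_trans fV.
  by apply: decreasing_density_orlicz_norm => //; rewrite ag lee_fin.
have Smix a1 b1 a2 b2 t : S a1 b1 -> S a2 b2 -> 0 <= t -> t <= 1 ->
    exists2 a, S a (t * b1 + (1 - t) * b2) & a <= t * a1 + (1 - t) * a2.
  move=> [g1 [dg1 ag1 bg1]] [g2 [dg2 ag2 bg2]] t0 t1.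
  have t1' : 0 <= 1 - t by lra.
  pose g s := t * g1 s + (1 - t) * g2 s.
  have dg : decreasing_density g.
    split=> [s ds|s s' ds ds' ss'].
      by rewrite addr_ge0// mulr_ge0// ?(dg1.1) ?(dg2.1).
    by apply: lerD; apply: ler_wpM2l => //; [exact: dg1.2|exact: dg2.2].
  have ag : (\int[mu]_(s in dom gamma) (phis (g s) * w s)%:E <=
      (t * a1 + (1 - t) * a2)%:E)%E.
    apply: (@le_trans _ _ (\int[mu]_(s in dom gamma)
       (t%:E * (phis (g1 s) * w s)%:E + (1 - t)%:E * (phis (g2 s) * w s)%:E))%E).
      apply: ge0_le_integral.
      - exact: md.
      - by move=> s ds; exact: phis0.
      - exact: mphis.
      - by apply: emeasurable_funD; apply: measurable_funeM; exact: mphis.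
      - move=> s ds; rewrite -!EFinM -EFinD lee_fin !mulrA -mulrDl ler_wpM2r ?w0//.
        exact: complementary_convex.
    rewrite ge0_integralD; last 5 first.
    - exact: md.
    - by move=> s ds; rewrite mule_ge0 ?phis0// lee_fin.
    - by apply: measurable_funeM; exact: mphis.
    - by move=> s ds; rewrite mule_ge0 ?phis0// lee_fin.
    - by apply: measurable_funeM; exact: mphis.
    rewrite (ge0_integralZl mu md (mphis _ dg1)); last 2 first.
    - by move=> s ds; exact: phis0.
    - by rewrite lee_fin.
    rewrite (ge0_integralZl mu md (mphis _ dg2)); last 2 first.
    - by move=> s ds; exact: phis0.
    - by rewrite lee_fin.
    by rewrite ag1 ag2 -!EFinM -EFinD.
  have ag0 : (0 <= \int[mu]_(s in dom gamma) (phis (g s) * w s)%:E)%E.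
    by apply: integral_ge0 => s ds; exact: phis0.
  exists (fine (\int[mu]_(s in dom gamma) (phis (g s) * w s)%:E)%E).
    exists g; split; first exact: dg.
      by rewrite fineK// ge0_fin_numE// (le_lt_trans ag)// ltry.
    rewrite (_ : (\int[mu]_(s in _) _)%E = (\int[mu]_(s in dom gamma)
       (t%:E * (rearr gamma f s * (g1 s * w s)%:E) +
       (1 - t)%:E * (rearr gamma f s * (g2 s * w s)%:E)))%E); last first.
      apply: eq_integral => s; rewrite inE => ds.
      rewrite !(muleCA _ (rearr gamma f s)) -!EFinM -ge0_muleDr; last 2 first.
      + by rewrite lee_fin mulr_ge0// mulr_ge0 ?w0 ?(dg1.1).
      + by rewrite lee_fin mulr_ge0// mulr_ge0 ?w0 ?(dg2.1).
      by rewrite -EFinD /g mulrDl !mulrA.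
    rewrite ge0_integralD; last 5 first.
    - exact: md.
    - by move=> s ds; rewrite mule_ge0 ?(fg0 _ _ dg1)// lee_fin.
    - by apply: measurable_funeM; exact: mfg.
    - by move=> s ds; rewrite mule_ge0 ?(fg0 _ _ dg2)// lee_fin.
    - by apply: measurable_funeM; exact: mfg.
    rewrite (ge0_integralZl mu md (mfg _ dg1)); last 2 first.
    - by move=> s ds; exact: fg0.
    - by rewrite lee_fin.
    rewrite (ge0_integralZl mu md (mfg _ dg2)); last 2 first.
    - by move=> s ds; exact: fg0.
    - by rewrite lee_fin.
    by rewrite bg1 bg2 -!EFinM -EFinD.
  by rewrite -lee_fin fineK// ge0_fin_numE// (le_lt_trans ag)// ltry.
have [m m0 Hm] := scalar_lagrange S00 SV Smix.
(* The multiplier may be 0 but a scale must be positive; the margin [e] is the error allowed in the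
   conclusion. *)
pose M := m + e; have M0 : 0 < M by rewrite /M; lra.
exists M => //.
have [p [p0 pE pnd]] := young_eq_selection Nphi.
pose fn (n : nat) t : R := fine (mine (rearr gamma f t) n%:R%:E).
have fnE n t : (fn n t)%:E = mine (rearr gamma f t) n%:R%:E.
  rewrite fineK// ge0_fin_numE; last by rewrite le_min r0 lee_fin ler0n.
  by rewrite (@le_lt_trans _ _ n%:R%:E) ?ltry// ge_min lexx orbT.
have fn0 n t : 0 <= fn n t by rewrite -lee_fin fnE le_min r0 lee_fin ler0n.
have fnn n t : fn n t <= n%:R by rewrite -lee_fin fnE ge_min lexx orbT.
have fnM0 n t : 0 <= fn n t / M by rewrite divr_ge0// ltW.
have fnr n t : ((fn n t)%:E <= rearr gamma f t)%E by rewrite fnE ge_min lexx.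
have fnni n s t : s <= t -> fn n t <= fn n s.
  move=> st; rewrite -lee_fin !fnE le_min ge_min (rearr_ni gamma f st)/=.
  by rewrite ge_min lexx orbT.
have fnnd (n n' : nat) t : (n <= n')%N -> fn n t <= fn n' t.
  move=> nn; rewrite -lee_fin !fnE le_min ge_min lexx/= ge_min lee_fin ler_nat nn.
  by rewrite orbT.
(* Extremal in Young's inequality at [fn n t / M]; nonincreasing since [p] is nondecreasing.
   Truncating the height and the interval makes its complementary modular finite. *)
pose g (n : nat) t := if t < n%:R then p (fn n t / M) else 0.
have dg n : decreasing_density (g n).
  split=> [t dt|s t ds dt st]; rewrite /g.
    by case: ifP => // _; exact: p0.
  case: (ltP t n%:R) => tn; last by case: ifP => // _; exact: p0.
  rewrite (le_lt_trans st tn); apply: pnd => //.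
  by rewrite ler_pM2r ?invr_gt0// fnni.
have afin n : exists2 a, 0 <= a &
    (\int[mu]_(t in dom gamma) (phis (g n t) * w t)%:E)%E = a%:E.
  pose I := (\int[mu]_(t in dom gamma) (phis (g n t) * w t)%:E)%E.
  have I0 : (0 <= I)%E by apply: integral_ge0 => t dt; exact: phis0.
  pose C := phis (p (n%:R / M)).
  have C0 : 0 <= C by exact: complementary_ge0.
  suff Ioo : (I < +oo)%E by exists (fine I); rewrite ?fine_ge0// fineK// ge0_fin_numE.
  pose D : set R := [set t | (t%:E < n%:R%:E)%E].
  have mwD : measurable_fun (dom gamma) (fun t => (w t)%:E * (\1_D t)%:E)%E.
    apply: emeasurable_funM; first exact/measurable_EFinP.
    apply/measurable_EFinP; apply: measurable_indic.
    by rewrite (_ : D = `]-oo, n%:R[%classic).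
  have wD0 t : dom gamma t -> (0 <= (w t)%:E * (\1_D t)%:E)%E.
    by move=> dt; rewrite mule_ge0// lee_fin w0.
  apply: (@le_lt_trans _ _ (\int[mu]_(t in dom gamma)
      (C%:E * ((w t)%:E * (\1_D t)%:E)))%E).
    apply: ge0_le_integral.
    - exact: md.
    - by move=> t dt; exact: phis0.
    - exact: mphis.
    - exact: measurable_funeM.
    - move=> t dt; rewrite indicE /g /D; case: ifPn => tn.
        rewrite mem_set/= ?lte_fin// mule1 -EFinM lee_fin ler_wpM2r ?w0//.
        apply: (complementary_nd Nphi); apply: pnd => //.
        by rewrite ler_pM2r ?invr_gt0.
      rewrite memNset/= ?lte_fin; last by apply/negP.
      by rewrite !mule0 /phis (complementary0 Nphi) mul0r.
  rewrite (ge0_integralZl mu md mwD); last 2 first.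
  - exact: wD0.
  - by rewrite lee_fin.
  apply: lte_mul_pinfty; [by rewrite lee_fin|by []|].
  by rewrite -integral_setI_indic; exact: wint_lty.
pose ch (n : nat) (t : R) : R := if t < n%:R then 1 else 0.
have ch0 n t : 0 <= ch n t by rewrite /ch; case: ifP.
have phifnM0 n t : 0 <= M * phi (fn n t / M).
  by apply: mulr_ge0; [exact: ltW|exact: (N_function_ge0 Nphi)].
have phifn0 n t : dom gamma t ->
    (0 <= (M * phi (fn n t / M) * ch n t * w t)%:E)%E.
  move=> dt; rewrite lee_fin; apply: mulr_ge0; last exact: w0.
  by apply: mulr_ge0; [exact: phifnM0|exact: ch0].
have mphifn n : measurable_fun (dom gamma)
    (fun t => (M * phi (fn n t / M) * ch n t * w t)%:E).
  apply/measurable_EFinP; apply: measurable_funM => //.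
  apply/measurable_EFinP; apply: nonincreasing_measurable_in => // s t _ _ st.
  rewrite lee_fin /ch; case: (ltP t n%:R) => tn; last first.
    by rewrite mulr0; apply: mulr_ge0; [exact: phifnM0|case: ifP].
  rewrite (le_lt_trans st tn) !mulr1 ler_pM2l//.
  by apply: (N_function_nd Nphi) => //; rewrite ler_pM2r ?invr_gt0// fnni.
have main n : (\int[mu]_(t in dom gamma)
    (M * phi (fn n t / M) * ch n t * w t)%:E <= (V - m)%:E)%E.
  have [a a0 ag] := afin n.
  have b0 : (0 <= \int[mu]_(t in dom gamma) (rearr gamma f t * (g n t * w t)%:E))%E.
    by apply: integral_ge0 => t dt; exact: fg0.
  have := decreasing_density_integral_lty mf (dg n) fV ag.
  rewrite -ge0_fin_numE// => bfin.
  pose b := fine (\int[mu]_(t in dom gamma) (rearr gamma f t * (g n t * w t)%:E))%E.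
  have bg : (\int[mu]_(t in dom gamma) (rearr gamma f t * (g n t * w t)%:E))%E = b%:E.
    by rewrite fineK.
  have := Hm a b; rewrite /S => /(_ (ex_intro _ (g n) (And3 (dg n) ag bg))) bV.
  have : (\int[mu]_(t in dom gamma) (M * phi (fn n t / M) * ch n t * w t)%:E +
      M%:E * \int[mu]_(t in dom gamma) (phis (g n t) * w t)%:E <=
      \int[mu]_(t in dom gamma) (rearr gamma f t * (g n t * w t)%:E))%E.
    rewrite -(ge0_integralZl mu md (mphis _ (dg n))); last 2 first.
    - by move=> t dt; exact: phis0.
    - by rewrite lee_fin ltW.
    rewrite -ge0_integralD; last 5 first.
    - exact: md.
    - by move=> t dt; exact: phifn0.
    - exact: mphifn.
    - by move=> t dt; rewrite mule_ge0 ?phis0// lee_fin ltW.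
    - by apply: measurable_funeM; exact: mphis.
    apply: ge0_le_integral.
    - exact: md.
    - by move=> t dt; rewrite adde_ge0 ?phifn0// mule_ge0 ?phis0// lee_fin ltW.
    - apply: emeasurable_funD; first exact: mphifn.
      by apply: measurable_funeM; exact: mphis.
    - exact: mfg.
    - move=> t dt; apply: (@le_trans _ _ ((fn n t)%:E * (g n t * w t)%:E)%E); last first.
        by apply: lee_wpmul2r => //; rewrite lee_fin mulr_ge0 ?w0 ?((dg n).1).
      rewrite -!EFinM -EFinD lee_fin /g /ch; case: (ltP t n%:R) => tn; last first.
        by rewrite /phis (complementary0 Nphi) !(mulr0, mul0r) addr0.
      have := pE _ (fnM0 n t); rewrite -/phis => pEt.
      have -> : fn n t * (p (fn n t / M) * w t) =
          M * (fn n t / M * p (fn n t / M)) * w t by field; rewrite gt_eqF.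
      by rewrite pEt mulr1; lra.
  rewrite ag bg -EFinM; move: bV.
  have : (0 <= \int[mu]_(t in dom gamma) (M * phi (fn n t / M) * ch n t * w t)%:E)%E.
    by apply: integral_ge0 => t dt; exact: phifn0.
  case: (\int[mu]_(t in dom gamma) (M * phi (fn n t / M) * ch n t * w t)%:E)%E => [x| |]//.
  rewrite -EFinD !lee_fin => x0 bV xb.
  (* The multiplier bound has [m * a] where Young's equality has [M * a]; the difference [e * a] has
     the favourable sign. *)
  have : 0 <= e * a by rewrite mulr_ge0// ltW.
  by rewrite /M in xb; nra.
have key : (\int[mu]_(t in dom gamma) (M%:E * (ext_fun phi
    (rearr gamma (M^-1 \*o f) t) * (w t)%:E)) <= (V - m)%:E)%E.
  apply: (monotone_convergence_le (g_ := fun n t =>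
    (M * phi (fn n t / M) * ch n t * w t)%:E)) main.
  - exact: md.
  - exact: mphifn.
  - by move=> n t dt; exact: phifn0.
  - move=> t dt k l kl; rewrite lee_fin ler_wpM2r ?w0//.
    apply: ler_pM.
    + exact: phifnM0.
    + exact: ch0.
    + rewrite ler_pM2l//; apply: (N_function_nd Nphi) => //.
      by rewrite ler_pM2r ?invr_gt0// fnnd.
    + rewrite /ch; case: (ltP t k%:R) => [tk|_]; last by case: ifP.
      by rewrite (lt_le_trans tk)// ler_nat.
  - move=> t dt; have wt : 0 < w t by case: Hw => H _ _ _; exact: H.
    rewrite rearr_scale ?invr_gt0//; have := r0 t.
    case rE : (rearr gamma f t) => [r| |]// rt0.
      apply: cvg_near_cst; near=> n.
      have tn : t < n%:R by near: n; exact: nbhs_infty_gtr.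
      have rn : r <= n%:R by near: n; exact: nbhs_infty_ger.
      have -> : fn n t = r.
        by apply: EFin_inj; rewrite fnE rE min_l// lee_fin.
      by rewrite /ch tn mulr1 /= -!EFinM mulrA [M^-1 * r]mulrC.
    rewrite gt0_muley ?lte_fin ?invr_gt0//= gt0_mulye ?lte_fin// gt0_muley ?lte_fin//.
    (* Where the rearrangement is infinite the truncations equal [n], and superlinear growth makes
       the integrands diverge. *)
    have [U U0 HU] := N_function_superlinear Nphi 1.
    apply/cvgeyPge => A; near=> n.
    have tn : t < n%:R by near: n; exact: nbhs_infty_gtr.
    have Un : U * M <= n%:R by near: n; exact: nbhs_infty_ger.
    have An : A / w t <= n%:R by near: n; exact: nbhs_infty_ger.
    have -> : fn n t = n%:R.
      by apply: EFin_inj; rewrite fnE rE min_r// leey.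
    rewrite /ch tn mulr1 lee_fin -ler_pdivrMr// (le_trans An)//.
    have : U <= n%:R / M by rewrite ler_pdivlMr.
    by move=> /HU; rewrite mul1r ler_pdivrMr// mulrC.
have mrho : measurable_fun (dom gamma) (fun t => ext_fun phi
    (rearr gamma (M^-1 \*o f) t) * (w t)%:E)%E.
  apply: emeasurable_funM; first exact: measurable_ext_fun_rearr.
  exact/measurable_EFinP.
move: key; rewrite (ge0_integralZl mu md mrho); last 2 first.
- move=> t dt; rewrite mule_ge0 ?lee_fin ?w0//.
  by apply: ext_fun_ge0 => //; exact: rearr_ge0.
- by rewrite lee_fin ltW.
rewrite -/(rho gamma phi w (M^-1 \*o f)) => key.
rewrite ge0_muleDr//; last exact: rho_ge0.
rewrite mule1; apply: (@le_trans _ _ (M%:E + (V - m)%:E)%E); first exact: leeD2l.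
by rewrite -EFinD lee_fin /M; lra.
Unshelve. all: by end_near. Qed.

End norms.

(** * Densities of functionals *)

Section representation.
Context {R : realType}.
Local Notation mu := (@lebesgue_measure R).
Variable gamma : \bar R.
Implicit Types (u v h : R -> R) (L G : (R -> R) -> R) (E : set R).

Lemma integrableZ_mu (D : set R) (k : R) (f : R -> R) : measurable D ->
  mu.-integrable D (EFin \o f) -> mu.-integrable D (EFin \o (fun t => k * f t)).
Proof.
by move=> mD /(@integrableZl _ _ _ mu _ mD k). Qed.

Lemma EFin_Rintegral_mu (D : set R) (f : R -> R) : measurable D ->
  mu.-integrable D (EFin \o f) ->
  (\int[mu]_(t in D) (f t)%:E)%E = (\int[mu]_(t in D) f t)%:E.
Proof. by move=> mD fi; rewrite /Rintegral fineK//; exact: integrable_fin_num. Qed.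

Lemma integrableB_mu (D : set R) (f g : R -> R) : measurable D ->
  mu.-integrable D (EFin \o f) -> mu.-integrable D (EFin \o g) ->
  mu.-integrable D (EFin \o (fun t => f t - g t)).
Proof. by move=> mD fi gi; exact: (@integrableB _ _ _ mu D mD _ _ fi gi). Qed.

Lemma le_normr_Rintegral_mu (D : set R) (f : R -> R) : measurable D ->
  mu.-integrable D (EFin \o f) ->
  `|\int[mu]_(t in D) f t| <= \int[mu]_(t in D) `|f t|.
Proof. by move=> mD fi; exact: le_normr_Rintegral. Qed.

Lemma integrable_patch_mu (D : set R) (f : R -> \bar R) : measurable D ->
  mu.-integrable D f <-> mu.-integrable setT (f \_ D).
Proof. by move=> mD; exact: integrable_mkcond. Qed.

Lemma integrableU_mu (A B : set R) (f : R -> R) : measurable A -> measurable B ->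
  [disjoint A & B] -> mu.-integrable A (EFin \o f) ->
  mu.-integrable B (EFin \o f) -> mu.-integrable (A `|` B) (EFin \o f).
Proof.
move=> mA mB AB /integrableP[mfA fA] /integrableP[mfB fB].
have mf : measurable_fun (A `|` B) (EFin \o f) by apply/measurable_funU.
apply/integrableP; split=> //.
rewrite ge0_integral_setU//; first by rewrite lte_add_pinfty.
exact: measurableT_comp.
Qed.

Lemma indic_setU (A B : set R) : A `&` B = set0 ->
  \1_(A `|` B) = \1_A \+ \1_B :> (R -> R).
Proof.
move=> AB; apply/funext => t /=; rewrite !indicE in_setU.
case: (boolP (t \in A)) => [/set_mem At|_]; last by rewrite add0r.
by rewrite memNset ?addr0// => Bt; have : (A `&` B) t by []; rewrite AB.
Qed.

Lemma RintegralZ_mu (D : set R) (k : R) (f : R -> R) : measurable D ->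
  mu.-integrable D (EFin \o f) ->
  \int[mu]_(t in D) (k * f t) = k * \int[mu]_(t in D) f t.
Proof. by move=> mD fi; rewrite RintegralZl. Qed.

Lemma RintegralD_mu (D : set R) (f g : R -> R) : measurable D ->
  mu.-integrable D (EFin \o f) -> mu.-integrable D (EFin \o g) ->
  \int[mu]_(t in D) (f t + g t) = \int[mu]_(t in D) f t + \int[mu]_(t in D) g t.
Proof. by move=> mD fi gi; rewrite RintegralD. Qed.

Definition bounded_supp u : Prop := L0 gamma u /\
  exists m : nat, forall t, dom gamma t -> `|u t| <= m%:R /\ (m%:R <= t -> u t = 0).

Definition linear_bounded_supp L : Prop := forall a u v,
  bounded_supp u -> bounded_supp v -> L (a \*o u \+ v) = a * L u + L v.

(** Continuity for the sup norm on functions carried by [[0, m)]. For linear [L] the case [e = 0]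
    also says that values outside [dom gamma] are ignored. *)
Definition locally_bounded L : Prop := forall m : nat, exists2 C : R, 0 <= C &
  forall u e, L0 gamma u ->
    (forall t, dom gamma t -> `|u t| <= e /\ (m%:R <= t -> u t = 0)) ->
    `|L u| <= C * e.

Lemma bounded_supp_cst0 : bounded_supp (cst 0).
Proof.
split; first exact: measurable_cst.
by exists 0%N => t _ /=; rewrite normr0.
Qed.

Lemma bounded_supp_lin a u v : bounded_supp u -> bounded_supp v ->
  bounded_supp (a \*o u \+ v).
Proof.
move=> [mu1 [m Hm]] [mv [n Hn]]; split.
  by apply: measurable_funD => //; apply: measurable_funM => //; exact: measurable_cst.
have [k Hk] := exists_nat_ge (`|a| * m%:R + n%:R + m%:R).
have ge1 : 0 <= `|a| * m%:R by exact: mulr_ge0.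
have m0 : 0 <= m%:R :> R by [].
have n0 : 0 <= n%:R :> R by [].
exists k => t dt /=; have [um ut] := Hm t dt; have [vn vt] := Hn t dt; split.
  rewrite (le_trans (ler_normD _ _))// normrM.
  have : `|a| * `|u t| <= `|a| * m%:R by exact: ler_wpM2l.
  by lra.
by move=> kt; rewrite ut ?vt ?mulr0 ?addr0//; lra.
Qed.

Lemma bounded_suppZ a u : bounded_supp u -> bounded_supp (a \*o u).
Proof.
move=> bu; have := bounded_supp_lin a bu bounded_supp_cst0.
by congr bounded_supp; apply/funext => t /=; rewrite addr0.
Qed.

Lemma bounded_suppD u v : bounded_supp u -> bounded_supp v -> bounded_supp (u \+ v).
Proof.
move=> bu bv; have := bounded_supp_lin 1 bu bv.
by congr bounded_supp; apply/funext => t /=; rewrite mul1r.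
Qed.

Lemma measurable_dom_lt_real (m : R) : measurable (dom gamma `&` [set t | t < m]).
Proof.
apply: measurableI; first exact: measurable_dom.
by rewrite (_ : [set t | _] = `]-oo, m[%classic) //; apply/seteqP; split=> t /=; rewrite in_itv.
Qed.

Lemma dom_itv_fin (a b : R) : (mu (dom gamma `&` `[a, b[%classic) < +oo)%E.
Proof.
apply: (@le_lt_trans _ _ (mu `[a, b[%classic)).
  by apply: le_mu; [apply: measurableI => //; exact: measurable_dom|exact: measurable_itv|].
rewrite lebesgue_measure_itv/= lte_fin; case: ifP => _; last exact: ltry.
by rewrite -EFinD ltry.
Qed.

Lemma mu_dom_lt_fin (m : R) : (mu (dom gamma `&` [set t | (t < m)%R]) < +oo)%E.
Proof.
apply: le_lt_trans (dom_itv_fin 0 m); apply: le_mu.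
- exact: measurable_dom_lt_real.
- by apply: measurableI => //; exact: measurable_dom.
- by move=> t [dt tm]; split=> //=; rewrite in_itv/= tm andbT; case: dt.
Qed.

Lemma bounded_supp_of_le (m : nat) (e : R) u : L0 gamma u ->
  (forall t, dom gamma t -> `|u t| <= e /\ (m%:R <= t -> u t = 0)) ->
  bounded_supp u.
Proof.
move=> mu_ ue; split=> //; have [k Hk] := exists_nat_ge (`|e| + m%:R).
have m0 : 0 <= m%:R :> R by [].
have e0 : 0 <= `|e| by [].
exists k => t dt; have [ute ut] := ue t dt; have := ler_norm e.
by split; [lra|move=> kt; apply: ut; lra].
Qed.

Lemma bounded_supp_indic (m : nat) E : measurable E ->
  (forall t, dom gamma t -> E t -> t < m%:R) -> bounded_supp \1_E.
Proof.
move=> mE Em; split; first exact: measurable_indic.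
exists m.+1 => t dt; rewrite indicE; split.
  by case: (_ \in _); rewrite ?normr1 ?normr0 ?ler1n.
move=> mt; rewrite memNset// => /(Em t dt).
by move: mt; rewrite -natr1; lra.
Qed.

(** * Functionals on bounded functions with bounded support *)

Section functional.
Variable L : (R -> R) -> R.
Hypotheses (HL : linear_bounded_supp L) (HB : locally_bounded L).

Lemma functional0 : L (cst 0) = 0.
Proof.
have := HL (-1) bounded_supp_cst0 bounded_supp_cst0.
rewrite (_ : (_ \*o _ \+ _) = cst 0); first by lra.
by apply/funext => t /=; rewrite mulr0 addr0.
Qed.

Lemma functionalZ a u : bounded_supp u -> L (a \*o u) = a * L u.
Proof.
move=> bu; have := HL a bu bounded_supp_cst0; rewrite functional0 addr0 => <-.
by congr L; apply/funext => t /=; rewrite addr0.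
Qed.

Lemma functionalD u v : bounded_supp u -> bounded_supp v ->
  L (u \+ v) = L u + L v.
Proof.
move=> bu bv; have := HL 1 bu bv; rewrite mul1r => <-.
by congr L; apply/funext => t /=; rewrite mul1r.
Qed.

Lemma functional_sum (s : seq (R -> R)) :
  (forall u, List.In u s -> bounded_supp u /\ L u = 0) ->
  bounded_supp (fun t => \sum_(u <- s) u t) /\ L (fun t => \sum_(u <- s) u t) = 0.
Proof.
elim: s => [|u s IH] Hs.
  rewrite (_ : (fun t => _) = cst 0); last by apply/funext => t; rewrite big_nil.
  by split; [exact: bounded_supp_cst0|exact: functional0].
have [|bs Ls] := IH; first by move=> v vs; apply: Hs; right.
have [bu Lu] := Hs u (or_introl erefl).
rewrite (_ : (fun t => _) = u \+ (fun t => \sum_(u <- s) u t)); last first.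
  by apply/funext => t; rewrite big_cons.
by split; [exact: bounded_suppD|rewrite functionalD// Lu Ls addr0].
Qed.

Lemma stair_approx (e x : R) (N : nat) : 0 < e -> 0 <= x ->
  (x < N%:R * e -> `|x - \sum_(0 <= k < N) e * (k.+1%:R * e <= x)%R%:R| <= e) /\
  (N%:R * e <= x -> \sum_(0 <= k < N) e * (k.+1%:R * e <= x)%R%:R = N%:R * e).
Proof.
move=> e0 x0; elim: N => [|N [IH1 IH2]].
  by rewrite big_geq// mul0r; split => //; rewrite ltNge x0.
rewrite big_nat_recr//=; case: leP => h; rewrite ?mulr1 ?mulr0 ?addr0.
  split=> [//|_]; rewrite IH2 -?natr1; first by ring.
  by move: h; rewrite -natr1 mulrDl mul1r; lra.
split=> // _; case: (ltP x (N%:R * e)) => h'; first exact: IH1.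
rewrite IH2//; move: h; rewrite -natr1 mulrDl mul1r => h.
by rewrite ger0_norm ?subr_ge0//; lra.
Qed.

(** Staircase combinations of superlevel sets approximate a nonnegative function uniformly, without
    leaving its support. *)
Lemma functional_eq0 :
  (forall (m : nat) E, measurable E -> E `<=` dom gamma ->
    (forall t, E t -> t < m%:R) -> L \1_E = 0) ->
  forall u, bounded_supp u -> L u = 0.
Proof.
move=> L0E.
have nonneg (m : nat) u : L0 gamma u ->
    (forall t, dom gamma t -> 0 <= u t <= m%:R /\ (m%:R <= t -> u t = 0)) -> L u = 0.
  move=> mu_ um.
  have bu : bounded_supp u.
    split => //; exists m => t dt; have [/andP[u0 utm] ut] := um t dt.
    by split=> //; rewrite ger0_norm.
  have [C C0 HC] := HB m.
  apply/eqP; rewrite -normr_le0 leNgt; apply/negP => Lu0.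
  (* Mesh for which [C * e] is at most half of [|L u|], contradicting the approximation. *)
  pose e := `|L u| / (C + 1) / 2.
  have e0 : 0 < e by rewrite /e !divr_gt0//; lra.
  have [N HN] := exists_nat_ge (m%:R / e + 1).
  have Nm : m%:R < N%:R * e.
    by rewrite -ltr_pdivrMr//; lra.
  pose A k := [set t | dom gamma t /\ k.+1%:R * e <= u t].
  have mA k : measurable (A k).
    have := mu_ (measurable_dom gamma) _ (measurable_itv `[k.+1%:R * e, +oo[).
    by congr measurable; apply/seteqP; split=> t [dt] /=; rewrite in_itv/= andbT.
  have Am k t : A k t -> t < m%:R.
    move=> [dt kt]; have [_ ut] := um t dt; rewrite ltNge; apply/negP => mt.
    by move: kt; rewrite ut// leNgt mulr_gt0.
  pose s := [seq (e \*o \1_(A k)) | k <- index_iota 0 N].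
  have [bs Ls] : bounded_supp (fun t => \sum_(v <- s) v t) /\ L (fun t => \sum_(v <- s) v t) = 0.
    apply: functional_sum => v /List.in_map_iff[k [<- _]].
    have bA : bounded_supp \1_(A k) by apply: (@bounded_supp_indic m) => // t _; exact: Am.
    split; first exact: bounded_suppZ.
    by rewrite functionalZ// (L0E m) ?mulr0//; [move=> t []|exact: Am].
  pose d := (-1) \*o (fun t => \sum_(v <- s) v t) \+ u.
  have bd : bounded_supp d by exact: bounded_supp_lin.
  have Ld : L d = L u by rewrite /d HL// Ls mulr0 add0r.
  have : `|L d| <= C * e.
    apply: HC; first by case: bd.
    move=> t dt; have [/andP[u0 utm] ut] := um t dt.
    have dE : d t = u t - \sum_(0 <= k < N) e * (k.+1%:R * e <= u t)%R%:R.
      rewrite /d /= mulN1r addrC /s big_map; congr (_ - _).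
      apply: eq_bigr => k _ /=; rewrite indicE; congr (_ * _%:R); congr nat_of_bool.
      by apply/idP/idP => [/set_mem[]//|h]; rewrite inE; split.
    split; first by rewrite dE; apply: (proj1 (stair_approx N e0 u0)); exact: le_lt_trans Nm.
    move=> mt; rewrite dE ut// big1 ?subr0// => k _.
    by rewrite leNgt mulr_gt0//= mulr0.
  rewrite Ld /e => h.
  have : `|L u| / (C + 1) * C <= `|L u|.
    by rewrite mulrAC ler_pdivrMr ?ler_wpM2l//; lra.
  by lra.
move=> u [mu_ [m um]].
(* Adding [m] times the indicator of [E], on which [L] vanishes, makes [u] nonnegative with values
   at most [m + m]. *)
pose E := dom gamma `&` [set t | t < m%:R].
have mE : measurable E by exact: measurable_dom_lt_real.
have bE : bounded_supp \1_E by apply: (@bounded_supp_indic m) => // t _ [].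
have bu : bounded_supp u by split => //; exists m.
have := HL m%:R bE bu; rewrite (L0E m) ?mulr0 ?add0r//; [|by move=> t []..].
move=> <-; apply: (nonneg (m + m)%N); first by case: (bounded_supp_lin m%:R bE bu).
move=> t dt /=; have [utm ut] := um t dt; rewrite indicE natrD; have m0 : 0 <= m%:R :> R by [].
have := ler_norm (u t); have := ler_norm (- u t); rewrite normrN.
case: (ltP t m%:R) => tm.
  by rewrite mem_set// mulr1 => h1 h2; split; [apply/andP; split; lra|lra].
rewrite memNset; last by move=> [_] /=; rewrite ltNge tm.
by rewrite mulr0 add0r ut// lexx addr_ge0.
Qed.

End functional.

(** Absolute continuity upgrades finite to countable additivity, since the remainders of a disjoint
    union decrease to the empty set inside [D], of finite measure. Radon-Nikodym then applies to the
    resulting charge. *)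
Lemma charge_density (D : set R) (nu : set R -> R) : measurable D ->
  (mu D < +oo)%E -> (forall E, measurable E -> nu E = nu (E `&` D)) ->
  (forall E E', measurable E -> measurable E' -> E `&` E' = set0 ->
    nu (E `|` E') = nu E + nu E') ->
  (forall e : R, 0 < e -> exists2 d : R, 0 < d & forall E, measurable E ->
    E `<=` D -> (mu E <= d%:E)%E -> `|nu E| <= e) ->
  exists2 g : R -> R, mu.-integrable setT (EFin \o g) &
    forall E, measurable E -> nu E = \int[mu]_(t in E) g t.
Proof.
move=> mD Dfin nuD nuU nuc.
have nu0 : nu set0 = 0.
  by have := nuU set0 set0 measurable0 measurable0 (setI0 _); rewrite setU0; lra.
pose N (E : set R) : \bar R := (nu E)%:E.
have N0 : N set0 = 0%E by rewrite /N nu0.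
have Nfin E : measurable E -> N E \is a fin_num by [].
have nusum (F : nat -> set R) : (forall i, measurable (F i)) -> trivIset setT F ->
    forall n, nu (\bigcup_(i < n) F i) = \sum_(0 <= i < n) nu (F i).
  move=> mF tF; elim=> [|n IH]; first by rewrite big_geq// bigcup0.
  rewrite big_nat_recr//= -IH -nuU//.
  - congr nu; apply/seteqP; split=> t.
      move=> [i /= in1 Ft]; move: in1; rewrite ltnS leq_eqVlt => /predU1P[iE|li].
        by right; rewrite -iE.
      by left; exists i.
    by case=> [[i /= li Ft]|Ft]; [exists i => //=; exact: ltnW|exists n => /=].
  - by apply: bigcup_measurable.
  - apply/seteqP; split=> // t [[i /= li Ft] Fn].
    by have := tF i n I I; rewrite (_ : i = n) ?ltnn in li * => [/(_ _)|]; [|apply: tF => //; exists t].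
have Nsig : semi_sigma_additive N.
  move=> F mF tF mUF; pose T n := (\bigcup_i F i) `\` (\bigcup_(i < n) F i).
  have mS n : measurable (\bigcup_(i < n) F i) by apply: bigcup_measurable.
  have mT n : measurable (T n) by exact: measurableD.
  have nuT n : nu (\bigcup_i F i) - \sum_(0 <= i < n) nu (F i) = nu (T n `&` D).
    rewrite -nuD// -nusum//; have <- : (\bigcup_(i < n) F i) `|` T n = \bigcup_i F i.
      rewrite /T setDUK//; first by move=> t [i _ Ft]; exists i.
    rewrite nuU//; first by rewrite addrC addKr.
    by rewrite /T setDE setICA setICr setI0.
  have muT0 : mu (T n `&` D) @[n --> \oo] --> 0%E.
    have c0 : \bigcap_n (T n `&` D) = set0.
      apply/seteqP; split=> // t Tt; have [[[i _ Ft] _] _] := Tt 0%N I.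
      by have [[_ nF] _] := Tt i.+1 I; apply: nF; exists i => /=.
    rewrite -(@measure0 _ _ _ mu) -c0.
    apply: (@nonincreasing_cvg_mu _ _ _ mu (fun n => T n `&` D)).
    - apply: le_lt_trans Dfin; apply: le_mu => //; exact: measurableI.
    - by move=> n; exact: (measurableI _ _ (mT n) mD).
    - by rewrite c0.
    - move=> m n mn; apply/subsetPset => t [[Ft nF] Dt]; split=> //; split=> //.
      by move=> [i /= im Fi]; apply: nF; exists i => //=; exact: leq_trans mn.
  rewrite (_ : (fun n => _) = EFin \o (fun n => \sum_(0 <= i < n) nu (F i))); last first.
    by apply/funext => n /=; rewrite sumEFin.
  apply: cvg_EFin; first by near=> n.
  apply/cvgrPdist_le => e e0; have [d d0 Hd] := nuc e e0.
  near=> n; rewrite nuT; apply: Hd.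
  - by apply: measurableI.
  - by apply: subIsetr.
  - by near: n; exact: cvge0_le.
pose nc : {charge set (measurableTypeR R) -> \bar R} :=
  HB.pack N (isCharge.Build _ (measurableTypeR R) R N N0 Nfin Nsig).
have dom_mu : nc `<< mu.
  apply/null_content_dominatesP => E mE /= E0; rewrite /N nuD//; congr (_%:E).
  apply/eqP; rewrite -normr_le0; apply/ler_addgt0Pl => e e0; rewrite addr0.
  have [d d0 Hd] := nuc e e0; apply: Hd; first exact: measurableI.
    exact: subIsetr.
  apply: (@le_trans _ _ (mu E)); last by rewrite E0 lee_fin ltW.
  by apply: le_mu => //; exact: measurableI.
have RNf t := Radon_Nikodym_fin_num t dom_mu.
have RNE : EFin \o (fine \o Radon_Nikodym nc mu) = Radon_Nikodym nc mu.
  by apply/funext => t /=; rewrite fineK.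
exists (fine \o Radon_Nikodym nc mu); first by rewrite RNE; exact: Radon_Nikodym_integrable.
move=> E mE; have := Radon_Nikodym_integral dom_mu mE.
rewrite -RNE /Rintegral => h; have -> : nu E = fine (nc E) by [].
by rewrite h.
Unshelve. all: by end_near. Qed.

Definition locally_abs_continuous L : Prop := forall (m : nat) (e : R), 0 < e ->
  exists2 d : R, 0 < d & forall E, measurable E -> E `<=` dom gamma ->
    (forall t, E t -> t < m%:R) -> (mu E <= d%:E)%E -> `|L \1_E| <= e.

Definition local_density h : Prop := L0 gamma h /\
  forall m : nat, mu.-integrable (dom gamma `&` [set t | t < m%:R]) (EFin \o h).

Lemma patch_dom_lt (V : pointedType) (m : nat) (f : R -> V) :
  (forall t, dom gamma t -> m%:R <= t -> f t = point) ->
  f \_ (dom gamma) = f \_ (dom gamma `&` [set t | t < m%:R]).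
Proof.
move=> f0; apply/funext => t; rewrite !patchE.
have [dt|ndt] := pselect (dom gamma t); last first.
  by rewrite !memNset// => -[].
rewrite mem_set//; case: (ltP t m%:R) => tm; first by rewrite mem_set.
by rewrite memNset ?f0// => -[_] /=; rewrite ltNge tm.
Qed.

Lemma bounded_supp_integrable h u : local_density h -> bounded_supp u ->
  mu.-integrable (dom gamma) (fun t => (u t * h t)%:E).
Proof.
move=> [mh ih] [mu_ [m um]]; pose D := dom gamma `&` [set t | t < m%:R].
have mD : measurable D by exact: measurable_dom_lt_real.
have md := measurable_dom gamma.
have : mu.-integrable D (fun t => (u t * h t)%:E).
  apply: (@le_integrable _ _ _ mu D mD _ (fun t => (m%:R * h t)%:E)).
  - apply/measurable_EFinP; apply: measurable_funM.
      by apply: (measurable_funS md) mu_ => //; exact: subIsetl.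
    by apply: (measurable_funS md) mh => //; exact: subIsetl.
  - move=> t [dt _]; have [utm _] := um t dt.
    by rewrite !abse_EFin lee_fin !normrM ler_wpM2r// [X in _ <= X]ger0_norm.
  - by apply: (integrableZ_mu m%:R mD); exact: ih.
move=> /(integrable_patch_mu (fun t => (u t * h t)%:E) mD) iD.
apply/(integrable_patch_mu (fun t => (u t * h t)%:E) md).
rewrite (@patch_dom_lt _ m)// => t dt mt.
by have [_ ->//] := um t dt; rewrite mul0r.
Qed.

Lemma integral_mul_linear h : local_density h ->
  linear_bounded_supp (fun u => \int[mu]_(t in dom gamma) (u t * h t)).
Proof.
move=> lh a u v bu bv; have md := measurable_dom gamma.
have iu := bounded_supp_integrable lh bu.
have iv := bounded_supp_integrable lh bv.
rewrite -(RintegralZ_mu _ md iu) -(RintegralD_mu md (integrableZ_mu a md iu) iv).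
by apply: eq_Rintegral => t _ /=; ring.
Qed.

Lemma integral_mul_locally_bounded h : local_density h ->
  locally_bounded (fun u => \int[mu]_(t in dom gamma) (u t * h t)).
Proof.
move=> lh m; pose D := dom gamma `&` [set t | t < m%:R].
have mD : measurable D by exact: measurable_dom_lt_real.
have md := measurable_dom gamma.
have ihm : mu.-integrable D (EFin \o h) := lh.2 m.
have iahm : mu.-integrable D (EFin \o (fun t => `|h t|)) by exact: (integrable_norm ihm).
exists (\int[mu]_(t in D) `|h t|); first by apply: Rintegral_ge0.
move=> u e mu_ ue.
have bu : bounded_supp u by exact: bounded_supp_of_le ue.
have iu := bounded_supp_integrable lh bu.
have -> : \int[mu]_(t in dom gamma) (u t * h t) = \int[mu]_(t in D) (u t * h t).
  rewrite Rintegral_mkcond [RHS]Rintegral_mkcond (@patch_dom_lt _ m)// => t dt mt.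
  by have [_ ->//] := ue t dt; rewrite mul0r.
have iuD : mu.-integrable D (EFin \o (fun t => u t * h t)).
  by apply: (@integrableS _ _ _ mu _ _ _ md) => //; exact: subIsetl.
apply: (le_trans (le_normr_Rintegral_mu mD iuD)).
rewrite mulrC -(RintegralZ_mu _ mD iahm); apply: le_Rintegral => //.
- exact: (integrable_norm iuD).
- exact: (integrableZ_mu e mD iahm).
- by move=> t [dt _]; have [ute _] := ue t dt; rewrite normrM ler_wpM2r.
Qed.

(** Radon-Nikodym is applied on each unit interval, where the measure is finite, and the densities
    are glued; no global integrability is claimed. *)
Lemma exists_local_density L : linear_bounded_supp L -> locally_bounded L ->
  locally_abs_continuous L ->
  exists2 h, local_density h & forall u, bounded_supp u ->
    L u = \int[mu]_(t in dom gamma) (u t * h t).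
Proof.
move=> HL HB HA; have md := measurable_dom gamma.
pose D k := dom gamma `&` `[k%:R, k.+1%:R[%classic.
have mD k : measurable (D k) by exact: measurableI.
have bI k E : measurable E -> bounded_supp \1_(E `&` D k).
  move=> mE; apply: (@bounded_supp_indic k.+1); first exact: measurableI.
  by move=> t _ [_ [_]] /=; rewrite in_itv/= => /andP[].
have piece k : exists g : R -> R, mu.-integrable setT (EFin \o g) /\
    forall E, measurable E -> L \1_(E `&` D k) = \int[mu]_(t in E) g t.
  have [|E mE|E E' mE mE' EE'|e e0|g ig gE] :=
    @charge_density (D k) (fun E => L \1_(E `&` D k)) (mD k).
  - exact: dom_itv_fin.
  - by rewrite -setIA setIid.
  - rewrite -(functionalD HL (bI k E mE) (bI k E' mE')); congr L.
    by rewrite setIUl indic_setU// -setIIl EE' set0I.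
  - have [d d0 Hd] := HA k.+1 e e0; exists d => // E mE ED Ed.
    apply: Hd; [exact: measurableI|by move=> t [/ED[]]| |].
      by move=> t [/ED[_]] /=; rewrite in_itv/= => /andP[].
    by rewrite (setIidl ED).
  - by exists g.
have [g Hg] := choice piece.
(* The integer part selects the unit interval containing [t]. *)
pose h t := g (Num.truncn t) t.
have hE k t : D k t -> h t = g k t.
  move=> [_] /=; rewrite in_itv/= => kt; congr (g _ t); exact: truncn_def.
have mg k : measurable_fun setT (g k).
  by have /measurable_int := (Hg k).1 => /measurable_EFinP.
have domD : dom gamma = \bigcup_k D k.
  apply/seteqP; split=> t; last by move=> [k _ []].
  move=> dt; exists (Num.truncn t) => //; split=> //=; rewrite in_itv/=.
  by apply: truncn_itv; case: dt.
have mh : L0 gamma h.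
  rewrite /L0/= domD; apply/measurable_fun_bigcup => // k.
  apply: (eq_measurable_fun (g k)); first by move=> t /set_mem Dt; rewrite (hE k).
  exact: measurable_funTS.
have lt0E E : E `<=` dom gamma -> (forall t, E t -> t < 0%:R) -> E = set0.
  move=> Ed E0; apply/seteqP; split=> // t Et.
  by have := E0 t Et; have [t0 _] := Ed t Et; rewrite ltNge t0.
have dec m E : E `<=` dom gamma -> (forall t, E t -> t < m.+1%:R) ->
    E = (E `&` [set t | t < m%:R]) `|` (E `&` D m).
  move=> Ed Em; apply/seteqP; split=> t; last by case=> -[].
  move=> Et; case: (ltP t m%:R) => tm; [by left|right; split=> //; split; first exact: Ed].
  by rewrite /= in_itv/= tm Em.
have ihD m E : measurable E -> mu.-integrable (E `&` D m) (EFin \o h).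
  move=> mE; apply: (@eq_integrable _ _ _ mu _ _ (EFin \o g m)).
  - exact: (measurableI _ _ mE (mD m)).
  - by move=> t /set_mem[_ Dt] /=; rewrite (hE m).
  - apply: (@integrableS _ _ _ mu setT _ _ measurableT _ _ (Hg m).1) => //.
    exact: (measurableI _ _ mE (mD m)).
have ih m E : measurable E -> E `<=` dom gamma -> (forall t, E t -> t < m%:R) ->
    mu.-integrable E (EFin \o h) /\ L \1_E = \int[mu]_(t in E) h t.
  elim: m E => [|m IH] E mE Ed Em.
    rewrite (lt0E E)//; split; first exact: integrable_set0.
    rewrite Rintegral_set0 (_ : \1_set0 = cst 0) ?functional0//.
    by apply/funext => t; rewrite indic0.
  have mEm : measurable (E `&` [set t | t < m%:R]).
    by rewrite -(setIidl Ed) -setIA; apply: measurableI => //; exact: measurable_dom_lt_real.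
  have [|t []//|i1 e1] := IH _ mEm; first by move=> t [/Ed].
  have dj : [disjoint (E `&` [set t | t < m%:R]) & (E `&` D m)].
    by apply/disj_setPS => t [[_ /= tm] [_ [_]]] /=; rewrite in_itv/= leNgt tm.
  have mED : measurable (E `&` D m) by exact: measurableI.
  rewrite (dec m E Ed Em); split.
    by apply: integrableU_mu => //; exact: ihD.
  rewrite Rintegral_setU//; last by apply: integrableU_mu => //; exact: ihD.
  have -> : \int[mu]_(t in E `&` D m) h t = L \1_(E `&` D m).
    have := (Hg m).2 _ mED; rewrite -setIA setIid => ->.
    by apply: eq_Rintegral => t /set_mem[_ Dt]; rewrite (hE m).
  rewrite -e1 -(functionalD HL); last exact: bI; last first.
    by apply: (@bounded_supp_indic m) => // t _ [].
  congr L; rewrite indic_setU//.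
  by apply/seteqP; split=> // t [[_ /= tm] [_ [_]]] /=; rewrite in_itv/= leNgt tm.
have lh : local_density h.
  split=> // m; apply: (ih m _ _ _ _).1 => //; [exact: measurable_dom_lt_real|by move=> t []].
exists h => // u bu; have bh := integral_mul_linear lh.
(* The difference vanishes on indicators of bounded sets, hence on all bounded functions with
   bounded support. *)
pose G u := L u + (-1) * \int[mu]_(t in dom gamma) (u t * h t).
suff : G u = 0 by rewrite /G mulN1r => /eqP; rewrite subr_eq0 => /eqP.
apply: functional_eq0 bu.
- by move=> a v1 v2 b1 b2; rewrite /G HL// bh//; ring.
- move=> m; have [C1 C10 H1] := HB m; have [C2 C20 H2] := integral_mul_locally_bounded lh m.
  exists (C1 + C2); first exact: addr_ge0.
  move=> v e mv ve; rewrite /G mulN1r (le_trans (ler_normB _ _))// mulrDl.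
  by apply: lerD; [exact: H1|exact: H2].
- move=> m E mE Ed Em; have [i1 e1] := ih m E mE Ed Em; rewrite /G e1.
  rewrite (_ : \int[mu]_(t in dom gamma) _ = \int[mu]_(t in E) h t); first by ring.
  rewrite Rintegral_mkcond [RHS]Rintegral_mkcond; apply: eq_Rintegral => t _.
  rewrite !patchE indicE; have [Et|nEt] := pselect (E t).
    by rewrite !mem_set ?mul1r//; exact: Ed.
  by rewrite (memNset nEt) mul0r; case: ifP.
Qed.

End representation.

(** * The minimax argument *)

Section minimax.
Context {R : realType}.
Local Notation mu := (@lebesgue_measure R).
Variables (gamma : \bar R) (phi w : R -> R).
Hypotheses (gamma_gt0 : (0 < gamma)%E) (Hw : weight gamma w).
Hypothesis Nphi : N_function phi.
Implicit Types (f g h u v : R -> R) (l : seq (R * set R)).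

Let cut (m : nat) : set R := dom gamma `&` [set t | t < m%:R].

Let mcut m : measurable (cut m). Proof. exact: measurable_dom_lt_real. Qed.

Let mu_cut m : (mu (cut m) < +oo)%E. Proof. exact: mu_dom_lt_fin. Qed.

Definition scale_dominant (c : R) l := [seq (c * p.1, p.2) | p <- l].

Lemma simple_dominantZ c l t :
  simple_dominant (scale_dominant c l) t = c * simple_dominant l t.
Proof.
rewrite /simple_dominant big_map mulr_sumr; apply: eq_bigr => p _ /=.
by rewrite mulrA.
Qed.

Lemma dominant_weightZ c l :
  dominant_weight gamma w (scale_dominant c l) = c * dominant_weight gamma w l.
Proof.
rewrite /dominant_weight big_map mulr_sumr; apply: eq_bigr => p _ /=.
by rewrite mulrA.
Qed.

Lemma admissibleZ c l : 0 <= c -> admissible gamma l ->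
  admissible gamma (scale_dominant c l).
Proof.
move=> c0 al _ /List.in_map_iff[p [<- pl]] /=; have [p0 mp dp fp] := al p pl.
by split=> //; exact: mulr_ge0.
Qed.

Lemma simple_dominant_cat l l' t :
  simple_dominant (l ++ l') t = simple_dominant l t + simple_dominant l' t.
Proof. by rewrite /simple_dominant big_cat. Qed.

Lemma dominant_weight_cat l l' : dominant_weight gamma w (l ++ l') =
  dominant_weight gamma w l + dominant_weight gamma w l'.
Proof. by rewrite /dominant_weight big_cat. Qed.

Lemma admissible_cat l l' : admissible gamma l -> admissible gamma l' ->
  admissible gamma (l ++ l').
Proof. by move=> al al' p /List.in_app_iff[]; [exact: al|exact: al']. Qed.

Lemma admissible1 c (E : set R) : 0 <= c -> measurable E -> E `<=` dom gamma ->
  (mu E < +oo)%E -> admissible gamma [:: (c, E)].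
Proof. by move=> c0 mE Ed Ef p [<-|//]. Qed.

Lemma simple_dominant1 c (E : set R) t : simple_dominant [:: (c, E)] t = c * \1_E t.
Proof. by rewrite /simple_dominant big_seq1. Qed.

Lemma dominant_weight1 c (E : set R) :
  dominant_weight gamma w [:: (c, E)] = c * fine (wint gamma w (mu E)).
Proof. by rewrite /dominant_weight big_seq1. Qed.

Lemma simple_dominant_nil t : simple_dominant [::] t = 0 :> R.
Proof. by rewrite /simple_dominant big_nil. Qed.

Lemma dominant_weight_nil : dominant_weight gamma w [::] = 0.
Proof. by rewrite /dominant_weight big_nil. Qed.

Lemma local_density_norm h : local_density gamma h ->
  local_density gamma (fun t => `|h t|).
Proof.
move=> [mh ih]; split; first exact: L0_norm.
by move=> m; exact: (integrable_norm (ih m)).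
Qed.

Lemma bounded_supp_phi f : bounded_supp gamma f ->
  bounded_supp gamma (fun t => phi `|f t|).
Proof.
move=> [mf [m Hm]]; apply: (@bounded_supp_of_le _ _ m (phi m%:R)).
  exact: measurable_phi_norm.
move=> t dt; have [fm ft] := Hm t dt; split.
  rewrite ger0_norm; last exact: (N_function_ge0 Nphi).
  exact: (N_function_nd Nphi).
by move=> /ft ->; rewrite normr0 N_function0.
Qed.

(** * Hahn-Banach separation for a fixed bound [K] *)

Section separation.
Variables (h : R -> R) (K : R).
Hypotheses (lh : local_density gamma h) (K0 : 0 <= K).
Let I f := \int[mu]_(t in dom gamma) (f t * `|h t|).
Hypothesis HK : forall f, bounded_supp gamma f ->
  (forall t, dom gamma t -> 0 <= f t) ->
  ((I f - K)%:E <= rho gamma phi w f)%E.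

(* The infimum of these values over all [s], [f] and [l] is the sublinear
   functional of the Hahn-Banach argument. *)
Definition majorant_value u (a : R) : Prop := exists s f l,
  [/\ 0 < s, bounded_supp gamma f & forall t, dom gamma t -> 0 <= f t] /\
  [/\ admissible gamma l,
      forall t, dom gamma t -> u t + s * phi (f t) <= simple_dominant l t
    & a = dominant_weight gamma w l - s * (I f - K)].

Let I_lin : linear_bounded_supp gamma I.
Proof. exact: integral_mul_linear (local_density_norm lh). Qed.

Let IZ a f : bounded_supp gamma f -> I (a \*o f) = a * I f.
Proof. by move=> bf; exact: (functionalZ I_lin). Qed.

Let I0 : I (cst 0) = 0. Proof. exact: functional0 I_lin. Qed.

(** Convexity of [phi] with weights [s / (s + s')] and [s' / (s + s')]: the factor [s] in the
    constraint makes the admissible data stable under addition. *)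
Lemma majorant_valueD u u' a a' : majorant_value u a -> majorant_value u' a' ->
  majorant_value (u \+ u') (a + a').
Proof.
move=> [s [f [l [[s0 bf f0] [al ul ->]]]]] [s' [f' [l' [[s'0 bf' f'0] [al' ul' ->]]]]].
have ss0 : 0 < s + s' by exact: addr_gt0.
pose c := s / (s + s'); have c0 : 0 <= c by exact: divr_ge0 (ltW _) (ltW _).
have cC : 1 - c = s' / (s + s').
  by rewrite /c -[X in X - _](divff (lt0r_neq0 ss0)) -mulrBl addrAC subrr add0r.
have c1 : c <= 1 by rewrite -subr_ge0 cC divr_ge0// ltW.
exists (s + s'), (c \*o f \+ ((1 - c) \*o f')), (l ++ l'); split; split.
- by [].
- by apply: bounded_supp_lin => //; exact: bounded_suppZ.
- by move=> t dt /=; rewrite addr_ge0// mulr_ge0 ?f0 ?f'0// subr_ge0.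
- exact: admissible_cat.
- move=> t dt; rewrite simple_dominant_cat /=.
  have := N_function_convex Nphi (f0 t dt) (f'0 t dt) c0 c1.
  rewrite -(ler_pM2l ss0) mulrDr => /= hc.
  apply: le_trans (lerD (ul t dt) (ul' t dt)); rewrite addrACA lerD2l.
  apply: (le_trans hc); rewrite cC !mulrA /c.
  by rewrite ![(s + s') * _]mulrC !mulfK// lt0r_neq0.
- rewrite dominant_weight_cat I_lin//; last exact: bounded_suppZ.
  rewrite IZ// cC /c; have sn : s + s' != 0 by exact: lt0r_neq0.
  by field.
Qed.

Lemma majorant_valueZ c u a : 0 < c -> majorant_value u a ->
  majorant_value (c \*o u) (c * a).
Proof.
move=> c0 [s [f [l [[s0 bf f0] [al ul ->]]]]].
exists (c * s), f, (scale_dominant c l); split; split => //.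
- exact: mulr_gt0.
- by apply: admissibleZ => //; exact: ltW.
- move=> t dt; rewrite simple_dominantZ /= -mulrA -mulrDr.
  by rewrite ler_wpM2l ?ul// ltW.
- by rewrite dominant_weightZ; ring.
Qed.

(** The choice [f = 0]. Since [s] must be positive a remainder [s * K] is left, which later tends to
    0. *)
Lemma majorant_value_dominant u l s : bounded_supp gamma u ->
  admissible gamma l -> (forall t, dom gamma t -> u t <= simple_dominant l t) ->
  0 < s -> majorant_value u (dominant_weight gamma w l + s * K).
Proof.
move=> bu al ul s0; exists s, (cst 0), l; split; split => //.
- exact: bounded_supp_cst0.
- by move=> t dt /=; rewrite (N_function0 Nphi) mulr0 addr0; exact: ul.
- by rewrite I0; ring.
Qed.

Lemma bounded_supp_dominant u : bounded_supp gamma u -> exists m : nat,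
  forall t, dom gamma t -> `|u t| <= m%:R * \1_(cut m) t.
Proof.
move=> [mu_ [m Hm]]; exists m => t dt; have [um ut] := Hm t dt; rewrite indicE.
case: (ltP t m%:R) => tm; first by rewrite mem_set ?mulr1.
by rewrite memNset ?ut ?normr0 ?mulr0// => -[_] /=; rewrite ltNge tm.
Qed.

(** The hypothesis on [K] enters here. With [|u|] below [m] times an indicator, [s * phi f] is
    dominated by [l ++ lm], so [s * (I f - K)] is at most the sum of the two weights, and the weight
    of [l] cancels. *)
Lemma majorant_value_lb u : bounded_supp gamma u ->
  exists b, forall a, majorant_value u a -> b <= a.
Proof.
move=> bu; have [m Hm] := bounded_supp_dominant bu.
pose lm := [:: (m%:R : R, cut m)].
have alm : admissible gamma lm by apply: admissible1 => //; move=> t [].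
exists (- dominant_weight gamma w lm) => a [s [f [l [[s0 bf f0] [al ul ->]]]]].
have si0 : 0 <= s^-1 by rewrite invr_ge0 ltW.
have mf : L0 gamma f by case: bf.
have fl t : dom gamma t -> phi `|f t| <= simple_dominant (scale_dominant s^-1 (l ++ lm)) t.
  move=> dt; rewrite simple_dominantZ simple_dominant_cat simple_dominant1.
  rewrite ger0_norm ?f0// mulrC ler_pdivlMr// mulrC.
  have := ul t dt; have := Hm t dt; have := ler_norm (- u t); rewrite normrN; lra.
have := rho_le_dominant gamma_gt0 Hw Nphi mf (admissibleZ si0 (admissible_cat al alm)) fl.
move=> /(le_trans (HK bf f0)); rewrite lee_fin dominant_weightZ dominant_weight_cat.
by rewrite mulrC ler_pdivlMr//; lra.
Qed.

Definition majorant u : R := inf [set a | majorant_value u a].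

Lemma majorant_nonempty u : bounded_supp gamma u ->
  [set a | majorant_value u a] !=set0.
Proof.
move=> bu; have [m Hm] := bounded_supp_dominant bu.
exists (dominant_weight gamma w [:: (m%:R, cut m)] + 1 * K).
apply: majorant_value_dominant => //; first by apply: admissible1 => // t [].
by move=> t dt; rewrite simple_dominant1 (le_trans (ler_norm _))// Hm.
Qed.

Lemma majorant_le u a : bounded_supp gamma u -> majorant_value u a ->
  majorant u <= a.
Proof.
move=> bu ua; have [b Hb] := majorant_value_lb bu.
by apply: ge_inf => //; exists b.
Qed.

Lemma majorant_ge u b : bounded_supp gamma u ->
  (forall a, majorant_value u a -> b <= a) -> b <= majorant u.
Proof. by move=> bu Hb; apply: lb_le_inf => //; exact: majorant_nonempty. Qed.

Lemma majorant_sublinear : sublinear_on (bounded_supp gamma) majorant.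
Proof.
split=> [x y bx by_|a x a0 bx].
  have bxy : bounded_supp gamma (x + y) by exact: bounded_suppD.
  rewrite -lerBlDr; apply: majorant_ge => // b xb.
  rewrite lerBlDr -lerBlDl; apply: majorant_ge => // c yc.
  by rewrite lerBlDl; apply: majorant_le => //; exact: majorant_valueD.
have bax : bounded_supp gamma (a *: x) by exact: bounded_suppZ.
rewrite mulrC -ler_pdivrMr//; apply: majorant_ge => // b xb.
rewrite ler_pdivrMr// mulrC; apply: majorant_le => //; exact: majorant_valueZ.
Qed.

Lemma exists_dominated_functional : exists nu : (R -> R) -> R,
  [/\ linear_bounded_supp gamma nu,
      forall u l, bounded_supp gamma u -> admissible gamma l ->
        (forall t, dom gamma t -> u t <= simple_dominant l t) ->
        nu u <= dominant_weight gamma w l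
    & forall f, bounded_supp gamma f -> (forall t, dom gamma t -> 0 <= f t) ->
        I f - K <= nu (fun t => phi `|f t|)].
Proof.
have [nu nuL nuq] := hahn_banach_dominated (bounded_supp_cst0 gamma)
  (fun a x y => @bounded_supp_lin R gamma a x y) majorant_sublinear.
have HL : linear_bounded_supp gamma nu by move=> a u v bu bv; exact: nuL.
exists nu; split => // [u l bu al ul|f bf f0].
  apply/ler_addgt0Pl => e e0.
  (* Small enough for the remainder [s * K] to be at most [e], also when [K = 0]. *)
  have s0 : 0 < e / (K + 1) by apply: divr_gt0 => //; rewrite ltr_wpDl.
  have : nu u <= dominant_weight gamma w l + e / (K + 1) * K.
    by apply: (le_trans (nuq u bu)); apply: majorant_le => //; exact: majorant_value_dominant.
  have : e / (K + 1) * K <= e.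
    by rewrite mulrAC ler_pdivrMr ?ltr_wpDl// ler_wpM2l ?ltW// ltrDl.
  by move=> h1 h2; rewrite addrC (le_trans h2)// lerD2l.
have bp := bounded_supp_phi bf.
have : nu (-1 \*o (fun t => phi `|f t|)) <= - (I f - K).
  apply: (le_trans (nuq _ (bounded_suppZ _ bp))); apply: majorant_le.
    exact: bounded_suppZ.
  (* For [u] equal to minus [phi f] the empty dominant suffices, and the value is minus
     [I f - K]. *)
  exists 1, f, [::]; split; split => //.
    by move=> t dt; rewrite /= simple_dominant_nil ger0_norm ?f0//; lra.
  by rewrite dominant_weight_nil; ring.
by rewrite (functionalZ HL)//; lra.
Qed.

Lemma minimax_weight : exists v, [/\ local_density gamma v,
    forall t, dom gamma t -> 0 <= v t, submaj gamma v w
  & forall f, bounded_supp gamma f -> (forall t, dom gamma t -> 0 <= f t) ->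
      \int[mu]_(t in dom gamma) (f t * `|h t|) -
      \int[mu]_(t in dom gamma) (phi `|f t| * v t) <= K].
Proof.
have [nu [HL nu_le nu_ge]] := exists_dominated_functional.
have dom0 : dom gamma 0 by split.
have nuN u : bounded_supp gamma u -> nu (-1 \*o u) = - nu u.
  by move=> bu; rewrite (functionalZ HL)// mulN1r.
(* A function bounded by [e] on [[0, m)] is dominated by [e] times one indicator, as is its
   opposite. *)
have HB : locally_bounded gamma nu.
  move=> m; exists (fine (wint gamma w (mu (cut m)))).
    by rewrite fine_ge0// wint_ge0.
  move=> u e mu_ ue; have e0 : 0 <= e by rewrite (le_trans (normr_ge0 _) (ue 0 dom0).1).
  have bu : bounded_supp gamma u by exact: bounded_supp_of_le ue.
  have al : admissible gamma [:: (e, cut m)] by apply: admissible1 => // t [].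
  have le_d t : dom gamma t -> `|u t| <= simple_dominant [:: (e, cut m)] t.
    move=> dt; have [u1 u2] := ue t dt; rewrite simple_dominant1 indicE.
    case: (ltP t m%:R) => tm; first by rewrite mem_set ?mulr1.
    by rewrite memNset ?u2 ?normr0 ?mulr0// => -[_] /=; rewrite ltNge tm.
  rewrite ler_norml mulrC -dominant_weight1; apply/andP; split.
    rewrite lerNl -nuN//; apply: nu_le => //; first exact: bounded_suppZ.
    by move=> t dt /=; rewrite mulN1r (le_trans (ler_norm _))// normrN le_d.
  by apply: nu_le => // t dt; rewrite (le_trans (ler_norm _))// le_d.
have nuE (m : nat) E : measurable E -> E `<=` dom gamma ->
    (forall t, E t -> t < m%:R) -> [/\ bounded_supp gamma \1_E, (mu E < +oo)%E, 0 <= nu \1_E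
      & (nu \1_E <= fine (wint gamma w (mu E)))].
  move=> mE Ed Em; have bE : bounded_supp gamma \1_E.
    by apply: (@bounded_supp_indic _ _ m) => // t _; exact: Em.
  have Efin : (mu E < +oo)%E.
    by apply: le_lt_trans (mu_cut m); apply: le_mu => // t Et; split; [exact: Ed|exact: Em].
  split=> //.
    rewrite -oppr_le0 -nuN// -dominant_weight_nil; apply: nu_le => //.
      exact: bounded_suppZ.
    by move=> t dt; rewrite simple_dominant_nil/= mulN1r oppr_le0.
  rewrite -[leRHS]mul1r -dominant_weight1; apply: nu_le => //; first exact: admissible1.
  by move=> t dt; rewrite simple_dominant1 mul1r.
(* Here W(0+) = 0 enters: on indicators [nu] lies between 0 and W of the measure. *)
have HA : locally_abs_continuous gamma nu.
  move=> m e e0; have [d d0 Hd] := wint_small gamma_gt0 Hw e0.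
  exists d => // E mE Ed Em Ed'; have [bE Efin n0 nW] := nuE m E mE Ed Em.
  rewrite ger0_norm// (le_trans nW)// -lee_fin fineK ?Hd//.
  exact: (wint_fin gamma_gt0 Hw).
have [v0 lv0 v0E] := exists_local_density HL HB HA.
(* Nonnegativity is required at every point, so the positive part is taken; the bounds on [nu] carry
   over by restricting to the set where [v0] is positive. *)
pose v t := Num.max (v0 t) 0.
have mv0 : L0 gamma v0 := lv0.1.
have mv : L0 gamma v by apply: measurable_maxr => //; exact: measurable_cst.
have v_ge0 t : 0 <= v t by rewrite /v le_max lexx orbT.
have lv : local_density gamma v.
  split=> // m; apply: (@le_integrable _ _ _ mu _ (mcut m) _ (EFin \o v0)).
  - apply/measurable_EFinP; apply: measurable_funS mv; first exact: measurable_dom.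
    exact: subIsetl.
  - move=> t _ /=; rewrite lee_fin ger0_norm ?v_ge0// /v ge_max.
    by rewrite ler_norm normr_ge0.
  - exact: lv0.2.
have vW E : measurable E -> E `<=` dom gamma ->
    (\int[mu]_(t in E) (v t)%:E <= wint gamma w (mu E))%E.
  move=> mE Ed; apply: (@integral_exhaustion_le R E (fun m => [set t | t < m%:R])).
  - exact: mE.
  - move=> m; rewrite (_ : [set t | _] = `]-oo, m%:R[%classic)//.
  - by move=> m n mn t /= tm; rewrite (lt_le_trans tm)// ler_nat.
  - by move=> t _; exists (Num.truncn t).+1; exact: truncnS_gt.
  - by apply/measurable_EFinP; apply: measurable_funS mv => //; exact: measurable_dom.
  - by move=> t _; rewrite lee_fin.
  move=> m; set E' := E `&` _.
  have mE' : measurable E'.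
    rewrite /E' -(setIidl Ed) -setIA; apply: measurableI => //; exact: mcut.
  have E'd : E' `<=` dom gamma by move=> t [/Ed].
  pose A := E' `&` [set t | dom gamma t /\ 0 < v0 t].
  have mA : measurable A by apply: measurableI => //; exact: measurable_super_level.
  have [||bA Afin n0 nW] := nuE m A mA; first by move=> t [/E'd].
    by move=> t [[]].
  have iA : mu.-integrable (dom gamma) (EFin \o (fun t => \1_A t * v0 t)).
    exact: (bounded_supp_integrable lv0 bA).
  have -> : (\int[mu]_(t in E') (v t)%:E = (nu \1_A)%:E)%E.
    rewrite v0E// -(EFin_Rintegral_mu (measurable_dom gamma) iA).
    rewrite integral_mkcond [RHS]integral_mkcond; apply: eq_integral => t _.
    rewrite !patchE indicE /v.
    have [E't|nE't] := pselect (E' t); last first.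
      rewrite (memNset nE't) [t \in A]memNset; last by move=> [].
      by rewrite mul0r; case: ifP.
    rewrite (mem_set E't) (mem_set (E'd t E't)).
    case: (ltP 0 (v0 t)) => v0t; first by rewrite mem_set ?mul1r//; split=> //; split=> //; exact: E'd.
    by rewrite memNset ?mul0r// => -[_ [_]]; rewrite ltNge v0t.
  apply: (@le_trans _ _ (wint gamma w (mu A))).
    rewrite -(fineK (wint_fin gamma_gt0 Hw Afin)) lee_fin; exact: nW.
  apply: (wint_nd gamma_gt0 Hw); apply: le_mu => //.
  by move=> t [[]].
exists v; split => //.
  exact: (submaj_of_integral_le gamma_gt0 Hw mv (fun t _ => v_ge0 t) vW).
move=> f bf f0; have := nu_ge f bf f0; have bp := bounded_supp_phi bf.
rewrite v0E//; suff : \int[mu]_(t in dom gamma) (phi `|f t| * v0 t) <=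
  \int[mu]_(t in dom gamma) (phi `|f t| * v t) by rewrite /I; lra.
apply: le_Rintegral; first exact: measurable_dom.
- exact: (bounded_supp_integrable lv0 bp).
- exact: (bounded_supp_integrable lv bp).
- move=> t dt; apply: ler_wpM2l; first exact: (N_function_ge0 Nphi).
  by rewrite /v le_max lexx.
Qed.

Lemma P_le_of_minimax : (P gamma (complementary phi) w h <= K%:E)%E.
Proof.
have [v [lv v0 vw vK]] := minimax_weight; have md := measurable_dom gamma.
apply: (@le_trans _ _ (\int[mu]_(t in dom gamma)
    P_integrand (complementary phi) (h t) (v t))%E).
  by apply: ereal_inf_lbound; exists v => //; split=> //; exact: lv.1.
pose C n : set R := [set t | t < n%:R].
(* Maximizers at stage [n], cut to [[0, n)] to have bounded support; the integrands increase with
   [n] to the integrand of [P]. *)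
pose f n t := young_argmax phi (h t) (v t) n * \1_(C n) t.
have mC n : measurable (dom gamma `&` C n) by exact: mcut.
have bf n : bounded_supp gamma (f n).
  have [M M0 HM] := young_argmax_bounded phi n.
  apply: (@bounded_supp_of_le _ _ n M).
    by apply: L0_indic => //; exact: (measurable_young_argmax Nphi n md lh.1 lv.1).
  move=> t dt; rewrite /f indicE; have /andP[y0 yM] := HM (h t) (v t).
  case: (ltP t n%:R) => tn; first by rewrite mem_set// mulr1 ger0_norm.
  by rewrite memNset ?mulr0 ?normr0// /C/= ltNge tn.
have f0 n t : 0 <= f n t by rewrite /f mulr_ge0// young_argmax_ge0.
have fE n t : f n t * `|h t| - phi `|f n t| * v t = young_max phi (h t) (v t) n * \1_(C n) t.
  rewrite (ger0_norm (f0 n t)) /f /young_max indicE; case: (t \in C n); rewrite ?mulr1//.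
  by rewrite !mulr0 (N_function0 Nphi) !mul0r subrr.
have iy n : mu.-integrable (dom gamma) (EFin \o (fun t => f n t * `|h t|)).
  exact: (bounded_supp_integrable (local_density_norm lh) (bf n)).
have ip n : mu.-integrable (dom gamma) (EFin \o (fun t => phi `|f n t| * v t)).
  exact: (bounded_supp_integrable lv (bounded_supp_phi (bf n))).
apply: (@monotone_convergence_le R _
    (fun n t => (young_max phi (h t) (v t) n * \1_(C n) t)%:E)) => //.
- move=> n; apply/measurable_EFinP.
  apply: (eq_measurable_fun (fun t => f n t * `|h t| - phi `|f n t| * v t)).
    by move=> t _; exact: fE.
  by apply: measurable_funB; apply/measurable_EFinP; exact: (@measurable_int _ _ _ mu).
- by move=> n t _; rewrite lee_fin mulr_ge0// (young_max_ge0 Nphi).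
- move=> t _ m n mn; rewrite lee_fin; apply: ler_pM => //.
  + exact: (young_max_ge0 Nphi).
  + exact: (young_max_nd phi).
  + rewrite !indicE; have [Ct|nCt] := pselect (C m t); last by rewrite (memNset nCt).
    by rewrite !mem_set// /C/= (lt_le_trans Ct)// ler_nat.
- move=> t dt; have := @cvg_young_max _ _ Nphi (h t) _ (v0 t dt).
  apply: cvg_trans; apply: near_eq_cvg; near=> n.
  rewrite indicE mem_set ?mulr1// /C/=.
  apply: (@lt_le_trans _ _ (Num.truncn t).+1%:R); first exact: truncnS_gt.
  by rewrite ler_nat; near: n; exact: nbhs_infty_ge.
- move=> n; have := vK (f n) (bf n) (fun t _ => f0 n t).
  rewrite -RintegralB//.
  rewrite -lee_fin -(EFin_Rintegral_mu md (integrableB_mu md (iy n) (ip n))).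
  apply: le_trans; rewrite le_eqVlt; apply/predU1P; left.
  by apply: eq_integral => t _; rewrite fE.
Unshelve. all: by end_near. Qed.

End separation.
End minimax.

(** * Functionals on the Orlicz-Lorentz space *)

Opaque rho.

Section dual_functionals.
Context {R : realType}.
Local Notation mu := (@lebesgue_measure R).
Variables (gamma : \bar R) (phi w : R -> R).
Hypotheses (gamma_gt0 : (0 < gamma)%E) (Hw : weight gamma w).
Hypothesis Nphi : N_function phi.
Implicit Types (f g h u v : R -> R) (F G : (R -> R) -> R) (A : set R).

Local Notation rho := (rho gamma phi w).
Local Notation Lam := (Lambda gamma phi w).
Local Notation norm0 := (orlicz_norm gamma phi w).

Lemma L0_cst0 : L0 gamma (cst 0). Proof. exact: measurable_cst. Qed.

Lemma L0Z a f : L0 gamma f -> L0 gamma (a \*o f).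
Proof. by move=> mf; apply: measurable_funM => //; exact: measurable_cst. Qed.

Lemma rho_lty_le f g : L0 gamma f -> L0 gamma g ->
  (forall t, dom gamma t -> `|f t| <= `|g t|) -> (rho g < +oo)%E -> (rho f < +oo)%E.
Proof. by move=> mf mg fg; apply: le_lt_trans; exact: (le_rho gamma_gt0 Hw Nphi). Qed.

Lemma Lambda_of_le f g : L0 gamma f -> Lam g ->
  (forall t, dom gamma t -> `|f t| <= `|g t|) -> Lam f.
Proof.
move=> mf [mg [k k0 gk]] fg; split; first exact: mf.
exists k; first exact: k0.
apply: rho_lty_le gk.
- exact: L0Z.
- exact: L0Z.
- by move=> t dt /=; rewrite !normrM ler_wpM2l ?fg.
Qed.

Lemma Lambda_rho f : L0 gamma f -> (rho f < +oo)%E -> Lam f.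
Proof.
move=> mf rf; split; first exact: mf.
exists 1; first exact: ltr01.
by rewrite (_ : 1 \*o f = f)//; apply/funext => t /=; rewrite mul1r.
Qed.

Lemma LambdaZ a f : Lam f -> Lam (a \*o f).
Proof.
move=> [mf [k k0 fk]]; split; first exact: L0Z.
have a0 : 0 < `|a| + 1 by rewrite ltr_wpDl.
exists (k / (`|a| + 1)); first exact: divr_gt0.
apply: rho_lty_le fk => [||t dt /=]; first by apply: L0Z; exact: L0Z.
  exact: L0Z.
rewrite !normrM mulrA ler_wpM2r// (gtr0_norm k0) ger0_norm ?invr_ge0 ?(ltW a0)//.
by rewrite mulrAC ler_pdivrMr// ler_wpM2l ?(ltW k0)// lerDl.
Qed.

Lemma rho_indic_le (k : R) (E : set R) : 0 <= k -> measurable E ->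
  E `<=` dom gamma -> (mu E < +oo)%E ->
  (rho (k \*o \1_E) <= (phi k)%:E * wint gamma w (mu E))%E.
Proof.
move=> k0 mE Ed Ef; have p0 : 0 <= phi k by exact: (N_function_ge0 Nphi).
have -> : ((phi k)%:E * wint gamma w (mu E) =
    (dominant_weight gamma w [:: (phi k, E)])%:E)%E.
  by rewrite dominant_weight1 EFinM fineK//; exact: (wint_fin gamma_gt0 Hw).
apply: (rho_le_dominant gamma_gt0 Hw Nphi).
- by apply: L0Z; exact: measurable_indic.
- exact: admissible1.
- move=> t dt; rewrite simple_dominant1 /= indicE; case: (_ \in _).
    by rewrite !mulr1 ger0_norm.
  by rewrite !mulr0 normr0 (N_function0 Nphi).
Qed.

Lemma bounded_supp_le u v : bounded_supp gamma u -> L0 gamma v ->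
  (forall t, dom gamma t -> `|v t| <= `|u t|) -> bounded_supp gamma v.
Proof.
move=> [_ [m Hm]] mv vu; split=> //; exists m => t dt; have [um ut] := Hm t dt.
split; first exact: le_trans (vu t dt) um.
by move=> /ut u0; apply/eqP; rewrite -normr_le0 -[leRHS](normr0 R) -u0 vu.
Qed.

Lemma rho_bounded_supp u : bounded_supp gamma u -> (rho u < +oo)%E.
Proof.
move=> [mu_ [m Hm]]; pose E := dom gamma `&` [set t | t < m%:R].
have mE : measurable E by exact: measurable_dom_lt_real.
have Ef : (mu E < +oo)%E by exact: mu_dom_lt_fin.
have m0 : 0 <= m%:R :> R by [].
have := rho_indic_le m0 mE (@subIsetl _ _ _) Ef.
rewrite -(fineK (wint_fin gamma_gt0 Hw Ef)) -EFinM => rE.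
apply: (@rho_lty_le _ (m%:R \*o \1_E)) => //.
- by apply: L0Z; exact: measurable_indic.
- move=> t dt /=; have [um ut] := Hm t dt; rewrite indicE.
  case: (ltP t m%:R) => tm; first by rewrite mem_set// mulr1 [leRHS]ger0_norm.
  by rewrite ut// normr0.
- exact: le_lt_trans rE (ltry _).
Qed.

Lemma Lambda_bounded_supp u : bounded_supp gamma u -> Lam u.
Proof. by move=> bu; apply: Lambda_rho; [case: bu|exact: rho_bounded_supp]. Qed.

Lemma Lambda_cst0 : Lam (cst 0).
Proof. by apply: Lambda_bounded_supp; exact: bounded_supp_cst0. Qed.

Definition linear_Lambda G : Prop := forall (a : R) f g, Lam f -> Lam g ->
  G (a \*o f \+ g) = a * G f + G g.

Lemma linear_Lambda0 G : linear_Lambda G -> G (cst 0) = 0.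
Proof.
move=> GL; have := GL (-1) _ _ Lambda_cst0 Lambda_cst0.
rewrite (_ : (_ \*o _ \+ _) = cst 0); first by lra.
by apply/funext => t /=; rewrite mulr0 addr0.
Qed.

Lemma linear_LambdaZ G a f : linear_Lambda G -> Lam f -> G (a \*o f) = a * G f.
Proof.
move=> GL Lf; have := GL a _ _ Lf Lambda_cst0; rewrite linear_Lambda0// addr0 => <-.
by congr G; apply/funext => t /=; rewrite addr0.
Qed.

Lemma linear_LambdaD G f g : linear_Lambda G -> Lam f -> Lam g ->
  G (f \+ g) = G f + G g.
Proof.
move=> GL Lf Lg; have := GL 1 _ _ Lf Lg; rewrite mul1r => <-.
by congr G; apply/funext => t /=; rewrite mul1r.
Qed.

(** By the Amemiya formula this amounts to [|G u| <= D] times the Orlicz norm of [u], but it is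
    expressed in terms of modulars. *)
Definition modular_bound G (D : R) : Prop := forall u (k r : R),
  L0 gamma u -> 0 < k -> (rho (k \*o u) <= r%:E)%E -> `|G u| <= D * (k^-1 * (1 + r)).

Lemma rho_le_ge0 u r : (rho u <= r%:E)%E -> 0 <= r.
Proof. by move=> h; rewrite -lee_fin (le_trans _ h)//; exact: (rho_ge0 Hw Nphi). Qed.

Lemma norm_le1_of_rho u (r : R) : L0 gamma u -> (rho ((1 + r) \*o u) <= r%:E)%E ->
  0 <= r -> (norm0 u <= 1)%E.
Proof.
move=> mu_ ru r0; have r1 : 0 < 1 + r by rewrite ltr_wpDr.
apply: (le_trans (orlicz_norm_le gamma_gt0 Hw Nphi mu_ r1)).
apply: (@le_trans _ _ ((1 + r)^-1%:E * (1 + r)%:E)%E).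
  by rewrite lee_pmul2l// ?lte_fin ?invr_gt0// EFinD leeD2l.
by rewrite -EFinM mulVf ?lt0r_neq0.
Qed.

(** Multiplication by [k / (1 + r)] brings [u] into the unit ball, by the easy half of the Amemiya
    formula. *)
Lemma modular_bound_of_norm G (D : R) : linear_Lambda G ->
  (forall f, Lam f -> (norm0 f <= 1)%E -> `|G f| <= D) -> modular_bound G D.
Proof.
move=> GL GD u k r mu_ k0 ru; have r0 := rho_le_ge0 ru.
have r1 : 0 < 1 + r by rewrite ltr_wpDr.
pose c := k / (1 + r); have c0 : 0 < c by exact: divr_gt0.
have Lu : Lam u by split=> //; exists k => //; exact: le_lt_trans ru (ltry _).
have E : (1 + r) \*o (c \*o u) = k \*o u.
  apply/funext => t /=; have := lt0r_neq0 r1; rewrite /c => rn.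
  by field.
have := GD _ (LambdaZ c Lu) _; rewrite linear_LambdaZ// normrM (gtr0_norm c0) => Gc.
have : c * `|G u| <= D.
  apply: Gc; apply: (@norm_le1_of_rho _ r); [exact: L0Z|rewrite E; exact: ru|exact: r0].
rewrite mulrC -ler_pdivlMr// /c invf_div => h.
by rewrite [X in _ * X]mulrC.
Qed.

Lemma rho_cst0_le : (rho (cst 0)%R <= 0%:E)%E.
Proof.
have -> : cst 0 = 0 \*o \1_set0 :> (R -> R).
  by apply/funext => t /=; rewrite mul0r.
apply: le_trans (rho_indic_le (lexx _) measurable0 (@sub0set _ _) _) _.
  by rewrite measure0 ltry.
by rewrite (N_function0 Nphi) mul0e.
Qed.

Lemma norm_le1_cst0 : (norm0 (cst 0)%R <= 1)%E.
Proof.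
apply: (@norm_le1_of_rho _ 0) => //; first exact: L0_cst0.
rewrite (_ : (1 + 0) \*o cst 0 = cst 0); first exact: rho_cst0_le.
by apply/funext => t /=; rewrite mulr0.
Qed.

Lemma orlicz_norm_ge0 f : L0 gamma f -> (0 <= norm0 f)%E.
Proof.
move=> mf; have H V : (norm0 f <= V%:E)%E -> 0 <= V.
  move=> fV; apply/ler_addgt0Pr => e e0.
  have [m m0 h] := amemiya gamma_gt0 Hw Nphi mf fV e0.
  rewrite -lee_fin (le_trans _ h)// mule_ge0 ?lee_fin ?(ltW m0)// adde_ge0//.
  exact: (rho_ge0 Hw Nphi).
case E : (norm0 f) => [V| |]//; first by rewrite lee_fin; apply: H; rewrite E.
by have := H (-1); rewrite E leNye => /(_ isT); rewrite oppr_ge0 ler10.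
Qed.

Lemma modular_lty f : (rho f < +oo)%E -> exists r, rho f = r%:E.
Proof.
move=> rf; exists (fine (rho f)); rewrite fineK// ge0_fin_numE//.
exact: (rho_ge0 Hw Nphi).
Qed.

Lemma amemiya_fin f (V e : R) : L0 gamma f -> (norm0 f <= V%:E)%E -> 0 < e ->
  exists m r, [/\ 0 < m, rho (m^-1 \*o f) = r%:E & m * (1 + r) <= V + e].
Proof.
move=> mf fV e0; have [m m0 h] := amemiya gamma_gt0 Hw Nphi mf fV e0.
have [|r rE] := @modular_lty (m^-1 \*o f).
  rewrite ltNge leye_eq; apply/negP => /eqP E.
  by move: h; rewrite E addey// gt0_muley ?lte_fin.
by exists m, r; split=> //; move: h; rewrite rE -EFinD -EFinM lee_fin.
Qed.

(** The converse passage, by scales [k = m^-1] that are nearly optimal in the Amemiya formula. *)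
Lemma norm_bound_of_modular (x D : R) f : Lam f -> 0 <= D ->
  (forall k r : R, 0 < k -> (rho (k \*o f) <= r%:E)%E -> x <= D * (k^-1 * (1 + r))) ->
  (x%:E <= D%:E * norm0 f)%E.
Proof.
move=> [mf [k k0 fk]] D0 H.
have Nfin : norm0 f \is a fin_num.
  rewrite ge0_fin_numE; last exact: orlicz_norm_ge0.
  apply: (le_lt_trans (orlicz_norm_le gamma_gt0 Hw Nphi mf k0)).
  by have [r ->] := modular_lty fk; rewrite -EFinD -EFinM ltry.
rewrite -(fineK Nfin) -EFinM lee_fin; set V := fine _.
have NV : (norm0 f <= V%:E)%E by rewrite fineK.
apply/ler_addgt0Pr => e e0; have D1 : 0 < D + 1 by rewrite ltr_wpDl.
have [m [r [m0 rE h]]] := amemiya_fin mf NV (divr_gt0 e0 D1).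
apply: (le_trans (H m^-1 r _ _)); [by rewrite invr_gt0|by rewrite rE|].
rewrite invrK; apply: (le_trans (ler_wpM2l D0 h)); rewrite mulrDr lerD2l.
by rewrite mulrA ler_pdivrMr// mulrC ler_wpM2l ?(ltW e0)// lerDl.
Qed.

Lemma dual_norm_fin G : dual_Lambda0 gamma phi w G ->
  exists2 D : R, 0 <= D & dual_norm gamma phi w G = D%:E.
Proof.
move=> [_ GL [C HC]].
have d0 : (0 <= dual_norm gamma phi w G)%E.
  apply: (@le_trans _ _ (`|G (cst 0)|%:E)).
    by rewrite linear_Lambda0// normr0.
  by apply: ereal_sup_ubound; exists (cst 0) => //; split; [exact: Lambda_cst0|exact: norm_le1_cst0].
have dC : (dual_norm gamma phi w G <= (Num.max C 0)%:E)%E.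
  apply: ge_ereal_sup => _ [f [Lf f1] <-]; apply: (le_trans (HC f Lf)).
  have N0 : (0 <= norm0 f)%E by apply: orlicz_norm_ge0; case: Lf.
  apply: (@le_trans _ _ ((Num.max C 0)%:E * norm0 f)%E).
    by apply: lee_wpmul2r => //; rewrite lee_fin le_max lexx.
  by rewrite -[leRHS]mule1 lee_wpmul2l// lee_fin le_max lexx orbT.
exists (fine (dual_norm gamma phi w G)); first exact: fine_ge0.
by rewrite fineK// ge0_fin_numE// (le_lt_trans dC)// ltry.
Qed.

Lemma dual_norm_ub G (D : R) f : dual_norm gamma phi w G = D%:E -> Lam f ->
  (norm0 f <= 1)%E -> `|G f| <= D.
Proof.
move=> GD Lf f1; rewrite -lee_fin -GD.
by apply: ereal_sup_ubound; exists f.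
Qed.

Lemma dual_modular_bound G (D : R) : dual_Lambda0 gamma phi w G ->
  dual_norm gamma phi w G = D%:E -> modular_bound G D.
Proof.
move=> [_ GL _] GD; apply: modular_bound_of_norm => // f; exact: dual_norm_ub.
Qed.

(** Modulars of indicators are at most [phi k * W (mu E)], which yields both local boundedness and,
    with [k] large, absolute continuity. *)
Lemma dual_local_density G : dual_Lambda0 gamma phi w G ->
  exists2 h, local_density gamma h & forall u, bounded_supp gamma u ->
    G u = \int[mu]_(t in dom gamma) (u t * h t).
Proof.
move=> dG; have [Gae GL _] := dG; have [D D0 GD] := dual_norm_fin dG.
have mb := dual_modular_bound dG GD.
have mcut m : measurable (dom gamma `&` [set t | t < m]) by exact: measurable_dom_lt_real.
have dom0 : dom gamma 0 by split.
apply: exists_local_density.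
- by move=> a u v bu bv; apply: GL; exact: Lambda_bounded_supp.
- move=> m; pose E := dom gamma `&` [set t | t < m%:R].
  have Ef : (mu E < +oo)%E by exact: mu_dom_lt_fin.
  have W0 := wint_ge0 Hw (mu E).
  pose B := phi 1 * fine (wint gamma w (mu E)).
  have B0 : 0 <= B by rewrite mulr_ge0 ?fine_ge0//; exact: (N_function_ge0 Nphi).
  exists (D * (1 + B)); first by rewrite mulr_ge0// addr_ge0.
  move=> u e mu_ ue; have e0 : 0 <= e by rewrite (le_trans (normr_ge0 _) (ue 0 dom0).1).
  have bu : bounded_supp gamma u by exact: bounded_supp_of_le ue.
  (* The scale [e^-1] is meaningless for [e = 0]; then [u] vanishes on the domain. *)
  have [e00|en0] := eqVneq e 0.
    rewrite (Gae u (cst 0)) ?linear_Lambda0 ?normr0 ?e00 ?mulr0//.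
    + exact: Lambda_bounded_supp.
    + exact: Lambda_cst0.
    + apply: aeW => t dt /=; apply/eqP; rewrite -normr_le0 -e00.
      by have [] := ue t dt.
  have egt0 : 0 < e by rewrite lt_def en0.
  have ei0 : 0 < e^-1 by rewrite invr_gt0.
  have := mb u e^-1 B mu_ ei0; rewrite invrK mulrCA [e * _]mulrC => -> //.
  have E1 : (rho (1 \*o \1_E) <= B%:E)%E.
    apply: (le_trans (rho_indic_le ler01 (mcut _) (@subIsetl _ _ _) Ef)).
    by rewrite EFinM fineK//; exact: (wint_fin gamma_gt0 Hw).
  apply: le_trans E1; apply: (le_rho gamma_gt0 Hw Nphi).
  + exact: L0Z.
  + by apply: L0Z; apply: measurable_indic; exact: mcut.
  + move=> t dt /=; have [u1 u2] := ue t dt; rewrite mul1r indicE normrM (gtr0_norm ei0).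
    case: (ltP t m%:R) => tm; last by rewrite u2// normr0 mulr0.
    by rewrite mem_set// normr1 mulrC ler_pdivrMr// mul1r.
- move=> m e e0; have D1 : 0 <= 2 * D / e by rewrite !mulr_ge0// invr_ge0 ltW.
  (* With modular at most 1 the bound is [2 * D / k], which this [k] brings below [e]; [d] is then
     chosen so that [phi k * W d] is at most 1. *)
  pose k := 2 * D / e + 1; have k0 : 0 < k by rewrite ltr_wpDl.
  have p0 : 0 <= phi k by apply: (N_function_ge0 Nphi); exact: ltW.
  have p1 : 0 < phi k + 1 by rewrite ltr_wpDl.
  have [d d0 Hd] := wint_small gamma_gt0 Hw (divr_gt0 ltr01 p1).
  exists d => // E mE Ed Em Emu.
  have Ef : (mu E < +oo)%E by exact: le_lt_trans Emu (ltry _).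
  have r1 : (rho (k \*o \1_E) <= 1%:E)%E.
    apply: (le_trans (rho_indic_le (ltW k0) mE Ed Ef)).
    apply: (@le_trans _ _ ((phi k)%:E * (1 / (phi k + 1))%:E)%E).
      by apply: lee_wpmul2l; [rewrite lee_fin|exact: Hd].
    by rewrite -EFinM lee_fin mul1r ler_pdivrMr// mul1r lerDl.
  have m1 : L0 gamma \1_E by exact: measurable_indic.
  have := mb \1_E k 1 m1 k0 r1; move/le_trans; apply.
  rewrite mulrCA ler_pdivrMl// /k [leRHS]mulrDl divfK ?lt0r_neq0//.
  by rewrite mul1r [leLHS]mulrC lerDl ltW.
Qed.

End dual_functionals.

(** * Truncation to large values or large arguments *)

Section tails.
Context {R : realType}.
Local Notation mu := (@lebesgue_measure R).
Variable gamma : \bar R.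
Implicit Types (f u h : R -> R) (A : set R).

Definition tail f (n : nat) : set R := [set t | n%:R < `|f t| \/ n%:R <= t].

Lemma measurable_tail f n : L0 gamma f -> measurable (dom gamma `&` tail f n).
Proof.
move=> mf; rewrite (_ : _ `&` _ = [set t | dom gamma t /\ n%:R < `|f t|] `|`
    (dom gamma `&` `[n%:R, +oo[)).
  apply: measurableU; first exact: measurable_distr_set.
  by apply: measurableI => //; exact: measurable_dom.
apply/seteqP; split=> t /=; rewrite in_itv/= andbT.
  by move=> [dt [h|h]]; [left|right].
by move=> [[dt h]|[dt h]]; split=> //; [left|right].
Qed.

Lemma tail_ni f : {homo tail f : m n / (m <= n)%N >-> n `<=` m}.
Proof.
move=> m n mn t; have mn' : m%:R <= n%:R :> R by rewrite ler_nat.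
by case=> h; [left; exact: le_lt_trans h|right; exact: le_trans h].
Qed.

Lemma tail_out f t : exists n, ~ tail f n t.
Proof.
have [n Hn] := exists_nat_ge (`|f t| + `|t| + 1); exists n.
have := normr_ge0 (f t); have := normr_ge0 t; have := ler_norm t.
by move=> h1 h2 h3 [h|h]; lra.
Qed.

Lemma measurable_dom_setC A : measurable (dom gamma `&` A) ->
  measurable (dom gamma `&` ~` A).
Proof.
move=> mA; rewrite -setDE (_ : _ `\` _ = dom gamma `\` (dom gamma `&` A)).
  by apply: measurableD => //; exact: measurable_dom.
by apply/seteqP; split=> t [dt nA]; split=> // At; apply: nA; [case: At|].
Qed.

Lemma indic_setC A (t : R) : \1_(~` A) t + \1_A t = 1 :> R.
Proof. by rewrite !indicE in_setC; case: (t \in A); rewrite ?add0r ?addr0. Qed.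

Lemma split_indic f A : f = (fun t => f t * \1_(~` A) t) \+ (fun t => f t * \1_A t).
Proof. by apply/funext => t /=; rewrite -mulrDr indic_setC mulr1. Qed.

Lemma norm_mul_indic_le f A t : `|f t * \1_A t| <= `|f t|.
Proof.
by rewrite indicE; case: (_ \in _); rewrite ?mulr1// mulr0 normr0.
Qed.

Lemma bounded_supp_tailC f n : L0 gamma f ->
  bounded_supp gamma (fun t => f t * \1_(~` tail f n) t).
Proof.
move=> mf; split.
  by apply: L0_indic => //; apply: measurable_dom_setC; exact: measurable_tail.
exists n => t dt; have [Tt|nT] := pselect (tail f n t).
  by rewrite indicE memNset ?mulr0 ?normr0// => /(_ Tt).
rewrite indicE mem_set// mulr1; split.
  by rewrite leNgt; apply/negP => h; apply: nT; left.
by move=> h; exfalso; apply: nT; right.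
Qed.

(** The sign is taken to be 1 where [h] vanishes, so multiplying by it never changes an absolute
    value, nor therefore a modular. *)
Lemma exists_sign h : L0 gamma h -> exists2 s, L0 gamma s &
  forall t, dom gamma t -> `|s t| = 1 /\ s t * h t = `|h t|.
Proof.
move=> mh; pose N := [set t | dom gamma t /\ 0 < - h t].
have mN : measurable N.
  by apply: measurable_super_level; exact: measurable_funN.
exists (fun t => 1 - 2 * \1_N t).
  apply: measurable_funB; first exact: measurable_cst.
  by apply: measurable_funM; [exact: measurable_cst|exact: measurable_indic].
move=> t dt; rewrite indicE; case: (ltP 0 (- h t)) => h0.
  have -> : t \in N by apply: mem_set.
  rewrite mulr1 (_ : 1 - 2 = -1); last by lra.
  by rewrite normrN1 mulN1r ltr0_norm// -oppr_gt0.
have -> : t \in N = false by apply: memNset => -[_]; rewrite ltNge h0.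
by rewrite mulr0 subr0 normr1 mul1r ger0_norm// -oppr_le0.
Qed.

End tails.

(** * The integral part and the singular part *)

Section decomposition.
Context {R : realType}.
Local Notation mu := (@lebesgue_measure R).
Variables (gamma : \bar R) (phi w : R -> R).
Hypotheses (gamma_gt0 : (0 < gamma)%E) (Hw : weight gamma w).
Hypothesis Nphi : N_function phi.
Implicit Types (f g u v y : R -> R) (A : set R).

Local Notation rho := (rho gamma phi w).
Local Notation Lam := (Lambda gamma phi w).
Local Notation norm0 := (orlicz_norm gamma phi w).
Local Notation dnorm := (dual_norm gamma phi w).

Definition integral_functional h f : R := \int[mu]_(t in dom gamma) (f t * h t).

Definition singular_functional (F : (R -> R) -> R) h f : R :=
  F f - integral_functional h f.

Variables (F : (R -> R) -> R) (h : R -> R).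
Hypotheses (dF : dual_Lambda0 gamma phi w F) (lh : local_density gamma h).
Local Notation H := (integral_functional h).
Local Notation S := (singular_functional F h).
Hypothesis FH : forall u, bounded_supp gamma u -> F u = H u.

Let md : measurable (dom gamma). Proof. exact: measurable_dom. Qed.

Let FL : linear_Lambda gamma phi w F. Proof. by case: dF. Qed.

Lemma Lambda_indic f A : Lam f -> measurable (dom gamma `&` A) ->
  Lam (fun t => f t * \1_A t).
Proof.
move=> Lf mA; apply: (Lambda_of_le gamma_gt0 Hw Nphi _ Lf).
  by apply: L0_indic => //; case: Lf.
by move=> t _; exact: norm_mul_indic_le.
Qed.

(** The bound for [F] is applied to truncations of [|f|] carrying the sign of [h], where [F] is
    already an integral; monotone convergence removes the truncation. *)
Lemma integral_abs_le (D : R) f (k r : R) : modular_bound gamma phi w F D ->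
  L0 gamma f -> 0 < k -> (rho (k \*o f) <= r%:E)%E ->
  (\int[mu]_(t in dom gamma) (`|f t * h t|)%:E <= (D * (k^-1 * (1 + r)))%:E)%E.
Proof.
move=> mb mf k0 rf; have mh : L0 gamma h := lh.1.
have [s ms sh] := exists_sign mh.
pose y n t := s t * (`|f t| * \1_(~` tail f n) t).
have mC n : measurable (dom gamma `&` ~` tail f n).
  by apply: measurable_dom_setC; exact: measurable_tail.
have my n : L0 gamma (y n).
  by apply: measurable_funM => //; apply: L0_indic => //; exact: L0_norm.
have yf n t : dom gamma t -> `|y n t| = `|f t * \1_(~` tail f n) t|.
  by move=> dt; rewrite !normrM (sh t dt).1 mul1r normr_id.
have by_ n : bounded_supp gamma (y n).
  apply: (bounded_supp_le (bounded_supp_tailC n mf) (my n)) => t dt.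
  by rewrite yf.
have yh n t : dom gamma t -> y n t * h t = `|f t * h t| * \1_(~` tail f n) t.
  by move=> dt; rewrite /y mulrAC (sh t dt).2 mulrA -normrM [h t * f t]mulrC.
apply: (@monotone_convergence_le R _
    (fun n t => (`|f t * h t| * \1_(~` tail f n) t)%:E)) => //.
- move=> n; apply/measurable_EFinP; apply: L0_indic => //.
  by apply: L0_norm; exact: measurable_funM.
- by move=> t _ m n mn; rewrite lee_fin ler_wpM2l// !indicE ler_nat;
     have [Tt|nT] := pselect ((~` tail f m) t); [
       rewrite !mem_set// => /(tail_ni mn)
     | rewrite (memNset nT)].
- move=> t dt; have [n0 nT] := tail_out f t.
  apply: cvg_near_cst; near=> n.
  rewrite indicE mem_set ?mulr1// => Tn; apply: nT; apply: tail_ni Tn.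
  by near: n; exact: nbhs_infty_ge.
- move=> n; have iy := bounded_supp_integrable lh (by_ n).
  rewrite (_ : (\int[mu]_(t in _) _)%E = (F (y n))%:E); last first.
    rewrite FH// /integral_functional -(EFin_Rintegral_mu md iy).
    by apply: eq_integral => t /set_mem dt; rewrite yh.
  rewrite lee_fin (le_trans (ler_norm _))//; apply: (mb _ k r (my n) k0).
  apply: le_trans rf; apply: (le_rho gamma_gt0 Hw Nphi); [exact: L0Z|exact: L0Z|].
  move=> t dt; rewrite [leLHS]normrM [leRHS]normrM ler_wpM2l// yf//.
  exact: norm_mul_indic_le.
Unshelve. all: by end_near. Qed.

Lemma integrable_Lambda f : Lam f ->
  mu.-integrable (dom gamma) (EFin \o (fun t => f t * h t)).
Proof.
move=> [mf [k k0 rf]]; have [D D0 FD] := dual_norm_fin gamma_gt0 Hw Nphi dF.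
have mb := dual_modular_bound gamma_gt0 Hw Nphi dF FD.
have [r rE] := modular_lty Hw Nphi rf.
apply/integrableP; split.
  by apply/measurable_EFinP; apply: measurable_funM => //; exact: lh.1.
apply: le_lt_trans (integral_abs_le mb mf k0 _) (ltry _).
by rewrite rE.
Qed.

Lemma integral_functional_linear : linear_Lambda gamma phi w H.
Proof.
move=> a f g Lf Lg; have fi := integrable_Lambda Lf; have gi := integrable_Lambda Lg.
rewrite /integral_functional -(RintegralZ_mu a md fi).
rewrite -(RintegralD_mu md (integrableZ_mu a md fi) gi).
by apply: eq_Rintegral => t _ /=; ring.
Qed.

Lemma integral_functional_modular (D : R) : modular_bound gamma phi w F D ->
  modular_bound gamma phi w H D.
Proof.
move=> mb f k r mf k0 rf.
have Lf : Lam f.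
  by split; [exact: mf|exists k; [exact: k0|exact: le_lt_trans rf (ltry _)]].
have fi := integrable_Lambda Lf.
apply: (le_trans (le_normr_Rintegral_mu md fi)).
have ai : mu.-integrable (dom gamma) (EFin \o (fun t => `|f t * h t|)).
  exact: (integrable_norm fi).
by rewrite -lee_fin -(EFin_Rintegral_mu md ai); exact: integral_abs_le.
Qed.

Lemma singular_functional_linear : linear_Lambda gamma phi w S.
Proof.
move=> a f g Lf Lg; rewrite /singular_functional FL// integral_functional_linear//.
by ring.
Qed.

Lemma dual_of_modular G (D : R) : 0 <= D ->
  (forall f g, Lam f -> Lam g -> f = g %[ae mu in dom gamma] -> G f = G g) ->
  linear_Lambda gamma phi w G -> modular_bound gamma phi w G D ->
  dual_Lambda0 gamma phi w G.
Proof.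
move=> D0 Gae GL mb; split=> //; exists D => f Lf.
apply: (norm_bound_of_modular gamma_gt0 Hw Nphi Lf D0) => k r k0 rf.
by apply: mb => //; case: Lf.
Qed.

Lemma integral_functional_ae f g : Lam f -> Lam g ->
  f = g %[ae mu in dom gamma] -> H f = H g.
Proof.
move=> [mf _] [mg _] fg; rewrite /integral_functional /Rintegral; congr fine.
apply: ae_eq_integral => //.
- by apply/measurable_EFinP; apply: measurable_funM => //; exact: lh.1.
- by apply/measurable_EFinP; apply: measurable_funM => //; exact: lh.1.
- by apply: ae_imply fg => t fgt dt; rewrite fgt.
Qed.

Lemma integral_functional_dual : dual_Lambda0 gamma phi w H.
Proof.
have [D D0 FD] := dual_norm_fin gamma_gt0 Hw Nphi dF.
have mb := dual_modular_bound gamma_gt0 Hw Nphi dF FD.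
apply: (dual_of_modular D0).
- exact: integral_functional_ae.
- exact: integral_functional_linear.
- exact: integral_functional_modular.
Qed.

Lemma singular_functional_dual : dual_Lambda0 gamma phi w S.
Proof.
have [D D0 FD] := dual_norm_fin gamma_gt0 Hw Nphi dF.
have mb := dual_modular_bound gamma_gt0 Hw Nphi dF FD.
apply: (@dual_of_modular _ (D + D)); first exact: addr_ge0.
- move=> f g Lf Lg fg; rewrite /singular_functional (integral_functional_ae Lf Lg fg).
  by case: dF => Fae _ _; rewrite (Fae f g).
- exact: singular_functional_linear.
- move=> f k r mf k0 rf; rewrite mulrDl (le_trans (ler_normB _ _))//.
  by apply: lerD; [exact: mb|exact: integral_functional_modular].
Qed.

Lemma singular_bounded_supp u : bounded_supp gamma u -> S u = 0.
Proof. by move=> bu; rewrite /singular_functional FH// subrr. Qed.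

Lemma singular_tail f n : Lam f -> S f = S (fun t => f t * \1_(tail f n) t).
Proof.
move=> Lf; have mf : L0 gamma f by case: Lf.
have bt := bounded_supp_tailC n mf.
rewrite {1}(split_indic f (tail f n)) (linear_LambdaD singular_functional_linear).
- by rewrite singular_bounded_supp// add0r.
- exact: (Lambda_bounded_supp gamma_gt0 Hw Nphi).
- by apply: Lambda_indic => //; exact: measurable_tail.
Qed.

Lemma rho_tail f (e : R) : L0 gamma f -> (rho f < +oo)%E -> 0 < e ->
  \forall n \near \oo, (rho (fun t => f t * \1_(tail f n) t)%R <= e%:E)%E.
Proof.
move=> mf rf e0; apply: cvge0_le => //.
apply: (rho_shrink gamma_gt0 Hw Nphi) => //.
- by move=> n; exact: measurable_tail.
- exact: tail_ni.
- by move=> t _; exact: tail_out.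
Qed.

Lemma mul1o f : 1 \*o f = f.
Proof. by apply/funext => t /=; rewrite mul1r. Qed.

(** No smallness of the modular is assumed: on the tail it is below any positive number, and scale 1
    in the modular bound leaves [D] times a factor close to 1. *)
Lemma singular_le (D : R) f : dnorm S = D%:E -> 0 <= D -> L0 gamma f ->
  (rho f < +oo)%E -> `|S f| <= D.
Proof.
move=> SD D0 mf rf.
have mb := dual_modular_bound gamma_gt0 Hw Nphi singular_functional_dual SD.
have Lf := Lambda_rho mf rf.
apply/ler_addgt0Pr => e e0; have D1 : 0 < D + 1 by rewrite ltr_wpDl.
have e1 : 0 < e / (D + 1) by exact: divr_gt0.
have [n _ Hn] := rho_tail mf rf e1.
rewrite (singular_tail n Lf).
have := mb (fun t => f t * \1_(tail f n) t) 1 (e / (D + 1)) _ ltr01.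
rewrite mul1o invr1 mul1r => /(_ _ (Hn n (leqnn n))).
have mt : L0 gamma (fun t => f t * \1_(tail f n) t).
  by apply: L0_indic => //; exact: measurable_tail.
move=> /(_ mt)/le_trans; apply; rewrite mulrDr mulr1 lerD2l mulrA ler_pdivrMr//.
by rewrite mulrC ler_wpM2l ?(ltW e0)// lerDl.
Qed.

(** Order continuity is applied to [|f|] restricted to its tails: their Luxemburg norms tend to 0,
    while [S f] is unaffected by the restriction. *)
Lemma singular_Lambda_a f : Lambda_a gamma phi w f -> S f = 0.
Proof.
move=> [Lf fa]; have mf : L0 gamma f by case: Lf.
pose fn n t := `|f t| * \1_(tail f n) t.
have mt n : measurable (dom gamma `&` tail f n) by exact: measurable_tail.
have mfn n : L0 gamma (fn n) by apply: L0_indic => //; exact: L0_norm.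
have indle m n t : (m <= n)%N -> \1_(tail f n) t <= \1_(tail f m) t :> R.
  move=> mn; rewrite !indicE ler_nat; have [Tt|nT] := pselect (tail f n t); last first.
    by rewrite (memNset nT).
  by rewrite !mem_set//; exact: tail_ni mn _ Tt.
have [_ lux0] : nonincreasing_seq (fun n => luxemburg_norm gamma phi w (fn n)) /\
    (luxemburg_norm gamma phi w (fn n) @[n --> \oo] --> 0%E).
  apply: fa => //; apply: aeW => t dt; split.
  - move=> n; rewrite /fn mulr_ge0//= indicE; case: (_ \in _); rewrite ?mulr1//.
    by rewrite mulr0.
  - by move=> m n mn; rewrite ler_wpM2l// indle.
  - have [n0 nT] := tail_out f t; apply: cvg_near_cst; near=> n.
    rewrite /fn indicE memNset ?mulr0// => Tn; apply: nT; apply: tail_ni Tn.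
    by near: n; exact: nbhs_infty_ge.
have [D D0 SD] := dual_norm_fin gamma_gt0 Hw Nphi singular_functional_dual.
have mb := dual_modular_bound gamma_gt0 Hw Nphi singular_functional_dual SD.
apply/eqP; rewrite -normr_le0; apply/ler_addgt0Pr => e e0; rewrite add0r.
have D1 : 0 < 2 * D + 1 by rewrite ltr_wpDl// mulr_ge0.
(* Modular at most 1 at scale [eps^-1] gives the bound [2 * D * eps]; the last factor 1/2 provides
   the strict inequality needed to extract [eps] from the infimum. *)
have e1 : 0 < e / (2 * D + 1) / 2 by rewrite !divr_gt0.
have [n _ Hn] := cvge0_le lux0 e1.
have : (luxemburg_norm gamma phi w (fn n) < (e / (2 * D + 1))%:E)%E.
  apply: (le_lt_trans (Hn n (leqnn n))); rewrite lte_fin.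
  by rewrite ltr_pdivrMr// ltr_pMr ?divr_gt0// ltr1n.
move=> /ereal_inf_lt[_ [eps [eps0 reps] <-]]; rewrite lte_fin => epse.
have epsV : 0 < eps^-1 by rewrite invr_gt0.
rewrite (singular_tail n Lf).
have mft : L0 gamma (fun t => f t * \1_(tail f n) t) by exact: L0_indic.
have := mb _ eps^-1 1 mft epsV.
rewrite invrK (@rho_eq _ _ _ _ _ (eps^-1 \*o fn n)); last first.
  by move=> t _ /=; rewrite !normrM normr_id.
move=> /(_ reps)/le_trans; apply.
have : eps * (2 * D + 1) <= e by rewrite -ler_pdivlMr// ltW.
lra.
Unshelve. all: by end_near. Qed.

Lemma integral_functional_shrink y (C : nat -> set R) (e : R) : Lam y ->
  (forall n, measurable (dom gamma `&` C n)) ->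
  {homo C : m n / (m <= n)%N >-> n `<=` m} ->
  (forall t, dom gamma t -> exists n, ~ C n t) -> 0 < e ->
  \forall n \near \oo, `|H (fun t => y t * \1_(C n) t)| <= e.
Proof.
move=> Ly mC Cni Cout e0; have my : L0 gamma y by case: Ly.
have iy := integrable_Lambda Ly.
have mh : L0 gamma h := lh.1.
pose a n t := `|y t * \1_(C n) t * h t|.
have iyn n : mu.-integrable (dom gamma) (EFin \o (fun t => y t * \1_(C n) t * h t)).
  by apply: integrable_Lambda; exact: Lambda_indic.
have ian n : mu.-integrable (dom gamma) (EFin \o a n) by exact: (integrable_norm (iyn n)).
have ma n : measurable_fun (dom gamma) (EFin \o a n).
  exact: (@measurable_int _ _ _ mu).
have iay : mu.-integrable (dom gamma) (EFin \o (fun t => `|y t * h t|)).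
  exact: (integrable_norm iy).
have cv : (\int[mu]_(t in dom gamma) (EFin \o a n) t)%E @[n --> \oo] --> 0%E.
  have -> : 0%E = (\int[mu]_(t in dom gamma) cst 0%E t)%E :> \bar R by rewrite integral0.
  apply: (@dominated_cvg _ _ _ mu _ md (fun n => EFin \o a n) (cst 0%E)
    (EFin \o (fun t => `|y t * h t|)) ma).
  - move=> t dt; have [n0 nC] := Cout t dt; apply: cvg_near_cst; near=> n.
    rewrite /a /= indicE memNset ?mulr0 ?mul0r ?normr0// => Cn; apply: nC.
    by apply: Cni Cn; near: n; exact: nbhs_infty_ge.
  - by [].
  - exact: iay.
  - move=> n t dt; rewrite /= lee_fin normr_id mulrAC.
    by rewrite indicE; case: (_ \in _); rewrite ?mulr1// mulr0 normr0.
near=> n; apply: (le_trans (le_normr_Rintegral_mu md (iyn n))).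
rewrite -lee_fin -(EFin_Rintegral_mu md (ian n)).
by near: n; exact: cvge0_le.
Unshelve. all: by end_near. Qed.

(** A pointwise limit of the discretized maxima, which avoids a case distinction on the zeros of
    [v]. *)
Lemma measurable_P_integrand g v : L0 gamma g -> L0 gamma v ->
  (forall t, dom gamma t -> 0 <= v t) ->
  measurable_fun (dom gamma) (fun t => P_integrand (complementary phi) (g t) (v t)).
Proof.
move=> mg mv v0.
apply: (@emeasurable_fun_cvg _ _ _ _ (fun n t => (young_max phi (g t) (v t) n)%:E)).
  move=> n; have ma := measurable_young_argmax Nphi n md mg mv.
  apply/measurable_EFinP; apply: measurable_funB; apply: measurable_funM => //.
  - exact: L0_norm.
  - apply: (measurable_N_function_comp Nphi md ma) => t _.
    exact: young_argmax_ge0.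
by move=> t dt; exact: (@cvg_young_max _ _ Nphi (g t) _ (v0 t dt)).
Qed.

Lemma integral_mul_le_young u g v (r p : R) : L0 gamma u -> L0 gamma g ->
  L0 gamma v -> (forall t, dom gamma t -> 0 <= v t) -> submaj gamma v w ->
  (rho u <= r%:E)%E ->
  (\int[mu]_(t in dom gamma) P_integrand (complementary phi) (g t) (v t) <= p%:E)%E ->
  (\int[mu]_(t in dom gamma) (`|u t * g t|)%:E <= (r + p)%:E)%E.
Proof.
move=> mu_ mg mv v0 vw ur gp.
have mp : L0 gamma (fun t => phi `|u t| * v t).
  by apply: measurable_funM => //; exact: measurable_phi_norm.
have mP := measurable_P_integrand mg mv v0.
have P0 t : dom gamma t -> (0 <= P_integrand (complementary phi) (g t) (v t))%E.
  by move=> dt; apply: (P_integrand_ge0 Nphi); exact: v0.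
have p0 t : dom gamma t -> (0 <= (phi `|u t| * v t)%:E)%E.
  by move=> dt; rewrite lee_fin mulr_ge0 ?v0//; exact: (N_function_ge0 Nphi).
apply: (@le_trans _ _ (\int[mu]_(t in dom gamma) ((phi `|u t| * v t)%:E +
    P_integrand (complementary phi) (g t) (v t)))%E).
  apply: ge0_le_integral => //.
  - by apply/measurable_EFinP; apply: L0_norm; exact: measurable_funM.
  - by apply: emeasurable_funD => //; apply/measurable_EFinP.
  - by move=> t dt; rewrite normrM; apply: (P_integrand_young Nphi) => //; exact: v0.
rewrite ge0_integralD//; last exact/measurable_EFinP.
rewrite EFinD; apply: leeD => //.
exact: le_trans (integral_le_rho gamma_gt0 Hw Nphi mu_ mv v0 vw) ur.
Qed.

Lemma norm_integral_le (l p r : R) u : 0 < l ->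
  (P gamma (complementary phi) w (l^-1 \*o h) <= p%:E)%E -> L0 gamma u ->
  (rho u <= r%:E)%E -> `|H u| <= l * (r + p).
Proof.
move=> l0 hp mu_ ur.
have Lu : Lam u by apply: Lambda_rho => //; exact: le_lt_trans ur (ltry _).
have iu := integrable_Lambda Lu.
apply/ler_addgt0Pr => e e0; have e1 : 0 < e / l by exact: divr_gt0.
have : (P gamma (complementary phi) w (l^-1 \*o h) < (p + e / l)%:E)%E.
  by apply: (le_lt_trans hp); rewrite lte_fin ltrDl.
move=> /ereal_inf_lt[_ [v [mv v0 vw] <-]] /ltW vp.
have mg : L0 gamma (l^-1 \*o h) by apply: L0Z; exact: lh.1.
have := integral_mul_le_young mu_ mg mv v0 vw ur vp.
have il : mu.-integrable (dom gamma) (EFin \o (fun t => l^-1 * `|u t * h t|)).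
  by apply: integrableZ_mu => //; exact: (integrable_norm iu).
rewrite (_ : (\int[mu]_(t in _) _)%E = (l^-1 * \int[mu]_(t in dom gamma) `|u t * h t|)%:E); last first.
  rewrite -(RintegralZ_mu _ md (integrable_norm iu)) -(EFin_Rintegral_mu md il).
  apply: eq_integral => t _ /=.
  by rewrite mulrCA normrM ger0_norm// invr_ge0 ltW.
rewrite lee_fin mulrC ler_pdivrMr// => hI.
apply: (le_trans (le_normr_Rintegral_mu md iu)); apply: (le_trans hI).
rewrite addrA mulrDl divfK ?lt0r_neq0//.
by rewrite [l * _]mulrC.
Qed.

Lemma dual_norm_le (D l : R) : dnorm S = D%:E -> 0 <= D -> 0 < l ->
  (P gamma (complementary phi) w (l^-1 \*o h) + (l^-1)%:E * dnorm S <= 1)%E ->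
  (dnorm F <= l%:E)%E.
Proof.
move=> SD D0 l0; rewrite SD -EFinM => hP.
have hp : (P gamma (complementary phi) w (l^-1 \*o h) <= (1 - l^-1 * D)%:E)%E.
  by rewrite EFinB leeBrDr.
apply: ge_ereal_sup => _ [f [Lf f1] <-]; rewrite lee_fin.
have mf : L0 gamma f by case: Lf.
apply/ler_addgt0Pr => e e0; have e1 : 0 < e / l by exact: divr_gt0.
have [m [r [m0 rE hm]]] := amemiya_fin gamma_gt0 Hw Nphi mf f1 e1.
have rf : (rho (m^-1 \*o f) < +oo)%E by rewrite rE ltry.
have mu_ : L0 gamma (m^-1 \*o f) by exact: L0Z.
have Hu : `|H (m^-1 \*o f)| <= l * (r + (1 - l^-1 * D)).
  by apply: (norm_integral_le l0 hp mu_); rewrite rE.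
have Su : `|S (m^-1 \*o f)| <= D by exact: singular_le.
have Fu : F (m^-1 \*o f) = H (m^-1 \*o f) + S (m^-1 \*o f).
  by rewrite /singular_functional addrC subrK.
have : `|F (m^-1 \*o f)| <= l * (1 + r).
  rewrite Fu (le_trans (ler_normD _ _))// (le_trans (lerD Hu Su))//.
  rewrite mulrDr mulrBr mulr1 mulrA divff ?lt0r_neq0// mul1r.
  by lra.
rewrite (linear_LambdaZ gamma_gt0 Hw Nphi _ FL Lf) normrM ger0_norm ?invr_ge0 ?(ltW m0)//.
rewrite mulrC ler_pdivrMr// => /le_trans; apply.
rewrite -mulrA [_ * m]mulrC.
apply: (le_trans (ler_wpM2l (ltW l0) hm)).
by rewrite mulrDr mulr1 mulrCA divff ?mulr1 ?lt0r_neq0.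
Qed.

Lemma orlicz_norm_eq f g : (forall t, dom gamma t -> `|f t| = `|g t|) ->
  norm0 f = norm0 g.
Proof.
move=> fg; rewrite /orlicz_norm (_ : rearr gamma f = rearr gamma g)//.
by apply/funext => t; exact: rearr_eq.
Qed.

(* Outside the sets [tail g n] replace [g] by [f]: this does not affect [S] and
   makes the modular of the sum arbitrarily close to that of [f]. *)
Lemma functional_add_singular_le (D r : R) f g : dnorm F = D%:E -> 0 <= D ->
  bounded_supp gamma f -> (rho f <= r%:E)%E -> Lam g -> (rho g < +oo)%E ->
  F f + S g <= D * (1 + r).
Proof.
move=> FD D0 bf fr Lg rg; have mf : L0 gamma f by case: bf.
have mg : L0 gamma g by case: Lg.
have mb := dual_modular_bound gamma_gt0 Hw Nphi dF FD.
have Lf := Lambda_bounded_supp gamma_gt0 Hw Nphi bf.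
have mt n : measurable (dom gamma `&` tail g n) by exact: measurable_tail.
have to t : dom gamma t -> exists n, ~ tail g n t by move=> _; exact: tail_out.
apply/ler_addgt0Pr => e e0; have D1 : 0 < D + 2 by rewrite ltr_wpDl.
(* One [D * d] pays for the modular of the tail of [g], and [d] twice for the integrals of [f] and
   of [g] against [h] over the tail. *)
pose d := e / (D + 2); have d0 : 0 < d by exact: divr_gt0.
suff : F f + S g <= D * (1 + r) + (D + 2) * d.
  by rewrite /d mulrCA divff ?mulr1 ?lt0r_neq0.
have [n1 _ N1] := rho_tail mg rg d0.
have [n2 _ N2] := integral_functional_shrink Lf mt (@tail_ni R g) to d0.
have [n3 _ N3] := integral_functional_shrink Lg mt (@tail_ni R g) to d0.
pose n := (n1 + n2 + n3)%N.
have {}N1 := N1 n (leq_trans (leq_addr n2 n1) (leq_addr n3 _)).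
have {}N2 := N2 n (leq_trans (leq_addl n1 n2) (leq_addr n3 _)).
have {}N3 := N3 n (leq_addl _ n3).
pose A := tail g n.
have mC : measurable (dom gamma `&` ~` A) by exact: (measurable_dom_setC (mt n)).
pose f1 t := f t * \1_(~` A) t; pose f2 t := f t * \1_A t; pose g2 t := g t * \1_A t.
have Lf1 : Lam f1 by exact: Lambda_indic.
have Lf2 : Lam f2 by exact: (Lambda_indic Lf (mt n)).
have Lg2 : Lam g2 by exact: (Lambda_indic Lg (mt n)).
have mf1 : L0 gamma f1 by case: Lf1.
have mg2 : L0 gamma g2 by case: Lg2.
have rk : (rho (f1 \+ g2)%R <= (r + d)%:E)%E.
  apply: (le_trans (rho_disjoint gamma_gt0 Hw Nphi mf1 mg2 _)).
    move=> t _; rewrite /f1 /g2 !indicE in_setC; case: (t \in A) => /=.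
      by left; rewrite mulr0.
    by right; rewrite mulr0.
  rewrite EFinD; apply: leeD; last exact: N1.
  apply: le_trans fr; apply: (le_rho gamma_gt0 Hw Nphi mf1 mf) => t _.
  exact: norm_mul_indic_le.
have := mb (f1 \+ g2) 1 (r + d) (measurable_funD mf1 mg2) ltr01.
rewrite mul1o invr1 mul1r => /(_ rk).
rewrite (linear_LambdaD FL)// => Fk.
have Hf : H f = H f1 + H f2.
  by rewrite -(linear_LambdaD integral_functional_linear)// -split_indic.
have Ff1 : F f1 = H f1.
  apply: FH; apply: (bounded_supp_le bf mf1) => t _; exact: norm_mul_indic_le.
have Fg2 : F g2 = H g2 + S g.
  by rewrite (singular_tail n Lg) /singular_functional addrC subrK.
rewrite FH// Hf; move: Fk; rewrite Ff1 Fg2 => Fk.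
have := le_trans (ler_norm _) Fk.
have := le_trans (ler_norm _) N2.
have : - H g2 <= d by rewrite (le_trans _ N3)// -normrN ler_norm.
rewrite -/f2; lra.
Qed.

(** For [g] in the unit ball the Amemiya formula gives finite modular at scales [m <= 1 + d], hence
    for [g / (1 + d)]; [d] is then made small. Replacing [g] by its opposite gives the absolute
    value. *)
Lemma functional_add_dual_norm_le (D DS r : R) f : dnorm F = D%:E -> 0 <= D ->
  dnorm S = DS%:E -> bounded_supp gamma f -> (rho f <= r%:E)%E ->
  F f + DS <= D * (1 + r).
Proof.
move=> FD D0 SD bf fr.
have key g : Lam g -> (norm0 g <= 1)%E -> S g <= D * (1 + r) - F f.
  move=> Lg g1; have mg : L0 gamma g by case: Lg.
  set X := D * (1 + r) - F f.
  apply/ler_addgt0Pr => e e0; have X1 : 0 < `|X| + 1 by rewrite ltr_wpDl.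
  (* The factor [1 + d] multiplies the bound [X], whose sign is unknown; this keeps the excess below
     [e]. *)
  pose d := e / (`|X| + 1); have d0 : 0 < d by exact: divr_gt0.
  have d1 : 0 < 1 + d by rewrite ltr_wpDl.
  have [m [q [m0 qE hm]]] := amemiya_fin gamma_gt0 Hw Nphi mg g1 d0.
  have rf : (rho (m^-1 \*o g) < +oo)%E by rewrite qE ltry.
  have q0 : 0 <= q by apply: (rho_le_ge0 Hw Nphi (u := m^-1 \*o g)); rewrite qE.
  have md1 : m <= 1 + d.
    by apply: le_trans hm; rewrite mulrDr mulr1 lerDl mulr_ge0// ltW.
  have ru : (rho ((1 + d)^-1 \*o g) < +oo)%E.
    apply: (rho_lty_le gamma_gt0 Hw Nphi _ _ _ rf); [exact: L0Z|exact: L0Z|].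
    move=> t dt /=; rewrite !normrM ler_wpM2r// !ger0_norm ?invr_ge0 ?(ltW m0) ?(ltW d1)//.
    by rewrite lef_pV2.
  have := functional_add_singular_le FD D0 bf fr (LambdaZ gamma_gt0 Hw Nphi _ Lg) ru.
  rewrite (linear_LambdaZ gamma_gt0 Hw Nphi _ singular_functional_linear Lg).
  rewrite -lerBrDl -/X mulrC ler_pdivrMr// => /le_trans; apply.
  rewrite mulrDr mulr1 lerD2l /d mulrA ler_pdivrMr// mulrC ler_wpM2l ?(ltW e0)//.
  by rewrite (le_trans (ler_norm _))// lerDl.
rewrite -lerBrDl -lee_fin -SD; apply: ge_ereal_sup => _ [g [Lg g1] <-].
rewrite lee_fin ler_norml key// andbT lerNl.
rewrite -mulN1r -(linear_LambdaZ gamma_gt0 Hw Nphi _ singular_functional_linear Lg).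
apply: key; first exact: LambdaZ.
by rewrite (@orlicz_norm_eq _ g)// => t _ /=; rewrite mulN1r normrN.
Qed.

(** Any positive [l >= D] is allowed, because the norm [D] may be 0 and can then only be approached
    from above. *)
Lemma P_add_le (D DS l : R) : dnorm F = D%:E -> 0 <= D -> dnorm S = DS%:E ->
  D <= l -> 0 < l ->
  (P gamma (complementary phi) w (l^-1 \*o h) + (l^-1)%:E * dnorm S <= 1)%E.
Proof.
move=> FD D0 SD Dl l0; rewrite SD -EFinM -leeBrDr// -EFinB.
have li0 : 0 <= l^-1 by rewrite invr_ge0 ltW.
have mh : L0 gamma h := lh.1.
have lh' : local_density gamma (l^-1 \*o h).
  split; first exact: L0Z.
  by move=> m; apply: integrableZ_mu; [exact: measurable_dom_lt_real|exact: lh.2].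
apply: (P_le_of_minimax gamma_gt0 Hw Nphi lh').
  have r0 := rho_cst0_le gamma_gt0 Hw Nphi.
  have := functional_add_dual_norm_le FD D0 SD (bounded_supp_cst0 gamma) r0.
  rewrite (linear_Lambda0 gamma_gt0 Hw Nphi FL) add0r addr0 mulr1 => DSD.
  by rewrite subr_ge0 mulrC ler_pdivrMr// mul1r (le_trans DSD).
move=> f bf f0; have mf : L0 gamma f by case: bf.
have [r rE] := modular_lty Hw Nphi (rho_bounded_supp gamma_gt0 Hw Nphi bf).
rewrite rE lee_fin.
have [s ms sh] := exists_sign mh.
(* Carrying the sign of [h], this function turns the integral against [|h|] into a value of [F]
   without changing the modular. *)
pose f' t := s t * f t.
have mf' : L0 gamma f' by exact: measurable_funM.
have ff' t : dom gamma t -> `|f' t| = `|f t|.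
  by move=> dt; rewrite normrM (sh t dt).1 mul1r.
have bf' : bounded_supp gamma f'.
  by apply: (bounded_supp_le bf mf') => t dt; rewrite ff'.
have rf' : (rho f' <= r%:E)%E by rewrite -rE (@rho_eq _ _ _ _ f' f).
have := functional_add_dual_norm_le FD D0 SD bf' rf'.
have lr : D * (1 + r) <= l * (1 + r).
  rewrite ler_wpM2r// addr_ge0//; exact: (rho_le_ge0 Hw Nphi rf').
move=> /le_trans/(_ lr).
have -> : \int[mu]_(t in dom gamma) (f t * `|(l^-1 \*o h) t|) = l^-1 * F f'.
  rewrite FH// -(RintegralZ_mu _ md (bounded_supp_integrable lh bf')).
  apply: eq_Rintegral => t /set_mem dt /=.
  by rewrite normrM (ger0_norm li0) -(sh t dt).2 /f'; ring.
move=> hF; have : l^-1 * (F f' + DS) <= 1 + r by rewrite mulrC ler_pdivrMr// mulrC.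
by rewrite mulrDr; lra.
Qed.

Lemma dual_norm_formula : dnorm F =
  ereal_inf [set lambda%:E | lambda in [set lambda : R | 0 < lambda /\
    (P gamma (complementary phi) w (lambda^-1 \*o h) +
       (lambda^-1)%:E * dnorm S <= 1)%E]].
Proof.
have [D D0 FD] := dual_norm_fin gamma_gt0 Hw Nphi dF.
have [DS DS0 SD] := dual_norm_fin gamma_gt0 Hw Nphi singular_functional_dual.
apply/eqP; rewrite eq_le; apply/andP; split.
  by apply: le_ereal_inf_tmp => _ [l [l0 hl] <-]; exact: (dual_norm_le SD DS0 l0 hl).
rewrite FD; apply/lee_addgt0Pr => e e0; rewrite -EFinD.
have De0 : 0 < D + e by rewrite ltr_wpDl.
apply: ereal_inf_lbound; exists (D + e) => //; split=> //.
by apply: (P_add_le FD D0 SD) => //; rewrite lerDl ltW.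
Qed.

Lemma mem_M_space : M_space gamma (complementary phi) w h.
Proof.
have [D D0 FD] := dual_norm_fin gamma_gt0 Hw Nphi dF.
have [DS DS0 SD] := dual_norm_fin gamma_gt0 Hw Nphi singular_functional_dual.
split; first exact: lh.1.
have De0 : 0 < D + 1 by rewrite ltr_wpDl.
exists (D + 1)^-1; first by rewrite invr_gt0.
have Dl : D <= D + 1 by rewrite lerDl.
have := P_add_le FD D0 SD Dl De0; rewrite SD -EFinM -leeBrDr// -EFinB.
by move=> /le_lt_trans; apply; exact: ltry.
Qed.

End decomposition.
Theorem theorem3p6 (R : realType) (gamma : \bar R) (phi w : R -> R)
    (F : (R -> R) -> R) :
  (0 < gamma)%E ->
  N_function phi ->
  weight gamma w ->
  dual_Lambda0 gamma phi w F ->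
  exists (H S : (R -> R) -> R) (h : R -> R),
    (forall f, Lambda gamma phi w f -> F f = H f + S f) /\
    M_space gamma (complementary phi) w h /\
    dual_Lambda0 gamma phi w H /\
    (forall f, Lambda gamma phi w f ->
      (@lebesgue_measure R).-integrable (dom gamma)
        (fun t => (f t * h t)%:E) /\
      H f = \int[@lebesgue_measure R]_(t in dom gamma) (f t * h t)) /\
    dual_norm gamma phi w H = M_norm gamma (complementary phi) w h /\
    dual_Lambda0 gamma phi w S /\
    (forall f, Lambda_a gamma phi w f -> S f = 0) /\
    dual_norm gamma phi w F =
      ereal_inf [set lambda%:E | lambda in
        [set lambda : R | 0 < lambda /\
          (P gamma (complementary phi) w (lambda^-1 \*o h)
             + (lambda^-1)%:E * dual_norm gamma phi w S <= 1)%E]].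
Proof.
move=> gamma_gt0 Nphi Hw dF.
have [h lh FH] := dual_local_density gamma_gt0 Hw Nphi dF.
have dH := integral_functional_dual gamma_gt0 Hw Nphi dF lh FH.
pose H := integral_functional gamma h.
have HH u : bounded_supp gamma u -> H u = integral_functional gamma h u by [].
exists H, (singular_functional gamma F h), h; split.
  by move=> f _; rewrite /singular_functional addrC subrK.
split; first exact: mem_M_space dF lh FH.
split; first exact: dH.
split; first by move=> f Lf; split; [exact: (integrable_Lambda gamma_gt0 Hw Nphi dF lh FH Lf)|].
split.
  have S0 : dual_norm gamma phi w (singular_functional gamma H h) = 0%E.
    apply/eqP; rewrite eq_le; apply/andP; split.
      by apply: ge_ereal_sup => _ [f _ <-]; rewrite /singular_functional subrr normr0.
    have [D D0 ->] := dual_norm_fin gamma_gt0 Hw Nphi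
      (singular_functional_dual gamma_gt0 Hw Nphi dH lh HH).
    by rewrite lee_fin.
  rewrite (dual_norm_formula gamma_gt0 Hw Nphi dH lh HH) S0 /M_norm.
  congr ereal_inf; congr image; apply/seteqP.
  by split=> l /=; rewrite mule0 adde0.
split; first exact: (singular_functional_dual gamma_gt0 Hw Nphi dF lh FH).
split; first by move=> f; exact: (singular_Lambda_a gamma_gt0 Hw Nphi dF lh FH).
exact: (dual_norm_formula gamma_gt0 Hw Nphi dF lh FH).
Qed.
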